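(* Let $u_\varepsilon$ be a positive $k$-peak concentrating family of solutions of $(P_\varepsilon)$ satisfying the energy quantization condition at $\xi^0=(\xi_1^0,\dots,\xi_k^0)$, and let $\mu_\varepsilon^{(1)}<\mu_\varepsilon^{(2)}\le\cdots$ be the eigenvalues of the linearized operator $L_\varepsilon=\varepsilon^{2s}(-\Delta)^s+V-p\,u_\varepsilon^{p-1}$. Then there exists $c_0>0$, independent of $\varepsilon$, such that, for all sufficiently small $\varepsilon$, $$\mu_\varepsilon^{(l)}\le\mu_\varepsilon^{(k)}\le-c_0<0,\qquad l=1,\dots,k.$$
   Context: Setting. $N\ge1$ is an integer, $0<s<1$, $N>2s$, $1<p<2_s^*-1$ with $2_s^*=\frac{2N}{N-2s}$, and $V\in C^2_b(\mathbb R^N)$ ($C^2$, bounded together with its derivatives up to order 2) with $V_{\min}:=\inf_{\mathbb R^N}V>0$. $(-\Delta)^s$ is the fractional Laplacian (Fourier symbol $|\eta|^{2s}$). For $\varepsilon>0$, problem $(P_\varepsilon)$ is: $\varepsilon^{2s}(-\Delta)^su+V(x)u=u^p$ in $\mathbb R^N$, $u>0$, $u\in H^s(\mathbb R^N)$. Ground state. $w\in H^s(\mathbb R^N)$ is the unique positive ground state of $(-\Delta)^sw+w=w^p$ in $\mathbb R^N$ with $w(0)=\max w$ (it is radial and strictly decreasing in $|x|$). For $\lambda>0$, $w_\lambda(x):=\lambda^{1/(p-1)}w(\lambda^{1/(2s)}x)$, which solves $(-\Delta)^sw_\lambda+\lambda w_\lambda=w_\lambda^p$, and $c_\lambda:=\frac{p-1}{2(p+1)}\int_{\mathbb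 R^N}w_\lambda^{p+1}\,dy$. Energy. $\mathcal E_\varepsilon(u):=\frac12\int_{\mathbb R^N}\big(\varepsilon^{2s}|(-\Delta)^{s/2}u|^2+V(x)u^2\big)dx-\frac1{p+1}\int_{\mathbb R^N}|u|^{p+1}dx$. $k$-peak family. Let $\xi_1^0,\dots,\xi_k^0$ be different critical points of $V$. A family $u_\varepsilon$ of positive solutions of $(P_\varepsilon)$ is a positive $k$-peak concentrating family satisfying the energy quantization condition at $\xi^0=(\xi_1^0,\dots,\xi_k^0)$ if there is $r>0$ such that the balls $B_{2r}(\xi_i^0)$ are pairwise disjoint and, for all sufficiently small $\varepsilon$, each $B_r(\xi_j^0)$ contains a unique local maximum point $\xi_{\varepsilon,j}$ of $u_\varepsilon$, with $\xi_{\varepsilon,j}\to\xi_j^0$ as $\varepsilon\to0$, while $u_\varepsilon\to0$ uniformly on $\mathbb R^N\setminus\bigcup_jB_r(\xi_j^0)$; moreover $\liminf_{\varepsilon\to0}u_\varepsilon(\xi_{\varepsilon,j})>0$ for every $j$, and $\varepsilon^{-N}\mathcal E_\varepsilon(u_\varepsilon)\to\sum_{j=1}^kc_{V(\xi_j^0)}$. Eigenvalues. The eigenvalues of $\varepsilon^{2s}(-\Delta)^sv+V(x)v-p\,u_\varepsilon^{p-1}v=\mu v$, $v\in H^s(\mathbb R^N)$, are ordered with multiplicity and characterized by $$\mu_\varepsilon^{(l)}=\inf_{\substack{W\subseteq H^s(\mathbb R^N)\\ \dim W=l}}\ \max_{v\in W\setminus\{0\}}\frac{\varepsilon^{2s}\int|(-\Delta)^{s/2}v|^2+\int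 V v^2-p\int u_\varepsilon^{p-1}v^2}{\int v^2},\qquad l\in\mathbb N.$$ *)

(* Defs.v *)
From HB Require Import structures.
From mathcomp Require Import all_boot all_order all_algebra.
From mathcomp Require Import all_classical all_reals all_analysis.

Set Implicit Arguments.
Unset Strict Implicit.
Unset Printing Implicit Defensive.

Import Order.TTheory GRing.Theory Num.Theory.
Import numFieldNormedType.Exports.

Local Open Scope classical_set_scope.
Local Open Scope ring_scope.

(* R^n carries the sigma-algebra generated by the coordinates, which is its
   Borel sigma-algebra (compare n.-tuple in measurable_structure.v). *)
Section rV_measurable.
Context {R : realType} (n : nat).

Let coors (i : 'I_n) (x : 'rV[R]_n) : R := x ord0 i.

Let rV_set0 : g_sigma_preimage coors set0.
Proof. exact: sigma_algebra0. Qed.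

Let rV_setC A : g_sigma_preimage coors A -> g_sigma_preimage coors (~` A).
Proof. exact: sigma_algebraC. Qed.

Let rV_bigcup (F : (set 'rV[R]_n)^nat) :
  (forall i, g_sigma_preimage coors (F i)) ->
  g_sigma_preimage coors (\bigcup_i (F i)).
Proof. exact: sigma_algebra_bigcup. Qed.

HB.instance Definition _ := @isMeasurable.Build default_measure_display
  'rV[R]_n (g_sigma_preimage coors) rV_set0 rV_setC rV_bigcup.

Lemma measurable_coord (i : 'I_n) :
  measurable_fun [set: 'rV[R]_n] (fun x => x ord0 i).
Proof.
move=> _ Y mY; rewrite setTI; apply: sub_sigma_algebra => /=.
rewrite -bigcup_seq/=; exists i => /=; first by rewrite mem_index_enum.
by exists Y => //; rewrite setTI.
Qed.

Lemma measurable_fun_coordP d (T : measurableType d) (f : T -> 'rV[R]_n) :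
  measurable_fun [set: T] f <->
  forall i, measurable_fun [set: T] (fun t => f t ord0 i).
Proof.
split=> [mf i|mf].
  exact: (measurableT_comp (measurable_coord i) mf).
move=> _ A; rewrite setTI.
suff : (g_sigma_preimage coors : set (set 'rV[R]_n)) `<=`
    [set B | measurable (f @^-1` B)] by exact.
apply: smallest_sub.
  split=> /=; first by rewrite preimage_set0.
    by move=> B mB; rewrite setTD preimage_setC; exact: measurableC.
  by move=> F mF; rewrite preimage_bigcup; exact: bigcup_measurable.
rewrite -bigcup_seq/= => B [i _] [Y mY <-] /=.
by rewrite setTI -[X in measurable X]setTI; exact: mf.
Qed.

End rV_measurable.

(* Lebesgue measure on R^n, by recursion: on R^0 the unit mass at the origin,
   and on R^(1+n) the image of the product of Lebesgue measure on R and
   Lebesgue measure on R^n under (t, x) |-> (t, x_1, ..., x_n). *)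
Section rV_lebesgue.
Context {R : realType}.

Definition rV_cons n (tx : R * 'rV[R]_n) : 'rV[R]_n.+1 :=
  row_mx (const_mx tx.1 : 'rV[R]_1) tx.2.

Definition rV_uncons n (x : 'rV[R]_n.+1) : R * 'rV[R]_n :=
  (x ord0 ord0, @rsubmx R 1 1 n x).

Lemma rV_consK n : cancel (@rV_cons n) (@rV_uncons n).
Proof.
move=> [t x]; rewrite /rV_uncons /rV_cons row_mxKr; congr pair.
have -> : ord0 = lshift n (ord0 : 'I_1) :> 'I_n.+1 by exact: val_inj.
by rewrite (@row_mxEl R 1 1 n) mxE.
Qed.

Lemma rV_unconsK n : cancel (@rV_uncons n) (@rV_cons n).
Proof.
move=> x; rewrite /rV_uncons /rV_cons /=.
rewrite (_ : const_mx _ = @lsubmx R 1 1 n x); first exact: (@hsubmxK R 1 1 n x).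
apply/rowP => j; rewrite !mxE ord1; congr (x _ _).
by apply: val_inj; rewrite /= (ord1 j).
Qed.

Lemma measurable_rV_cons n : measurable_fun [set: R * 'rV[R]_n] (@rV_cons n).
Proof.
apply/measurable_fun_coordP => i.
have [j|j] := @splitP 1 n i => ij.
  have -> : i = lshift n j by apply: val_inj.
  rewrite (_ : (fun _ => _) = fst) //; apply/funext => -[t x].
  by rewrite (@row_mxEl R 1 1 n) mxE.
have -> : i = rshift 1 j by apply: val_inj.
rewrite (_ : (fun _ => _) = (fun x : 'rV[R]_n => x ord0 j) \o snd).
  exact: measurableT_comp (measurable_coord j) _.
by apply/funext => -[t x]; rewrite (@row_mxEr R 1 1 n).
Qed.

Lemma measurable_rV_uncons n :
  measurable_fun [set: 'rV[R]_n.+1] (@rV_uncons n).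
Proof.
apply/measurable_fun_pairP; split; first exact: measurable_coord.
apply/measurable_fun_coordP => i.
have -> : (fun t : 'rV[R]_n.+1 => (snd \o @rV_uncons n) t ord0 i) =
    (fun x => x ord0 (@rshift 1 n i)) by apply/funext => x /=; rewrite !mxE.
exact: measurable_coord.
Qed.

Section step.
Variables (n : nat) (mu : {sigma_finite_measure set 'rV[R]_n -> \bar R}).

Definition rV_lebesgue_step : set 'rV[R]_n.+1 -> \bar R :=
  pushforward ((@lebesgue_measure R) \x mu)%E (@rV_cons n).

HB.instance Definition _ := Measure.copy rV_lebesgue_step
  (measure_function_pushforward__canonical__measure_function_Measure
    (@lebesgue_measure R \x mu)%E (@measurable_rV_cons n)).

Let rV_lebesgue_step_sigma_finite : sigma_finite setT rV_lebesgue_step.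
Proof.
have /sigma_finiteP[F [TF ndF Foo]] := sigma_finiteT (@lebesgue_measure R).
have /sigma_finiteP[G [TG ndG Goo]] := sigma_finiteT mu.
exists (fun k => @rV_uncons n @^-1` (F k `*` G k)).
  rewrite -preimage_bigcup (_ : \bigcup_k _ = setT) ?preimage_setT//.
  rewrite -setXTT TF TG; apply/seteqP; split => -[x y] /=.
    by move=> [k _ []] /= *; split; exists k.
  move=> [[i _ Fix] [j _ Gjy]]; exists (maxn i j) => //; split.
    by move: x Fix; exact/subsetPset/ndF/leq_maxl.
  by move: y Gjy; exact/subsetPset/ndG/leq_maxr.
move=> k; have [mFk Fkoo] := Foo k; have [mGk Gkoo] := Goo k; split.
  by rewrite -[X in measurable X]setTI; apply: measurable_rV_uncons => //;
    exact: measurableX.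
rewrite /rV_lebesgue_step /pushforward -comp_preimage.
rewrite (_ : _ \o _ = id); last by apply/funext => x /=; rewrite rV_consK.
by rewrite product_measure1E// lte_mul_pinfty// ge0_fin_numE.
Qed.

HB.instance Definition _ := Measure_isSigmaFinite.Build _ _ _
  rV_lebesgue_step rV_lebesgue_step_sigma_finite.

End step.

Fixpoint lebesgueN (n : nat) : {sigma_finite_measure set 'rV[R]_n -> \bar R} :=
  match n with
  | 0 => @dirac _ 'rV[R]_0 0 R
  | n.+1 => rV_lebesgue_step (lebesgueN n)
  end.

End rV_lebesgue.

Section euclidean.
Context {R : realType} {N : nat}.
Local Notation E := 'rV[R]_N.
Implicit Types x y : E.

Definition dotp x y : R := \sum_(i < N) x ord0 i * y ord0 i.

(* The library's norm on matrices is the sup norm, which has the same topology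
   but not the same balls. *)
Definition enorm x : R := Num.sqrt (dotp x x).

Definition eball x (r : R) : set E := [set y | enorm (y - x) < r].

Definition partial (i : 'I_N) (f : E -> R) (x : E) : R :=
  'D_(delta_mx ord0 i) f x.

(* C^m, bounded together with all partial derivatives of order at most m. *)
Fixpoint Cb (m : nat) (f : E -> R) : Prop :=
  [/\ continuous f, [bounded f x | x in [set: E]] &
   match m with
   | 0 => True
   | m'.+1 => forall i : 'I_N,
       (forall x, derivable f x (delta_mx ord0 i)) /\ Cb m' (partial i f)
   end].

Definition critical_point (f : E -> R) (x : E) := forall i, partial i f x = 0.

Definition local_max (f : E -> R) (x : E) := \forall y \near x, f y <= f x.

End euclidean.

Section fractional.
Context {R : realType} {N : nat}.
Local Notation E := 'rV[R]_N.
Local Notation leb := (@lebesgueN R N).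
Implicit Types f g u v : E -> R.

Definition L2 : set (E -> R) := [set f | f \in Lfun leb 2%:E].

Definition ae0 f := {ae leb, forall x, f x = 0}.

Definition cvgL2 (F : nat -> E -> R) f :=
  Lnorm leb 2%:E (EFin \o (F n \- f)) @[n --> \oo] --> 0%E.

(* Real and imaginary parts of the integral of u(x) exp(- i eta.x) over the
   ball of radius n. *)
Definition fourier_re u (n : nat) (eta : E) : R :=
  \int[leb]_(x in eball 0 n%:R) (u x * cos (dotp eta x)).

Definition fourier_im u (n : nat) (eta : E) : R :=
  \int[leb]_(x in eball 0 n%:R) (- (u x * sin (dotp eta x))).

(* Plancherel: the Fourier transform of u in L^2 is the L^2 limit a + i b of the
   truncated Fourier integrals.  The normalization (2 pi)^(-N/2) is immaterial
   below, where the transform only enters through multipliers. *)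
Definition is_fourier u (a b : E -> R) :=
  [/\ L2 u, L2 a, L2 b, cvgL2 (fourier_re u) a & cvgL2 (fourier_im u) b].

Definition multiplier (t : R) (a : E -> R) : E -> R :=
  fun eta => enorm eta `^ t * a eta.

Definition Hs (s : R) : set (E -> R) :=
  [set u | exists a b, [/\ is_fourier u a b,
                           L2 (multiplier s a) & L2 (multiplier s b)]].

(* g = (- Laplacian)^sigma u, whose Fourier symbol is |eta|^(2 sigma). *)
Definition is_fraclap (sigma : R) u g :=
  exists a b, is_fourier u a b /\
    is_fourier g (multiplier (2 * sigma) a) (multiplier (2 * sigma) b).

(* is_fraclap determines its result up to a null set; a representative is
   chosen. *)
Definition fraclap (sigma : R) u : E -> R :=
  xget (fun=> 0) [set g | is_fraclap sigma u g].

(* The form domain of the Schroedinger operator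
   eps^(2s) (- Laplacian)^s + V is H^s; the equations are understood in the
   corresponding weak sense. *)
Definition weak_solution (s eps : R) (V : E -> R) (nl : R -> R) u :=
  Hs s u /\ forall phi, Hs s phi ->
    eps `^ (2 * s) *
       \int[leb]_x (fraclap (s / 2) u x * fraclap (s / 2) phi x)
     + \int[leb]_x (V x * u x * phi x)
     = \int[leb]_x (nl (u x) * phi x).

(* Peaks are located pointwise, so u denotes the continuous representative. *)
Definition positive_solution (s p eps : R) (V : E -> R) u :=
  [/\ continuous u, forall x, 0 < u x &
      weak_solution s eps V (fun t => t `^ p) u].

Definition energy (s p eps : R) (V : E -> R) u : R :=
  2^-1 * \int[leb]_x (eps `^ (2 * s) * fraclap (s / 2) u x ^+ 2
                       + V x * u x ^+ 2)
   - (p + 1)^-1 * \int[leb]_x (`|u x| `^ (p + 1)).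

(* A ground state is a nontrivial solution of least energy, sign-changing
   competitors included; (- Laplacian)^s w + w = w^p is the case eps = 1,
   V = 1. *)
Definition ground_state (s p : R) (w : E -> R) :=
  [/\ positive_solution s p 1 (fun=> 1) w,
      forall x, w x <= w 0 &
      forall v, weak_solution s 1 (fun=> 1) (fun t => `|t| `^ (p - 1) * t) v ->
        ~ ae0 v -> energy s p 1 (fun=> 1) w <= energy s p 1 (fun=> 1) v].

Definition rescaled (s p : R) (w : E -> R) (lam : R) : E -> R :=
  fun x => lam `^ (p - 1)^-1 * w (lam `^ (2 * s)^-1 *: x).

Definition ground_level (s p : R) (w : E -> R) (lam : R) : R :=
  (p - 1) / (2 * (p + 1)) *
  \int[leb]_x (rescaled s p w lam x `^ (p + 1)).

Definition peak_family (s p : R) (V w : E -> R) (k : nat) (xi0 : 'I_k -> E)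
    (u : R -> E -> R) :=
  (\forall eps \near 0^'+, positive_solution s p eps V (u eps)) /\
  exists (r : R) (xi : R -> 'I_k -> E), 0 < r /\
  [/\ forall i j, i != j ->
        eball (xi0 i) (2 * r) `&` eball (xi0 j) (2 * r) = set0,
      (\forall eps \near 0^'+, forall j,
         [set x | eball (xi0 j) r x /\ local_max (u eps) x] = [set xi eps j])
      /\ (forall j, xi eps j @[eps --> 0^'+] --> xi0 j),
      forall delta : R, 0 < delta -> \forall eps \near 0^'+, forall x,
        (forall j, ~ eball (xi0 j) r x) -> `|u eps x| < delta,
      forall j,
        (0 < limf_einf (fun eps => (u eps (xi eps j))%:E) (0 : R)^'+)%E &
      eps ^- N * energy s p eps V (u eps) @[eps --> 0^'+]
        --> \sum_(j < k) ground_level s p w (V (xi0 j))].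

(* W is an l-dimensional subspace of H^s.  Elements of H^s are represented by
   functions, so linear independence is modulo null sets. *)
Definition Hs_subspace (s : R) (l : nat) (W : set (E -> R)) :=
  exists e : 'I_l -> E -> R,
    [/\ forall i, Hs s (e i),
        forall c : 'I_l -> R,
          ae0 (fun x => \sum_(i < l) c i * e i x) -> forall i, c i = 0 &
        W = [set v | exists c : 'I_l -> R,
               v = (fun x => \sum_(i < l) c i * e i x)]].

Definition rayleigh (s p eps : R) (V u v : E -> R) : R :=
  (eps `^ (2 * s) * \int[leb]_x (fraclap (s / 2) v x ^+ 2)
    + \int[leb]_x (V x * v x ^+ 2)
    - p * \int[leb]_x (u x `^ (p - 1) * v x ^+ 2))
   / \int[leb]_x (v x ^+ 2).

(* The l-th eigenvalue, counted with multiplicity from l = 1, of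
   eps^(2s) (- Laplacian)^s + V - p u^(p-1). *)
Definition eigenvalue_lin (s p eps : R) (V u : E -> R) (l : nat) : \bar R :=
  ereal_inf [set ereal_sup [set (rayleigh s p eps V u v)%:E
                               | v in W `&` [set v | ~ ae0 v]]
                | W in Hs_subspace s l].

End fractional.

(* Main.v *)
Require Import Defs.
From HB Require Import structures.
From mathcomp Require Import all_boot all_order all_algebra.
From mathcomp Require Import all_classical all_reals all_analysis.
From mathcomp Require Import measurable_realfun.
From mathcomp Require Import ring lra.

(** The k-th eigenvalue is bounded by the Rayleigh quotient on any k-dimensional
    space of test functions. The space used here is spanned by the tops of the
    peaks, [psi_j = max (u - th) 0] on the j-th ball, for a small height [th]
    that does not depend on the parameter. For [v = sum_j c_j psi_j] one compares
    the form of the fractional Laplacian at [(v, v)] with its value at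
    [(u, phi)], where [phi = sum_j c_j ^ 2 psi_j], since the latter is given by
    the equation. Write [u = tau + sum_j psi_j] with [tau = min u th].

    - The form of [tau] and [psi_j] is nonnegative, because [tau] is maximal where
      [psi_j] is positive.
    - The forms of [sum_j psi_j] with [phi], and of [v] with [v], differ by the
      interactions of different peaks. These are at most a constant times
      [int psi_i * int psi_j], because the peaks are at a positive distance, and
      bounded energy bounds the sum of the [int psi_j]. The factor
      [eps ^ (2 s)] in front of the form makes them negligible.

    Hence the quadratic form at [v] is at most
    [sum_j c_j ^ 2 int psi_j (u ^ p - V u + V psi_j - p u ^ (p - 1) psi_j + dl)]
    with [dl] small, and with [psi_j = u - th] the bracket is
    [- u ^ (p - 1) ((p - 1) u - p th) - V th + dl]. For [u] large compared with
    [th] it is negative by superlinearity, and for [u] comparable to [th] because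
    [u ^ (p - 1)] is then small compared with [V]: it is at most [- c0 psi_j],
    with [c0] depending only on [p], [th] and the infimum of [V] ([peak_ineq],
    [rayleigh_excess]). This bounds the Rayleigh quotient by [- c0].

    All statements about the fractional form are reduced to the heat flow. The
    form [heat_form t f g] of the identity minus the heat flow at time [t] is
    bounded on L2, and its sign and size can be read off from the heat kernel.
    The power [|eta| ^ (2 s)] is a superposition of the numbers
    [1 - exp (- t |eta| ^ 2)] ([subordination]), so that the form of the
    fractional Laplacian is an integral of heat forms over the times
    ([fraclap_form]), and [H^s] consists of the functions for which this integral
    is finite ([HsP]). Inequalities between heat forms at each time therefore
    suffice, both for the comparison above ([heat_form_excess_form]) and to see
    that the peaks belong to [H^s] ([heat_form_excess_le]).

    The link with the Fourier transform rests on Plancherel's theorem. It is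
    proved for the Hartley transform, the difference of the real and imaginary
    parts of the Fourier transform: with a Gaussian weight the inner product of
    two transforms is computed by Fubini's theorem from the transform of a
    Gaussian and gives the heat kernel ([gaussian_parseval_L1]); the weight is
    removed by the continuity of the heat flow at time zero
    ([heat_form_invS_cvg0]). *)

Set Implicit Arguments.
Unset Strict Implicit.
Unset Printing Implicit Defensive.

Import Order.TTheory GRing.Theory Num.Theory.
Import numFieldNormedType.Exports.

Local Open Scope classical_set_scope.
Local Open Scope ring_scope.

(** * Square-integrable functions and L2 convergence *)
Section discriminant.
Variable R : realFieldType.

(** The discriminant form of Cauchy-Schwarz, degenerate forms included: when
    [c = 0] a well chosen [t] would make the affine function negative unless
    [b = 0]. *)
Lemma psd_discriminant (a b c : R) :
  (forall t, 0 <= a + 2 * t * b + t ^+ 2 * c) -> b ^+ 2 <= a * c.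
Proof.
move=> h.
have [c0|c0] := eqVneq c 0.
  suff -> : b = 0 by rewrite c0 expr0n mulr0.
  apply/eqP/negP => /negP b0; have := h (- (a + 1) / (2 * b)).
  rewrite c0 mulr0 addr0.
  have -> : a + 2 * (- (a + 1) / (2 * b)) * b = -1 by field.
  by rewrite lerNr oppr0 ler10.
have c_gt0 : 0 < c.
  rewrite lt_neqAle eq_sym c0 /= leNgt; apply/negP => cneg.
  have := h ((a + 1 + b ^+ 2) / - c + 1); have := h (- ((a + 1 + b ^+ 2) / - c + 1)).
  have := h 0; rewrite mulr0 mul0r expr0n mul0r !addr0 => a0.
  set t := (_ / _ + 1) => h1 h2.
  have t1 : 1 <= t by rewrite /t lerDr divr_ge0 ?oppr_ge0 ?ltW//; nra.
  have tc : t * - c = a + 1 + b ^+ 2 - c by rewrite /t; field.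
  have : 0 <= a + t ^+ 2 * c by nra.
  have -> : t ^+ 2 * c = - (t * (t * - c)) by ring.
  by rewrite tc; nra.
have := h (- b / c).
have -> : a + 2 * (- b / c) * b + (- b / c) ^+ 2 * c = (a * c - b ^+ 2) / c by field.
by rewrite pmulr_lge0 ?invr_gt0// subr_ge0.
Qed.

End discriminant.

Section L2_toolkit.
Context d (T : measurableType d) (R : realType) (mu : {measure set T -> \bar R}).
Implicit Types f g h : T -> R.

Definition itg f := mu.-integrable setT (EFin \o f).

Definition sqint f := f \in Lfun mu 2%:E.

Definition inner f g : R := \int[mu]_x (f x * g x).

Lemma itg_meas f : itg f -> measurable_fun setT f.
Proof. by move=> /integrableP[/measurable_EFinP]. Qed.

Lemma sqint_meas f : sqint f -> measurable_fun setT f.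
Proof. by rewrite /sqint inE => /andP[/[!inE]]. Qed.

Lemma itgP f : measurable_fun setT f ->
  itg f <-> (\int[mu]_x `|f x|%:E < +oo)%E.
Proof.
move=> mf; split=> [/integrableP[_]//|fi].
by apply/integrableP; split => //; exact/measurable_EFinP.
Qed.

Lemma itg_le f g : measurable_fun setT f -> itg g ->
  (forall x, `|f x| <= g x) -> itg f.
Proof.
move=> mf ig fg; apply: le_integrable ig => //; first exact/measurable_EFinP.
by move=> x _ /=; rewrite lee_fin (le_trans (fg x))// ler_norm.
Qed.

Lemma itgD f g : itg f -> itg g -> itg (fun x => f x + g x).
Proof. exact: (@integrableD _ _ _ mu setT measurableT (EFin \o f) (EFin \o g)). Qed.

Lemma itgZ c f : itg f -> itg (fun x => c * f x).
Proof. by move=> fi; exact: (integrableZl measurableT c fi). Qed.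

Lemma itgN f : itg f -> itg (fun x => - f x).
Proof. by move=> fi; under [X in itg X]eq_fun do rewrite -mulN1r; exact: itgZ. Qed.

Lemma itgB f g : itg f -> itg g -> itg (fun x => f x - g x).
Proof. by move=> fi gi; apply: itgD => //; exact: itgN. Qed.

Lemma itg_norm f : itg f -> itg (fun x => `|f x|).
Proof. by move=> fi; exact: (integrable_abse fi). Qed.

Lemma itg0 : itg (fun=> 0).
Proof. exact: integrable0. Qed.

Lemma sqintP f : sqint f <->
  measurable_fun setT f /\ itg (fun x => f x ^+ 2).
Proof.
split=> [sf|[mf fi]]; first by split; [exact: sqint_meas|exact: Lfun2_integrable_sqr].
rewrite /sqint inE; apply/andP; split; rewrite inE//=.
rewrite /finite_norm unlock poweR_lty//.
move/itgP : fi => /(_ (measurable_funX _ mf)); apply: le_lt_trans.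
rewrite le_eqVlt; apply/orP; left; apply/eqP/eq_integral => x _ /=.
by rewrite (powR_mulrn 2)// normrX.
Qed.

Lemma itgM f g : sqint f -> sqint g -> itg (fun x => f x * g x).
Proof. by move=> fi gi; apply/Lfun1_integrable; exact: Lfun2_mul_Lfun1. Qed.

Lemma sqint_le f g : measurable_fun setT f -> sqint g ->
  (forall x, `|f x| <= `|g x|) -> sqint f.
Proof.
move=> mf /sqintP[mg gi] fg; apply/sqintP; split => //.
apply: itg_le gi _; first exact: measurable_funX.
by move=> x; rewrite normrX -[leRHS]real_normK ?num_real// lerXn2r ?nnegrE.
Qed.

Lemma sqintD f g : sqint f -> sqint g -> sqint (fun x => f x + g x).
Proof.
move=> /sqintP[mf fi] /sqintP[mg gi]; apply/sqintP; split; first exact: measurable_funD.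
apply: (@itg_le _ (fun x => 2 * f x ^+ 2 + 2 * g x ^+ 2)).
- by apply: measurable_funX; exact: measurable_funD.
- by apply: itgD; exact: itgZ.
- move=> x; rewrite ger0_norm ?sqr_ge0// -subr_ge0.
  by rewrite (_ : _ - _ = (f x - g x) ^+ 2) ?sqr_ge0//; ring.
Qed.

Lemma sqintZ c f : sqint f -> sqint (fun x => c * f x).
Proof.
move=> /sqintP[mf fi]; apply/sqintP; split; first exact: measurable_funM.
by under [X in itg X]eq_fun do rewrite exprMn; exact: itgZ.
Qed.

Lemma sqintN f : sqint f -> sqint (fun x => - f x).
Proof. by move=> fi; under [X in sqint X]eq_fun do rewrite -mulN1r; exact: sqintZ. Qed.

Lemma sqintB f g : sqint f -> sqint g -> sqint (fun x => f x - g x).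
Proof. by move=> fi gi; apply: sqintD => //; exact: sqintN. Qed.

Lemma sqint0 : sqint (fun=> 0).
Proof.
apply/sqintP; split => //; under [X in itg X]eq_fun do rewrite expr0n/=.
exact: itg0.
Qed.

Lemma sqint_sum n (F : 'I_n -> T -> R) :
  (forall i, sqint (F i)) -> sqint (fun x => \sum_(i < n) F i x).
Proof.
elim: n F => [|n IH] F Fi.
  by under [X in sqint X]eq_fun do rewrite big_ord0; exact: sqint0.
by under [X in sqint X]eq_fun do rewrite big_ord_recr/=; apply: sqintD => //; exact: IH.
Qed.

Lemma innerC f g : inner f g = inner g f.
Proof. by apply: eq_Rintegral => x _; rewrite mulrC. Qed.

Lemma innerDl f g h : sqint f -> sqint g -> sqint h ->
  inner (fun x => f x + g x) h = inner f h + inner g h.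
Proof.
move=> fi gi hi; rewrite /inner -RintegralD//; [|exact: itgM..].
by apply: eq_Rintegral => x _; rewrite mulrDl.
Qed.

Lemma innerZl c f h : sqint f -> sqint h -> inner (fun x => c * f x) h = c * inner f h.
Proof.
move=> fi hi; rewrite /inner -RintegralZl//; last exact: itgM.
by apply: eq_Rintegral => x _; rewrite mulrA.
Qed.

Lemma innerBl f g h : sqint f -> sqint g -> sqint h ->
  inner (fun x => f x - g x) h = inner f h - inner g h.
Proof.
move=> fi gi hi; rewrite /inner -RintegralB//; [|exact: itgM..].
by apply: eq_Rintegral => x _; rewrite mulrBl.
Qed.

Lemma innerDr f g h : sqint f -> sqint g -> sqint h ->
  inner h (fun x => f x + g x) = inner h f + inner h g.
Proof. by move=> *; rewrite innerC innerDl// !(innerC h). Qed.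

Lemma innerZr c f h : sqint f -> sqint h -> inner h (fun x => c * f x) = c * inner h f.
Proof. by move=> *; rewrite innerC innerZl// (innerC h). Qed.

Lemma innerBr f g h : sqint f -> sqint g -> sqint h ->
  inner h (fun x => f x - g x) = inner h f - inner h g.
Proof. by move=> *; rewrite innerC innerBl// !(innerC h). Qed.

Lemma inner_ge0 f : 0 <= inner f f.
Proof. by apply: Rintegral_ge0 => x _; rewrite -expr2 sqr_ge0. Qed.

Lemma Rintegral_sqr f : \int[mu]_x (f x ^+ 2) = inner f f.
Proof. by apply: eq_Rintegral => x _; rewrite expr2. Qed.

Lemma inner_sqrD f g : sqint f -> sqint g ->
  inner (fun x => f x + g x) (fun x => f x + g x) =
  inner f f + 2 * inner f g + inner g g.
Proof.
move=> fi gi; rewrite innerDl//; last exact: sqintD.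
by rewrite !innerDr// (innerC g f); ring.
Qed.

Lemma inner_AM f g : sqint f -> sqint g -> `|inner f g| <= 2^-1 * (inner f f + inner g g).
Proof.
move=> fi gi; rewrite ler_norml; apply/andP; split.
  have := inner_ge0 (fun x => f x + g x); rewrite inner_sqrD//; lra.
have := inner_ge0 (fun x => f x - g x); rewrite innerBl//; last exact: sqintB.
by rewrite !innerBr// (innerC g f); lra.
Qed.

Lemma inner_eq0 f : sqint f -> inner f f = 0 -> {ae mu, forall x, f x = 0}.
Proof.
move=> /sqintP[mf fi] f0.
have : (\int[mu]_x `|(f x ^+ 2)%:E| = 0)%E.
  rewrite -[0%E]/(0%:E) -f0 /inner /Rintegral fineK; last first.
    under eq_integral do rewrite -expr2.
    exact: integrable_fin_num fi.
  by apply: eq_integral => x _; rewrite -expr2 gee0_abs// lee_fin sqr_ge0.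
move/ae_eq_integral_abs => /(_ measurableT)[].
  by apply/measurable_EFinP; exact: measurable_funX.
move=> N [mN N0 sN]; exists N; split => // x fx; apply: sN => /= h; apply: fx.
by have /eqP := h I; rewrite eqe sqrf_eq0 => /eqP.
Qed.

Lemma eq_ae_inner f g h : sqint f -> sqint g -> measurable_fun setT h ->
  {ae mu, forall x, f x = g x} -> inner f h = inner g h.
Proof.
move=> /sqint_meas mf /sqint_meas mg mh fg; rewrite /inner /Rintegral.
congr fine; apply: ae_eq_integral => //.
- by apply/measurable_EFinP; exact: measurable_funM.
- by apply/measurable_EFinP; exact: measurable_funM.
- by move: fg; apply: filterS => x -> _.
Qed.

Lemma Lnorm2E f : sqint f ->
  Lnorm mu 2%:E (EFin \o f) = (Num.sqrt (inner f f))%:E.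
Proof.
move=> /sqintP[mf fi]; rewrite unlock.
rewrite (_ : (\int[mu]_x _)%E = (inner f f)%:E); last first.
  rewrite /inner /Rintegral fineK; last first.
    by under eq_integral do rewrite -expr2; exact: integrable_fin_num fi.
  apply: eq_integral => x _; rewrite /= (powR_mulrn 2)//.
  by rewrite -normrX ger0_norm ?sqr_ge0// expr2.
by rewrite poweR_EFin powR12_sqrt ?inner_ge0.
Qed.

End L2_toolkit.

Section fatou.
Context d (T : measurableType d) (R : realType) (mu : {measure set T -> \bar R}).
Local Open Scope ereal_scope.

Lemma limn_einf_le (u : (\bar R)^nat) c : (forall n, u n <= c) -> limn_einf u <= c.
Proof.
move=> uc; apply: le_trans (limn_einf_sup u) _.
rewrite limn_esup_lim; apply: lime_le; first exact: is_cvg_esups.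
by apply: nearW => n; apply: ge_ereal_sup => _ [m _ <-].
Qed.

(** Fatou's lemma in the form in which it passes bounds to limits. *)
Lemma fatou_le (g : nat -> T -> \bar R) (g0 : T -> \bar R) c :
  (forall n, measurable_fun setT (g n)) -> measurable_fun setT g0 ->
  (forall n x, 0 <= g n x) -> (forall x, 0 <= g0 x) ->
  {ae mu, forall x, g n x @[n --> \oo] --> g0 x} ->
  (forall n, \int[mu]_x g n x <= c) -> \int[mu]_x g0 x <= c.
Proof.
move=> mg mg0 gge0 g0ge0 gg0 gc.
have -> : \int[mu]_x g0 x = \int[mu]_x limn_einf (g^~ x).
  apply: ae_eq_integral => //.
    rewrite (_ : (fun x => _) = (fun x => - limn_esup (fun n => - g n x))); last first.
      apply/funext => x; rewrite -[in LHS](oppeK (limn_einf _)) -limn_esupN.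
      by congr (- limn_esup _).
    apply: measurableT_comp => //; apply: measurable_fun_limn_esup => n.
    exact: measurableT_comp.
  move: gg0; apply: filterS => x gx _.
  by have [-> _] := cvg_limn_einf_sup gx.
apply: le_trans (fatou mu measurableT mg _) _ => //.
exact: limn_einf_le.
Qed.

End fatou.

Section L2_convergence.
Context d (T : measurableType d) (R : realType) (mu : {measure set T -> \bar R}).
Implicit Types (f g h : T -> R) (F G : nat -> T -> R).
Notation inner := (inner mu).
Notation sqint := (sqint mu).
Notation itg := (itg mu).

Definition l2cvg F f := inner (fun x => F n x - f x) (fun x => F n x - f x) @[n --> \oo] --> (0
  : R).

(** Convergence in norm is restated with inner products, in which the
    computations below take place. *)
Lemma l2cvgP F f : (forall n, sqint (F n)) -> sqint f ->
  Lnorm mu 2%:E (EFin \o (F n \- f)) @[n --> \oo] --> 0%E <-> l2cvg F f.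
Proof.
move=> Fi fi.
have -> : (fun n => Lnorm mu 2%:E (EFin \o (F n \- f))) =
    (fun n => (Num.sqrt (inner (fun x => F n x - f x) (fun x => F n x - f x)))%:E).
  by apply/funext => n; rewrite Lnorm2E//; exact: sqintB.
split=> [/fine_cvgP[_]/= h|h].
  have : (Num.sqrt (inner (fun x => F n x - f x) (fun x => F n x - f x))) ^+ 2 @[n --> \oo] -->
    (0 : R) ^+ 2.
    by apply: (@continuous_cvg _ _ _ _ _ _ (fun y : R => y ^+ 2)) => //; exact: exprn_continuous.
  rewrite expr0n/=; apply: cvg_trans; apply: near_eq_cvg; apply: nearW => n /=.
  by rewrite sqr_sqrtr// inner_ge0.
apply/fine_cvgP; split; first exact: nearW.
rewrite -[X in _ --> X]sqrtr0.
by apply: (@continuous_cvg _ _ _ _ _ _ (@Num.sqrt R)) => //; exact: sqrt_continuous.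
Qed.

(** Cauchy-Schwarz for the form [b] itself, followed by the bound on its
    diagonal; applied to the inner product and to the heat form. *)
Lemma form_cvg (b : (T -> R) -> (T -> R) -> R) (C : R) :
  (forall f g h, sqint f -> sqint g -> sqint h -> b (fun x => f x + g x) h = b f h + b g h) ->
  (forall c f h, sqint f -> sqint h -> b (fun x => c * f x) h = c * b f h) ->
  (forall f g, sqint f -> sqint g -> b f g = b g f) ->
  (forall f, sqint f -> 0 <= b f f <= C * inner f f) ->
  forall F G f g, (forall n, sqint (F n)) -> sqint f -> (forall n, sqint (G n)) -> sqint g ->
  l2cvg F f -> l2cvg G g -> b (F n) (G n) @[n --> \oo] --> b f g.
Proof.
move=> bD bZ bC b0 F G f g Fi fi Gi gi Ff Gg.
pose r n x := F n x - f x; pose s n x := G n x - g x.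
have ri n : sqint (r n) by exact: sqintB.
have si n : sqint (s n) by exact: sqintB.
have CS u v : sqint u -> sqint v -> b u v ^+ 2 <= b u u * b v v.
  move=> ui vi; apply: psd_discriminant => t.
  have ti : sqint (fun x => t * v x) by exact: sqintZ.
  have uvi := sqintD ui ti.
  have /andP[+ _] := b0 _ uvi.
  rewrite bD// (bC u)// (bC (fun x => t * v x))// !bD// !bZ// (bC u (fun x => t * v x))// bZ//
    (bC v u)//.
  rewrite (bC v (fun x => t * v x))// bZ//.
  by move=> /le_trans; apply; rewrite le_eqVlt; apply/orP; left; apply/eqP; ring.
have b_cvg0 H u : (forall n, sqint (H n)) -> sqint u ->
    inner (H n) (H n) @[n --> \oo] --> (0 : R) -> b u (H n) @[n --> \oo] --> (0 : R).
  move=> Hi ui H0; apply/norm_cvg0P.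
  apply: (@squeeze_cvgr _ _ _ _ (fun=> 0) (fun n => Num.sqrt (b u u * C) * Num.sqrt (inner (H n)
    (H n)))).
  - apply: nearW => n; rewrite normr_ge0/=; have /andP[bu0 _] := b0 _ ui.
    have /andP[bH0 bHC] := b0 _ (Hi n).
    have [C0|C0] := leP 0 C; last first.
      have -> : b u (H n) = 0.
        apply/eqP; rewrite -sqrf_eq0 eq_le sqr_ge0 andbT; apply: (le_trans (CS _ _ ui (Hi n))).
        rewrite mulr_ge0_le0//; apply: (le_trans bHC); rewrite mulr_le0_ge0 ?inner_ge0//.
        exact: ltW.
      by rewrite normr0 mulr_ge0// sqrtr_ge0.
    rewrite -sqrtrM ?mulr_ge0// -sqrtr_sqr ler_wsqrtr//.
    by apply: (le_trans (CS _ _ ui (Hi n))); rewrite -mulrA ler_wpM2l.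
  - exact: cvg_cst.
  - rewrite -[X in _ --> X](mulr0 (Num.sqrt (b u u * C))); apply: cvgMl_tmp.
    rewrite -[X in _ --> X]sqrtr0.
    by apply: (@continuous_cvg _ _ _ _ _ _ (@Num.sqrt R)) => //; exact: sqrt_continuous.
have E n : b (F n) (G n) = b f g + b f (s n) + b g (r n) + b (r n) (s n).
  have -> : F n = (fun x => f x + r n x) by apply/funext => x; rewrite /r addrC subrK.
  have -> : G n = (fun x => g x + s n x) by apply/funext => x; rewrite /s addrC subrK.
  have gsi : sqint (fun x => g x + s n x) by exact: sqintD.
  rewrite (bD _ _ _ fi (ri n) gsi) (bC _ _ fi gsi) (bC _ _ (ri n) gsi).
  rewrite (bD _ _ _ gi (si n) fi) (bD _ _ _ gi (si n) (ri n)).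
  by rewrite (bC _ _ gi fi) (bC _ _ (si n) fi) (bC _ _ (si n) (ri n)); ring.
rewrite (funext E).
rewrite -[X in _ --> X]addr0 -[X in _ --> X + _]addr0 -[X in _ --> X + _ + _]addr0.
apply: cvgD; first apply: cvgD; first apply: cvgD.
- exact: cvg_cst.
- exact: b_cvg0.
- exact: b_cvg0.
- apply/norm_cvg0P; apply: (@squeeze_cvgr _ _ _ _ (fun=> 0)
    (fun n => 2^-1 * (C * inner (r n) (r n) + C * inner (s n) (s n)))).
  + apply: nearW => n; rewrite normr_ge0/=.
    have /andP[r0 rC] := b0 _ (ri n); have /andP[s0 sC] := b0 _ (si n).
    apply: (@le_trans _ _ (2^-1 * (b (r n) (r n) + b (s n) (s n)))); last first.
      by rewrite ler_wpM2l ?invr_ge0//; exact: lerD.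
    rewrite -ler_sqr ?nnegrE ?mulr_ge0 ?invr_ge0 ?addr_ge0// real_normK ?num_real//.
    apply: (le_trans (CS _ _ (ri n) (si n))).
    by rewrite exprMn; have := sqr_ge0 (b (r n) (r n) - b (s n) (s n)); lra.
  + exact: cvg_cst.
  + have -> : 0 = 2^-1 * (C * 0 + C * 0) :> R by ring.
    by apply: cvgMl_tmp; apply: cvgD; apply: cvgMl_tmp.
Qed.

Lemma inner_cvg F G f g : (forall n, sqint (F n)) -> sqint f -> (forall n, sqint (G n)) ->
  sqint g ->
  l2cvg F f -> l2cvg G g -> inner (F n) (G n) @[n --> \oo] --> inner f g.
Proof.
apply: (@form_cvg _ 1).
- by move=> *; exact: innerDl.
- by move=> *; exact: innerZl.
- by move=> *; exact: innerC.
- by move=> u ui; rewrite inner_ge0 mul1r lexx.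
Qed.

Lemma l2cvg_cst f : l2cvg (fun=> f) f.
Proof.
rewrite /l2cvg /inner; under eq_fun do under eq_Rintegral do rewrite subrr mulr0.
by rewrite /Rintegral integral0; exact: cvg_cst.
Qed.

Lemma inner_sqrD_le f g : sqint f -> sqint g ->
  inner (fun x => f x + g x) (fun x => f x + g x) <= 2 * (inner f f + inner g g).
Proof.
move=> fi gi; rewrite inner_sqrD//.
by have := inner_AM fi gi => /ler_normlP[]; lra.
Qed.

Lemma innerN f : inner (fun x => - f x) (fun x => - f x) = inner f f.
Proof. by apply: eq_Rintegral => x _; rewrite mulrNN. Qed.

Lemma l2cvg_uniq F f g : (forall n, sqint (F n)) -> sqint f -> sqint g ->
  l2cvg F f -> l2cvg F g -> {ae mu, forall x, f x = g x}.
Proof.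
move=> Fi fi gi Ff Fg.
suff : inner (fun x => f x - g x) (fun x => f x - g x) = 0.
  by move/inner_eq0 => /(_ (sqintB fi gi)); apply: filterS => x /subr0_eq.
apply/eqP; rewrite eq_le inner_ge0 andbT.
have : 2 * (inner (fun x => F n x - f x) (fun x => F n x - f x) +
   inner (fun x => F n x - g x) (fun x => F n x - g x)) @[n --> \oo] --> 2 * ((0 : R) + 0).
  by apply: cvgMl_tmp; exact: cvgD.
rewrite addr0 mulr0 => /cvg_lim <- //; apply: limr_ge.
  by apply/cvg_ex; eexists; apply: cvgMl_tmp; apply: cvgD; [exact: Ff|exact: Fg].
apply: nearW => n.
rewrite -innerN (_ : (fun x => - _) = (fun x => (F n x - f x) + (- (F n x - g x)))).
  rewrite -[X in 2 * (_ + X)]innerN; apply: inner_sqrD_le; first exact: sqintB.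
  by apply: sqintN; exact: sqintB.
by apply/funext => x; ring.
Qed.

Lemma l2cvgD F G f g : (forall n, sqint (F n)) -> sqint f -> (forall n, sqint (G n)) -> sqint g ->
  l2cvg F f -> l2cvg G g -> l2cvg (fun n x => F n x + G n x) (fun x => f x + g x).
Proof.
move=> Fi fi Gi gi Ff Gg.
apply: (@squeeze_cvgr _ _ _ _ (fun=> 0) (fun n => 2 * (inner (fun x => F n x - f x) (fun x => F
  n x - f x) +
   inner (fun x => G n x - g x) (fun x => G n x - g x)))).
- apply: nearW => n; rewrite inner_ge0/=.
  rewrite (_ : (fun x => _ - _) = (fun x => (F n x - f x) + (G n x - g x))).
    by apply: inner_sqrD_le; exact: sqintB.
  by apply/funext => x; ring.
- exact: cvg_cst.
- rewrite -[X in _ --> X](mulr0 2); apply: cvgMl_tmp.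
  by rewrite -[X in _ --> X]addr0; exact: cvgD.
Qed.

Lemma l2cvgZ c F f : (forall n, sqint (F n)) -> sqint f ->
  l2cvg F f -> l2cvg (fun n x => c * F n x) (fun x => c * f x).
Proof.
move=> Fi fi Ff; rewrite /l2cvg.
rewrite (_ : (fun n => _) = (fun n => c ^+ 2 * inner (fun x => F n x - f x) (fun x => F n x - f
  x))).
  by rewrite -[X in _ --> X](mulr0 (c ^+ 2)); apply: cvgMl_tmp.
apply/funext => n; have Ffi : sqint (fun x => F n x - f x) by exact: sqintB.
rewrite expr2 -mulrA -innerZl// -innerZr//; last exact: sqintZ.
by apply: eq_Rintegral => x _; ring.
Qed.

Lemma l2cvgB F G f g : (forall n, sqint (F n)) -> sqint f -> (forall n, sqint (G n)) -> sqint g ->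
  l2cvg F f -> l2cvg G g -> l2cvg (fun n x => F n x - G n x) (fun x => f x - g x).
Proof.
move=> Fi fi Gi gi Ff Gg.
rewrite (_ : (fun n x => _) = (fun n x => F n x + (-1) * G n x)); last first.
  by apply/funext => n; apply/funext => x; rewrite mulN1r.
rewrite (_ : (fun x => _) = (fun x => f x + (-1) * g x)); last first.
  by apply/funext => x; rewrite mulN1r.
by apply: l2cvgD => //; [move=> n|..]; [exact: sqintZ..|exact: l2cvgZ].
Qed.

Lemma integral_sqr f : sqint f -> (\int[mu]_x (f x ^+ 2)%:E)%E = (inner f f)%:E.
Proof.
move=> /sqintP[mf fi]; rewrite -Rintegral_sqr /Rintegral fineK//.
exact: integrable_fin_num fi.
Qed.

(** Riesz-Fischer: a subsequence with summable increments converges almost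
    everywhere, and the limit is an L2 limit by Fatou's lemma. *)
Lemma L2_complete F : (forall n, sqint (F n)) ->
  (forall e, 0 < e -> exists n0, forall m n, (n0 <= m)%N -> (n0 <= n)%N ->
     inner (fun x => F m x - F n x) (fun x => F m x - F n x) <= e) ->
  exists f, sqint f /\ l2cvg F f.
Proof.
move=> Fi Fc.
have e_gt0 k : 0 < (8 ^+ k.+1)^-1 :> R by rewrite invr_gt0 exprn_gt0.
have [N NP] := choice (fun k => Fc _ (e_gt0 k)).
pose phi k := (k + \sum_(i < k.+1) N i)%N.
have phi_ge k : (N k <= phi k)%N by rewrite /phi big_ord_recr/= addnA leq_addl.
have phiS k : (phi k <= phi k.+1)%N by rewrite /phi [leqRHS](_ : _ = k.+1 + (\sum_(i < k.+1) N i
  + N k.+1))%N ?big_ord_recr// leq_add ?leq_addr.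
have phi_mono k l : (k <= l)%N -> (phi k <= phi l)%N.
  by move=> /subnK <-; elim: (l - k)%N => // j IH; exact: leq_trans IH (phiS _).
pose D k x := F (phi k.+1) x - F (phi k) x.
have Di k : sqint (D k) by exact: sqintB.
have DP k : inner (D k) (D k) <= (8 ^+ k.+1)^-1.
  by apply: NP => //; exact: leq_trans (phi_ge _) (phiS _).
(* The squared increments are at most [8 ^- k.+1]; even with the weights
   [4 ^+ k] they have a finite sum almost everywhere, and this bounds the
   increments by a geometric sequence. *)
pose S x : \bar R := (\sum_(k <oo) (4 ^+ k * D k x ^+ 2)%:E)%E.
have mD k : measurable_fun setT (fun x => (4 ^+ k * D k x ^+ 2)%:E).
  apply/measurable_EFinP; apply: measurable_funM => //; apply: measurable_funX.
  exact: sqint_meas.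
have D0 k x : (0 <= (4 ^+ k * D k x ^+ 2)%:E)%E by rewrite lee_fin; apply: mulr_ge0;
  [exact: exprn_ge0|exact: sqr_ge0].
have mS : measurable_fun setT S by apply: ge0_emeasurable_sum.
have S_fin : (\int[mu]_x S x < +oo)%E.
  rewrite /S integral_nneseries//.
  apply: (@le_lt_trans _ _ (\sum_(k <oo) (1 / (2 ^ k.+1)%:R)%:E)%E); last first.
    by rewrite (le_lt_trans (epsilon_trick0 _ _))// ltry.
  apply: lee_nneseries => [k _ _|k _]; first exact: integral_ge0.
  under eq_integral do rewrite EFinM.
  rewrite ge0_integralZl//; [|by apply/measurable_EFinP; apply: measurable_funX; exact: sqint_meas|
    by first [move=> x _; rewrite lee_fin sqr_ge0 | rewrite lee_fin exprn_ge0]].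
  rewrite integral_sqr// -EFinM lee_fin.
  apply: (@le_trans _ _ (4 ^+ k * (8 ^+ k.+1)^-1)); first by rewrite ler_wpM2l ?exprn_ge0.
  have -> : 8 = 2 * 4 :> R by ring.
  rewrite natrX exprMn invfM mulrCA div1r ler_piMr ?invr_ge0 ?exprn_ge0//.
  rewrite (exprS 4) invfM mulrCA divff ?expf_neq0// mulr1.
  lra.
have S_ae : {ae mu, forall x, S x \is a fin_num}.
  have iS : mu.-integrable setT S.
    apply/integrableP; split => //; apply: le_lt_trans S_fin.
    by rewrite (@eq_integral _ _ _ _ _ S)// => x _; rewrite gee0_abs// nneseries_ge0.
  by have := integrable_ae measurableT iS; apply: filterS => x; apply.
have F_cvg x : S x \is a fin_num -> cvg (F (phi k) x @[k --> \oo]).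
  move=> Sx.
  have Dle k : `|D k x| <= geometric (Num.sqrt (fine (S x))) 2^-1 k.
    have geo_ge0 : 0 <= geometric (Num.sqrt (fine (S x))) 2^-1 k.
      by rewrite /= mulr_ge0 ?sqrtr_ge0// exprn_ge0// invr_ge0.
    rewrite -ler_sqr ?nnegrE//=.
    rewrite /= exprMn sqr_sqrtr; last by rewrite fine_ge0// nneseries_ge0.
    have -> : (2^-1 : R) ^+ k ^+ 2 = (4 ^+ k)^-1.
      by rewrite exprAC -[RHS]exprVn; congr (_ ^+ _); field.
    rewrite real_normK ?num_real// ler_pdivlMr ?exprn_gt0//.
    rewrite mulrC -lee_fin fineK// /S.
    have := @nneseries_lim_ge R (fun k => (4 ^+ k * D k x ^+ 2)%:E) xpredT 0%N k.+1 (fun n _ _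
      => D0 n x).
    apply: le_trans; rewrite big_mkord big_ord_recr/= leeDr//.
    by apply: sume_ge0 => i _; exact: D0.
  have cD : cvgn (series (D ^~ x)).
    apply: normed_cvg; apply: (@series_le_cvg _ _ (geometric (Num.sqrt (fine (S x))) 2^-1)) => //.
    - by move=> n /=; exact: normr_ge0.
    - by move=> n; exact: le_trans (normr_ge0 _) (Dle n).
    - by apply: is_cvg_geometric_series; rewrite ger0_norm ?invr_ge0//; lra.
  rewrite (_ : (fun k => _) = (fun k => F (phi 0%N) x + series (D ^~ x) k)).
    by apply: is_cvgD => //; exact: is_cvg_cst.
  by apply/funext => k; exact: (eq_sum_telescope (fun k => F (phi k) x)).
pose f x := fine (limn_esup (fun k => (F (phi k) x)%:E)).
have mf : measurable_fun setT f.
  apply: measurableT_comp => //; apply: measurable_fun_limn_esup => n.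
  by apply/measurable_EFinP; exact: sqint_meas.
have Ff : {ae mu, forall x, F (phi k) x @[k --> \oo] --> f x}.
  apply: filterS S_ae => x /F_cvg h.
  suff -> : f x = lim (F (phi k) x @[k --> \oo]) by [].
  rewrite /f is_cvg_limn_esupE; last by apply/cvg_ex; eexists; apply: cvg_EFin;
    [exact: nearW|exact: h].
  rewrite (@cvg_lim _ _ _ _ _ _ (lim (F (phi k) x @[k --> \oo]))%:E)//.
  by apply: cvg_EFin => //; exact: nearW.
have key e n0 n : (forall m n, (n0 <= m)%N -> (n0 <= n)%N ->
     inner (fun x => F m x - F n x) (fun x => F m x - F n x) <= e) -> (n0 <= n)%N ->
     (\int[mu]_x ((F n x - f x) ^+ 2)%:E <= e%:E)%E.
  move=> h n0n.
  apply: (@fatou_le _ _ _ _ (fun k x => ((F n x - F (phi (k + n0)) x) ^+ 2)%:E)).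
  - move=> k; apply/measurable_EFinP; apply: measurable_funX; apply: measurable_funB;
    exact: sqint_meas.
  - apply/measurable_EFinP; apply: measurable_funX; apply: measurable_funB => //; exact: sqint_meas.
  - by move=> k x; rewrite lee_fin sqr_ge0.
  - by move=> x; rewrite lee_fin sqr_ge0.
  - apply: filterS Ff => x Fx; apply: cvg_EFin; first exact: nearW.
    have := Fx; rewrite -(cvg_shiftn n0) => h1.
    apply: (@continuous_cvg _ _ _ _ _ _ (fun y : R => y ^+ 2)); first exact: exprn_continuous.
    by apply: cvgB => //; exact: cvg_cst.
  - move=> k; rewrite integral_sqr; last exact: sqintB.
    rewrite lee_fin; apply: h => //; apply: leq_trans (leq_addl k _) _.
    exact: leq_addr.
have fi : sqint f.
  have [n0 /key/(_ (leqnn n0)) h] := Fc 1 ltr01.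
  have : sqint (fun x => F n0 x - f x).
    apply/sqintP; split; first by apply: measurable_funB => //; exact: sqint_meas.
    apply/itgP; first by apply: measurable_funX; apply: measurable_funB => //; exact: sqint_meas.
    rewrite (le_lt_trans _ (ltry 1))//; apply: le_trans h.
    by under eq_integral do rewrite ger0_norm ?sqr_ge0//.
  by move=> /(sqintB (Fi n0)); under [X in sqint X]eq_fun do rewrite opprB addrC subrK.
exists f; split => //; apply/cvgrPdist_le => e e0.
have [n0 n0P] := Fc e e0; exists n0 => // n /= n0n.
rewrite sub0r normrN ger0_norm ?inner_ge0// -lee_fin -integral_sqr; last exact: sqintB.
exact: key n0P n0n.
Qed.

End L2_convergence.

(** * Euclidean space and its Lebesgue measure *)
Section euclidean_facts.
Context {R : realType} {N : nat}.
Local Notation E := 'rV[R]_N.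
Implicit Types x y z : E.

Lemma dotpC x y : dotp x y = dotp y x.
Proof. by apply: eq_bigr => i _; rewrite mulrC. Qed.

Lemma dotpDl x y z : dotp (x + y) z = dotp x z + dotp y z.
Proof. by rewrite -big_split; apply: eq_bigr => i _; rewrite mxE mulrDl. Qed.

Lemma dotpNl x z : dotp (- x) z = - dotp x z.
Proof. by rewrite -sumrN; apply: eq_bigr => i _; rewrite mxE mulNr. Qed.

Lemma dotpBl x y z : dotp (x - y) z = dotp x z - dotp y z.
Proof. by rewrite dotpDl dotpNl. Qed.

Lemma dotpZl c x z : dotp (c *: x) z = c * dotp x z.
Proof. by rewrite mulr_sumr; apply: eq_bigr => i _; rewrite mxE mulrA. Qed.

Lemma dotp_ge0 x : 0 <= dotp x x.
Proof. by apply: sumr_ge0 => i _; rewrite -expr2 sqr_ge0. Qed.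

Lemma enorm_ge0 x : 0 <= enorm x. Proof. exact: sqrtr_ge0. Qed.

Lemma enorm_sqr x : enorm x ^+ 2 = dotp x x.
Proof. by rewrite sqr_sqrtr// dotp_ge0. Qed.

Lemma enorm0 : enorm (0 : E) = 0.
Proof. by rewrite /enorm /dotp big1 ?sqrtr0// => i _; rewrite mxE mul0r. Qed.

Lemma enormN x : enorm (- x) = enorm x.
Proof. by rewrite /enorm dotpNl dotpC dotpNl opprK. Qed.

Lemma dotp_CS x y : dotp x y <= enorm x * enorm y.
Proof.
apply: (le_trans (ler_norm _)); rewrite -ler_sqr ?nnegrE ?mulr_ge0 ?enorm_ge0//.
rewrite real_normK ?num_real// exprMn !enorm_sqr.
apply: psd_discriminant => t; have := dotp_ge0 (x + t *: y).
rewrite dotpDl !(dotpC _ (x + _)) !dotpDl !dotpZl !(dotpC _ (t *: _)) !dotpZl.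
by rewrite (dotpC y x) => /le_trans; apply; rewrite le_eqVlt; apply/orP; left; apply/eqP; ring.
Qed.

Lemma enormD x y : enorm (x + y) <= enorm x + enorm y.
Proof.
rewrite -ler_sqr ?nnegrE ?addr_ge0 ?enorm_ge0// sqrrD !enorm_sqr.
rewrite dotpDl !(dotpC _ (x + _)) !dotpDl (dotpC y x).
by have := dotp_CS x y; lra.
Qed.

Lemma coord_le_enorm x i : `|x ord0 i| <= enorm x.
Proof.
rewrite -ler_sqr ?nnegrE ?enorm_ge0// enorm_sqr real_normK ?num_real//.
rewrite /dotp (bigD1 i)//= -expr2 lerDl; apply: sumr_ge0 => j _.
by rewrite -expr2 sqr_ge0.
Qed.

Lemma measurable_dotp d (T : measurableType d) (f g : T -> E) :
  measurable_fun setT f -> measurable_fun setT g ->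
  measurable_fun setT (fun t => dotp (f t) (g t)).
Proof.
move=> /measurable_fun_coordP mf /measurable_fun_coordP mg.
by apply: measurable_sum => i; exact: measurable_funM.
Qed.

Lemma measurable_rVB d (T : measurableType d) (f g : T -> E) :
  measurable_fun setT f -> measurable_fun setT g ->
  measurable_fun setT (fun t => f t - g t).
Proof.
move=> /measurable_fun_coordP mf /measurable_fun_coordP mg.
apply/measurable_fun_coordP => i; under eq_fun do rewrite !mxE.
exact: measurable_funB.
Qed.

Lemma measurable_rVN : measurable_fun setT (fun x : E => - x).
Proof.
apply/measurable_fun_coordP => i; under eq_fun do rewrite !mxE.
by apply: measurable_funN; exact: measurable_coord.
Qed.

Lemma measurable_enorm d (T : measurableType d) (f : T -> E) :
  measurable_fun setT f -> measurable_fun setT (fun t => enorm (f t)).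
Proof.
move=> mf; apply: (@measurableT_comp _ _ _ _ _ _ (@Num.sqrt R)); last exact: measurable_dotp.
by apply: continuous_measurable_fun; exact: sqrt_continuous.
Qed.

Lemma measurable_eball x r : measurable (eball x r).
Proof.
rewrite (_ : eball x r = (fun y => enorm (y - x)) @^-1` `]-oo, r[); last first.
  by apply/seteqP; split => y /=; rewrite /eball /= in_itv.
rewrite -[X in measurable X]setTI; apply: measurable_enorm => //.
by apply: measurable_rVB => //; exact: measurable_cst.
Qed.

(** The coordinate sigma-algebra contains the open sets: an open set is the
    union of the countably many rational cubes that it contains. *)
Lemma open_measurable_rV (U : set E) : open U -> measurable U.
Proof.
move=> oU.
pose box (qm : 'rV[rat]_N * nat) : set E :=
  [set y | forall i, `|y ord0 i - ratr (qm.1 ord0 i)| < qm.2.+1%:R^-1].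
have mbox qm : measurable (box qm).
  rewrite (_ : box qm = \bigcap_(i in [set: 'I_N])
      (fun y : E => `|y ord0 i - ratr (qm.1 ord0 i)|) @^-1` `]-oo, qm.2.+1%:R^-1[); last first.
    apply/seteqP; split => y /= h i.
      by move=> _; rewrite /= in_itv/= h.
    by have := h i I; rewrite /= in_itv.
  apply: fin_bigcap_measurable => // i _; rewrite -[X in measurable X]setTI.
  have : measurable_fun [set: E] (fun y => `|y ord0 i - ratr (qm.1 ord0 i)|).
    apply: measurableT_comp => //; apply: measurable_funB => //.
    exact: measurable_coord.
  by apply.
rewrite (_ : U = \bigcup_(qm in [set: 'rV[rat]_N * nat]) (if `[< box qm `<=` U >] then box qm
  else set0)).
  apply: countable_bigcupT_measurable => // qm.
  by case: asboolP.
apply/seteqP; split => [x Ux|x [qm _]]; last by case: asboolP => // h /h.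
have /nbhs_ballP[e /= e0 eU] := open_nbhs_nbhs (conj oU Ux).
have [m me] : exists m, m.+1%:R^-1 * 2 < e.
  have [m _ /(_ m (leqnn m))/= h] := near_infty_natSinv_lt (PosNum (divr_gt0 e0 (ltr0Sn R 1))).
  by exists m; rewrite -ltr_pdivlMr.
have /choice[q qP] : forall i : 'I_N, exists q : rat, `|x ord0 i - ratr q| < m.+1%:R^-1.
  move=> i; have [|q] := @rat_in_itvoo R (x ord0 i - m.+1%:R^-1) (x ord0 i + m.+1%:R^-1).
    by rewrite ltrD2l gtrN// invr_gt0.
  rewrite in_itv/= => /andP[h1 h2]; exists q.
  by rewrite distrC ltr_distl h1 h2.
exists (\row_i q i, m) => //.
case: asboolP => [_ i /=|]; first by rewrite mxE.
case=> y /= yq; apply: eU; split => // i j; rewrite ord1 /ball/=.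
apply: le_lt_trans (ler_distD (ratr (q j)) _ _) _.
apply: lt_trans me; rewrite mulr_natr mulr2n ltrD//.
by rewrite distrC; have := yq j; rewrite mxE.
Qed.

Lemma continuous_measurable_rV (f : E -> R) : continuous f -> measurable_fun setT f.
Proof.
move=> /continuousP cf; apply: (measurability _ (RGenOpens.measurableE R)).
by move=> _ [_ [a [b ->]] <-]; rewrite setTI; apply: open_measurable_rV; exact: cf.
Qed.

Lemma continuous_enormB x : continuous (fun y : E => enorm (y - x)).
Proof.
move=> y; apply: (@continuous_comp _ _ _ (fun y => dotp (y - x) (y - x)) (@Num.sqrt R));
  last exact: sqrt_continuous.
rewrite (_ : (fun y => _) = (fun y => \sum_(i <- index_enum 'I_N | true) (y - x) ord0 i * (y -
  x) ord0 i))//.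
apply: continuous_big.
  exact: add_continuous.
move=> i _ z.
have h : {for z, continuous (fun y : E => (y - x) ord0 i)}.
  rewrite (_ : (fun _ => _) = (fun y : E => y ord0 i - x ord0 i)); last first.
    by apply/funext => t; rewrite !mxE.
  have cz := @coord_continuous R 1 N ord0 i z.
  exact: (cvgB cz (cvg_cst _)).
exact: (cvgM h h).
Qed.

Lemma open_eball x r : open (eball x r).
Proof.
rewrite (_ : eball x r = (fun y => enorm (y - x)) @^-1` [set t | t < r])//.
by apply: open_comp; [move=> y _; exact: continuous_enormB|exact: open_lt].
Qed.

End euclidean_facts.

Section lebesgueN_facts.
Context {R : realType}.
Local Open Scope ereal_scope.

(** The recursive definition of the measure, read as Tonelli's theorem along
    the first coordinate. *)
Lemma ge0_integral_lebesgueNS n (f : 'rV[R]_n.+1 -> \bar R) :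
  measurable_fun setT f -> (forall x, 0 <= f x) ->
  \int[lebesgueN n.+1]_x f x =
  \int[@lebesgue_measure R]_t \int[lebesgueN n]_x f (rV_cons (t, x)).
Proof.
move=> mf f0.
have := @ge0_integral_pushforward _ _ (measurableTypeR R * 'rV[R]_n)%type _ R (@rV_cons R n)
  (@measurable_rV_cons R n)
  (@lebesgue_measure R \x lebesgueN n)%E setT f measurableT mf (fun x _ => f0 x).
rewrite preimage_setT fubini_tonelli1//; last by move=> x; exact: f0.
by apply: measurableT_comp => //; exact: (@measurable_rV_cons R n).
Qed.

Lemma integral_lebesgueN0 (f : 'rV[R]_0 -> \bar R) : measurable_fun setT f ->
  \int[lebesgueN 0]_x f x = f 0%R.
Proof. by move=> mf; rewrite /= integral_dirac// diracT mul1e. Qed.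

Let leb : {measure set (measurableTypeR R) -> \bar R} := @lebesgue_measure R.

Lemma measurable_oppr :
  measurable_fun [set: measurableTypeR R] ((fun x : R => - x)%R : _ -> measurableTypeR R).
Proof. by apply: (@measurable_funN _ _ R setT id). Qed.

(** Lebesgue measure is determined by its values on intervals. *)
Lemma lebesgue_measure_oppr (A : set (measurableTypeR R)) : measurable A ->
  leb ((fun x : R => - x)%R @^-1` A) = leb A.
Proof.
move=> mA.
pose nu : measure (measurableTypeR R) R :=
  measure_function_pushforward__canonical__measure_function_Measure
  leb measurable_oppr.
apply/esym; apply: (@lebesgue_measure_unique R nu) => // X [[a b] _ <-] /=.
rewrite /nu /= /pushforward.
have -> : ((fun x : R => - x)%R @^-1` `]a, b])%classic = `[(- b)%R, (- a)%R[%classic :> set R.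
  by apply/seteqP; split => x /=; rewrite !in_itv/= ltrNr lerNl andbC.
rewrite /leb !lebesgue_measure_itv/= !lte_fin ltrN2; case: ifP => // _.
by rewrite -!EFinB opprK addrC.
Qed.

Lemma ge0_integral_oppr (f : measurableTypeR R -> \bar R) : measurable_fun setT f ->
  (forall x, 0 <= f x) ->
  \int[leb]_x f (- (x : R))%R = \int[leb]_x f x.
Proof.
move=> mf f0.
have := @ge0_integral_pushforward _ _ _ _ _ _ measurable_oppr leb setT f measurableT mf (fun x _
  => f0 x).
rewrite preimage_setT => <-.
apply: eq_measure_integral => [|mN A mA _]; first exact: measurable_oppr.
exact: lebesgue_measure_oppr.
Qed.

Lemma rV_consN n (t : R) (x : 'rV[R]_n) : rV_cons (- t, - x)%R = (- rV_cons (t, x))%R.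
Proof.
apply: (can_inj (@rV_unconsK R n)); rewrite rV_consK /rV_uncons; congr pair.
  rewrite mxE; congr (- _)%R; have -> : ord0 = lshift n (ord0 : 'I_1) :> 'I_n.+1 by exact: val_inj.
  by rewrite (@row_mxEl R 1 1 n) mxE.
by apply/rowP => i; rewrite mxE [RHS]mxE [RHS]mxE (@row_mxEr R 1 1 n).
Qed.

(** The reflection acts on one coordinate after the other. *)
Lemma ge0_integral_rVN n (f : 'rV[R]_n -> \bar R) : measurable_fun setT f ->
  (forall x, 0 <= f x) ->
  \int[lebesgueN n]_x f (- x)%R = \int[lebesgueN n]_x f x.
Proof.
elim: n f => [|n IH] f mf f0.
  have mfN : measurable_fun setT (fun x : 'rV[R]_0 => f (- x)%R).
    by apply: measurableT_comp => //; exact: measurable_rVN.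
  by rewrite !integral_lebesgueN0// oppr0.
have mfN : measurable_fun setT (fun x : 'rV[R]_n.+1 => f (- x)%R).
  by apply: measurableT_comp => //; exact: measurable_rVN.
have mc (t : R) : measurable_fun setT (fun x : 'rV[R]_n => f (rV_cons (t, x))).
  apply: measurableT_comp => //.
  by apply: measurableT_comp; [exact: (@measurable_rV_cons R n)|exact: pair1_measurable].
rewrite (ge0_integral_lebesgueNS mfN (fun x => f0 _)) (ge0_integral_lebesgueNS mf f0).
rewrite -[RHS]ge0_integral_oppr.
- apply: eq_integral => t _; rewrite -[RHS]IH//.
  by apply: eq_integral => x _; rewrite rV_consN.
- apply: (measurable_fun_fubini_tonelli_F (f \o @rV_cons R n)).
  + by apply: measurableT_comp => //; exact: (@measurable_rV_cons R n).
  + by move=> z; exact: f0.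
- by move=> t; apply: integral_ge0 => x _; exact: f0.
Qed.

Lemma rV_cons0 n (t : R) (x : 'rV[R]_n) : rV_cons (t, x) ord0 ord0 = t.
Proof. by have := congr1 fst (rV_consK (t, x)). Qed.

Lemma rV_consS n (t : R) (x : 'rV[R]_n) i : rV_cons (t, x) ord0 (lift ord0 i) = x ord0 i.
Proof.
have /rowP/(_ i) := congr1 snd (rV_consK (t, x)); rewrite /= => <-.
by rewrite [RHS]mxE; congr (_ _ _); exact: val_inj.
Qed.

Lemma dotp_cons n (t s : R) (x y : 'rV[R]_n) :
  (dotp (rV_cons (t, x)) (rV_cons (s, y)) = t * s + dotp x y)%R.
Proof.
rewrite /dotp big_ord_recl !rV_cons0; congr (_ + _)%R.
by apply: eq_bigr => i _; rewrite !rV_consS.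
Qed.

Lemma rV_consB n (t s : R) (x y : 'rV[R]_n) :
  (rV_cons (t, x) - rV_cons (s, y) = rV_cons (t - s, x - y))%R.
Proof.
apply/rowP => i; rewrite mxE [X in (_ + X)%R]mxE; case: (unliftP ord0 i) => [j ->|->].
  by rewrite !rV_consS !mxE.
by rewrite !rV_cons0.
Qed.

(** Cubes are products, so their measure follows the recursion. They give the
    positivity of open sets and the finiteness of balls. *)
Lemma lebesgueN_cube n (x : 'rV[R]_n) (e : R) : (0 < e)%R ->
  lebesgueN n [set y : 'rV[R]_n | forall i, (`|y ord0 i - x ord0 i| < e)%R] = ((2 * e) ^+ n)%:E.
Proof.
move=> e0; have mc m (z : 'rV[R]_m) : measurable [set y : 'rV[R]_m | forall i, (`|y ord0 i - z
  ord0 i| < e)%R].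
  rewrite (_ : [set _ | _] = \bigcap_(i in [set: 'I_m])
      (fun y : 'rV[R]_m => `|y ord0 i - z ord0 i|)%R @^-1` `]-oo, e[); last first.
    apply/seteqP; split => y /= h i.
      by move=> _; rewrite /= in_itv/= h.
    by have := h i I; rewrite /= in_itv.
  apply: fin_bigcap_measurable => // i _; rewrite -[X in measurable X]setTI.
  have : measurable_fun [set: 'rV[R]_m] (fun y => `|y ord0 i - z ord0 i|)%R.
    apply: measurableT_comp => //; apply: measurable_funB => //.
    exact: measurable_coord.
  by apply.
elim: n x => [|n IH] x.
  rewrite (_ : [set _ | _] = setT); first by rewrite /= diracT.
  by apply/seteqP; split => // y _ [].
rewrite -(rV_unconsK x); case: (rV_uncons x) => s z {x}.
rewrite /= /rV_lebesgue_step /pushforward.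
rewrite (_ : _ @^-1` _ = `](s - e)%R, (s + e)%R[%classic `*`
    [set y : 'rV[R]_n | forall i, (`|y ord0 i - z ord0 i| < e)%R]); last first.
  apply/seteqP; split => -[t y] /=.
    move=> h; split => [|i]; last by have := h (lift ord0 i); rewrite !rV_consS.
    by have := h ord0; rewrite !rV_cons0 in_itv/= ltr_distl.
  move=> [ts h] i; case: (unliftP ord0 i) => [j ->|->]; first by rewrite !rV_consS.
  by rewrite !rV_cons0 ltr_distl; move: ts; rewrite in_itv.
transitivity (@lebesgue_measure R `](s - e)%R, (s + e)%R[ *
    lebesgueN n [set y : 'rV[R]_n | forall i, (`|y ord0 i - z ord0 i| < e)%R]).
  by apply: product_measure1E => //; exact: mc.
rewrite IH lebesgue_measure_itv/= lte_fin ifT; last by rewrite ltrD2l gtrN.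
by rewrite -EFinB -EFinM exprS; congr ((_ * _)%:E); ring.
Qed.

Lemma lebesgueN_open_gt0 n (U : set 'rV[R]_n) x : open U -> U x -> 0 < lebesgueN n U.
Proof.
move=> oU Ux; have /nbhs_ballP[e /= e0 eU] := open_nbhs_nbhs (conj oU Ux).
apply: (@lt_le_trans _ _ (lebesgueN n (ball x e))).
  rewrite (_ : ball x e = [set y : 'rV[R]_n | forall i, (`|y ord0 i - x ord0 i| < e)%R]).
    by rewrite lebesgueN_cube// lte_fin exprn_gt0// mulr_gt0.
  apply/seteqP; split => y /=; first by move=> [_ h] i; rewrite distrC; exact: h.
  by move=> h; split => // i j; rewrite ord1 /ball/= distrC.
apply: le_measure => //; rewrite inE; apply: open_measurable_rV => //.
exact: ball_open.
Qed.

Lemma lebesgueN_eball_lty n (x : 'rV[R]_n) r : lebesgueN n (eball x r) < +oo.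
Proof.
have [r0|r0] := ltP 0%R r; last first.
  rewrite (_ : eball x r = set0) ?measure0//; apply/seteqP; split => // y.
  by rewrite /eball/= => /lt_le_trans/(_ r0); rewrite ltNge enorm_ge0.
have h := lebesgueN_cube x r0.
apply: le_lt_trans (ltry ((2 * r) ^+ n)%R); rewrite -h.
apply: le_measure; rewrite ?inE; first exact: measurable_eball.
  rewrite (_ : [set _ | _] = ball x r); first by apply: open_measurable_rV; exact: ball_open.
  apply/seteqP; split => y /=; last by move=> [_ h'] i; rewrite distrC; exact: h'.
  by move=> h'; split => // i j; rewrite ord1 /ball/= distrC.
move=> y; rewrite /eball/= => yx i; apply: le_lt_trans yx.
by have := coord_le_enorm (y - x) i; rewrite !mxE.
Qed.

Lemma Rintegral_rVN n (f : 'rV[R]_n -> R) : measurable_fun setT f ->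
  (\int[lebesgueN n]_x f (- x) = \int[lebesgueN n]_x f x)%R.
Proof.
move=> mf; rewrite /Rintegral; congr fine; rewrite integralE [RHS]integralE.
have mE : measurable_fun setT (EFin \o f) by exact/measurable_EFinP.
congr (_ - _).
  rewrite -[RHS]ge0_integral_rVN//; [by apply: eq_integral => x _;
    rewrite !funeposE|exact: measurable_funepos].
rewrite -[RHS]ge0_integral_rVN//; [by apply: eq_integral => x _;
  rewrite !funenegE|exact: measurable_funeneg].
Qed.

Lemma itg_lebesgueNS n (f : 'rV[R]_n.+1 -> R) : itg (lebesgueN n.+1) f ->
  (@lebesgue_measure R \x lebesgueN n)%E.-integrable setT (EFin \o (f \o @rV_cons R n)).
Proof.
move=> fi; have mf := itg_meas fi.
have mfc : measurable_fun [set: measurableTypeR R * 'rV[R]_n] (f \o @rV_cons R n).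
  by apply: measurableT_comp => //; exact: (@measurable_rV_cons R n).
apply/integrableP; split; first exact/measurable_EFinP.
move/(itgP _ mf) : fi; rewrite ge0_integral_lebesgueNS//; last first.
  by apply/measurable_EFinP; exact: measurableT_comp.
by rewrite fubini_tonelli1//; apply: measurableT_comp => //; exact/measurable_EFinP.
Qed.

Lemma Rintegral_lebesgueNS n (f : 'rV[R]_n.+1 -> R) : itg (lebesgueN n.+1) f ->
  \int[lebesgueN n.+1]_x (f x)%:E =
  \int[@lebesgue_measure R]_t \int[lebesgueN n]_x (f (rV_cons (t, x)))%:E.
Proof.
move=> fi; have fci := itg_lebesgueNS fi.
have := @integral_pushforward _ _ (measurableTypeR R * 'rV[R]_n)%type _ R (@rV_cons R n)
  (@measurable_rV_cons R n)
  (@lebesgue_measure R \x lebesgueN n)%E setT (EFin \o f).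
rewrite preimage_setT => ->//; last by apply/measurable_EFinP; exact: itg_meas fi.
by rewrite -integral12_prod_meas1.
Qed.

End lebesgueN_facts.

(** * Gaussian integrals *)
Section gaussian1.
Context {R : realType}.
Notation leb := (@lebesgue_measure R).
Implicit Types a b : R.

Definition gauss1 (b x : R) : R := expR (- (b * x ^+ 2)).

Lemma measurable_gauss1 b : measurable_fun setT (gauss1 b).
Proof.
apply: measurableT_comp => //; apply: measurable_funN.
by apply: measurable_funM => //; exact: measurable_funX.
Qed.

Lemma gauss1_ge0 b x : 0 <= gauss1 b x. Proof. exact: expR_ge0. Qed.

Lemma integral_gauss1 a m : 0 < a ->
  (\int[leb]_x (gauss1 a (x - m))%:E = (Num.sqrt (pi / a))%:E)%E.
Proof.
move=> a0; pose sg := Num.sqrt (2 * a)^-1.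
have sg2 : sg ^+ 2 = (2 * a)^-1 by rewrite sqr_sqrtr// invr_ge0 mulr_ge0// ltW.
have sg0 : sg != 0 by rewrite sqrtr_eq0 -ltNge invr_gt0 mulr_gt0.
have pk : normal_peak sg = (Num.sqrt (pi / a))^-1.
  rewrite /normal_peak sg2; congr (Num.sqrt _)^-1.
  by rewrite -mulr_natr; field; rewrite gt_eqF.
have spos : 0 < Num.sqrt (pi / a) by rewrite sqrtr_gt0 divr_gt0// pi_gt0.
have E x : gauss1 a (x - m) = Num.sqrt (pi / a) * normal_pdf m sg x.
  rewrite normal_pdfE// pk mulrA divff ?mul1r; last by rewrite gt_eqF.
  rewrite /normal_fun sg2; congr expR; rewrite -mulr_natr; field.
  by rewrite gt_eqF.
under eq_integral do rewrite E EFinM.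
rewrite ge0_integralZl//.
- by rewrite integral_normal_pdf mule1.
- by apply/measurable_EFinP; exact: measurable_normal_pdf.
- by move=> x _; rewrite lee_fin normal_pdf_ge0.
Qed.

Lemma itg_gauss1 a : 0 < a -> itg leb (gauss1 a).
Proof.
move=> a0; apply/itgP; first exact: measurable_gauss1.
under eq_integral do rewrite ger0_norm ?gauss1_ge0// -[X in gauss1 a X]subr0.
by rewrite integral_gauss1// ltry.
Qed.

Lemma gauss1_le b n : 0 < b -> gauss1 b n.+1%:R <= b^-1 * n.+1%:R^-1.
Proof.
move=> b0; rewrite /gauss1 expRN -invfM lef_pV2 ?posrE ?expR_gt0 ?mulr_gt0//.
apply: le_trans (expR_ge1Dx _); rewrite ler_wpDl// ler_wpM2l ?(ltW b0)//.
by rewrite expr2 ler_peMl// ler1n.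
Qed.

Lemma is_derive_linear (c x : R) : is_derive x 1 (fun y : R => c * y) c.
Proof.
have -> : (fun y : R => c * y) = c *: (id : R -> R) by [].
by apply: is_derive_eq; rewrite scaler1.
Qed.

Lemma is_derive_gauss1 b (x : R) : is_derive x 1 (gauss1 b) (- 2 * b * x * gauss1 b x).
Proof.
have h : is_derive x 1 (fun y : R => - (b * y ^+ 2)) (- 2 * b * x).
  have -> : (fun y : R => - (b * y ^+ 2)) = - (b *: ((id : R -> R) ^+ 2)).
    by apply/funext => y; rewrite fctE.
  apply: is_derive_eq; rewrite scaler1 expr1 scalerAr.
  rewrite -mulr_natr /GRing.scale/=; ring.
apply: (@is_derive_eq _ _ _ _ _ _ (- 2 * b * x * expR (- (b * x ^+ 2)))) => //.
by have := @is_derive1_comp _ expR (fun y : R => - (b * y ^+ 2)) x _ _ (is_derive_expR _) h;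
  rewrite mulrC.
Qed.

Variable a : R.
Hypothesis a0 : 0 < a.

Lemma is_derive_sin_gauss (z x : R) :
  is_derive x 1 (fun x => sin (z * x) * gauss1 a x)
    ((z * cos (z * x) - 2 * a * x * sin (z * x)) * gauss1 a x).
Proof.
have h := @is_derive1_comp _ sin (fun y : R => z * y) x _ _ (is_derive_sin _) (is_derive_linear
  z x).
have -> : (fun x => sin (z * x) * gauss1 a x) = (sin \o (fun y : R => z * y)) * gauss1 a by [].
apply: (is_derive_eq (is_deriveM h (is_derive_gauss1 a x))).
by rewrite /GRing.scale/=; ring.
Qed.

Lemma is_derive_cos_exp (y x z : R) :
  is_derive z 1 (fun z => expR (z ^+ 2 / (4 * a)) * cos (z * x) * y)
    (expR (z ^+ 2 / (4 * a)) * (z / (2 * a) * cos (z * x) - x * sin (z * x)) * y).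
Proof.
have h1 : is_derive z 1 (fun t : R => t ^+ 2 / (4 * a)) (z / (2 * a)).
  have -> : (fun t : R => t ^+ 2 / (4 * a)) = (4 * a)^-1 *: ((id : R -> R) ^+ 2).
    by apply/funext => t; rewrite fctE mulrC.
  apply: is_derive_eq; rewrite scaler1 expr1 -mulr_natr /GRing.scale/=; field.
  by rewrite gt_eqF.
have h2 := @is_derive1_comp _ expR _ z _ _ (is_derive_expR _) h1.
have h3 : is_derive z 1 (fun t : R => t * x) x.
  by rewrite (_ : (fun t => _) = (fun t => x * t)); [exact: is_derive_linear|apply/funext => t;
    rewrite mulrC].
have h4 := @is_derive1_comp _ cos _ z _ _ (is_derive_cos _) h3.
have -> : (fun z => expR (z ^+ 2 / (4 * a)) * cos (z * x) * y) =
  (expR \o (fun t : R => t ^+ 2 / (4 * a))) * (cos \o (fun t : R => t * x)) * cst y by [].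
apply: (is_derive_eq (is_deriveM (is_deriveM h2 h4) (is_derive_cst y z 1))).
by rewrite /GRing.scale/=; ring.
Qed.

Lemma continuous_gauss1 b : continuous (gauss1 b).
Proof.
by move=> x; apply: differentiable_continuous; apply/derivable1_diffP;
  have := is_derive_gauss1 b x; case.
Qed.

Lemma itg_xgauss1 : itg leb (fun x => `|x| * gauss1 a x).
Proof.
have a2 : 0 < a / 2 by rewrite divr_gt0.
apply: (@itg_le _ _ _ leb _ (fun x => (1 + 2 / a) * gauss1 (a / 2) x)).
- apply: measurable_funM; last exact: measurable_gauss1.
  exact: (@measurableT_comp _ _ _ _ _ _ (@Num.norm R R)).
- by apply: itgZ; exact: itg_gauss1.
- move=> x; rewrite normrM normr_id (ger0_norm (gauss1_ge0 _ _)).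
  have -> : gauss1 a x = gauss1 (a / 2) x * gauss1 (a / 2) x.
    by rewrite /gauss1 -expRD; congr expR; field.
  rewrite mulrA ler_wpM2r ?gauss1_ge0// [X in _ * X]/gauss1 expRN ler_pdivrMr ?expR_gt0//.
  apply: (@le_trans _ _ ((1 + 2 / a) * (1 + a / 2 * x ^+ 2))); last first.
    by rewrite ler_wpM2l ?expR_ge1Dx// addr_ge0// divr_ge0// ltW.
  have -> : (1 + 2 / a) * (1 + a / 2 * x ^+ 2) = 1 + 2 / a + a / 2 * x ^+ 2 + x ^+ 2.
    by field; rewrite gt_eqF.
  have : 0 <= 2 / a by rewrite divr_ge0// ltW.
  have : 0 <= a / 2 * x ^+ 2 by rewrite mulr_ge0 ?sqr_ge0// ltW.
  rewrite -(real_normK (num_real x)); have := normr_ge0 x; set y := `|x|; nra.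
Qed.

(** The integrand is the derivative of [sin (z * x) * gauss1 a x], which
    vanishes at infinity. *)
Lemma Rintegral_derive_gauss1 (z : R) :
  itg leb (fun x => (z * cos (z * x) - 2 * a * x * sin (z * x)) * gauss1 a x) /\
  \int[leb]_x ((z * cos (z * x) - 2 * a * x * sin (z * x)) * gauss1 a x) = 0.
Proof.
set g := fun x => _.
have mg : measurable_fun setT g.
  apply: measurable_funM; last exact: measurable_gauss1.
  apply: measurable_funB; apply: measurable_funM => //.
  - apply: continuous_measurable_fun => x; apply: continuous_comp; last exact: continuous_cos.
    by apply: cvgMl_tmp; exact: cvg_id.
  - apply: continuous_measurable_fun => x; apply: continuous_comp; last exact: continuous_sin.
    by apply: cvgMl_tmp; exact: cvg_id.
pose G x := `|z| * gauss1 a x + 2 * a * (`|x| * gauss1 a x).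
have iG : itg leb G by apply: itgD; apply: itgZ; [exact: itg_gauss1|exact: itg_xgauss1].
have gG x : `|g x| <= G x.
  rewrite /g /G normrM (ger0_norm (gauss1_ge0 _ _)) !mulrA -mulrDl ler_wpM2r ?gauss1_ge0//.
  apply: (le_trans (ler_normB _ _)); rewrite !normrM (ger0_norm (ltW a0)) [`|2|]ger0_norm//.
  apply: lerD; first by rewrite ler_piMr// ler_norml cos_geN1 cos_le1.
  by rewrite ler_piMr ?mulr_ge0 ?(ltW a0)// ler_norml sin_geN1 sin_le1.
have ig : itg leb g by exact: itg_le iG gG.
split => //.
pose D n : set R := `[- n.+1%:R, n.+1%:R]%classic.
have cvI : \int[leb]_(x in D n) (g x) @[n --> \oo] --> \int[leb]_x g x.
  have := @dominated_convergence _ _ _ leb setT measurableT (fun n => EFin \o (g \_ (D n)))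
    (EFin \o g) (EFin \o G).
  case.
  - move=> n; apply/measurable_EFinP; apply/(@measurable_restrictT _ _ _ _ (D n) g).
      by rewrite /D; exact: measurable_itv.
    exact: (measurable_funS measurableT (@subsetT _ _) mg).
  - exact/measurable_EFinP.
  - apply: aeW => x _; apply: cvg_EFin; first exact: nearW.
    apply: cvg_near_cst; near=> n.
    rewrite /= patchE ifT// inE /D /= in_itv/= -ler_norml.
    apply: (@le_trans _ _ n%:R); last by rewrite ler_nat.
    by near: n; exact: nbhs_infty_ger.
  - exact: iG.
  - apply: aeW => x n _; rewrite /= lee_fin patchE; case: ifPn => _; first exact: gG.
    by rewrite normr0 (le_trans (normr_ge0 (g x)))// gG.
  move=> _ _ h; rewrite /Rintegral; apply: fine_cvg; rewrite fineK;
    last exact: integrable_fin_num ig.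
  apply: cvg_trans h; apply: near_eq_cvg; apply: nearW => n /=.
  by rewrite [RHS]integral_mkcond; apply: eq_integral => x _; rewrite restrict_EFin.
have cv0 : \int[leb]_(x in D n) (g x) @[n --> \oo] --> (0 : R).
  have E n : \int[leb]_(x in D n) (g x) = 2 * (sin (z * n.+1%:R) * gauss1 a n.+1%:R).
    rewrite /Rintegral (@continuous_FTC2 _ g (fun x => sin (z * x) * gauss1 a x)).
    - rewrite -EFinB /= mulrN sinN /gauss1 sqrrN; ring.
    - by rewrite gtrN.
    - apply: continuous_subspaceT => x; apply: cvgM; last exact: continuous_gauss1.
      apply: cvgB; apply: cvgM => //; first exact: cvg_cst.
      + apply: continuous_comp; last exact: continuous_cos.
        by apply: cvgMl_tmp; exact: cvg_id.
      + by apply: cvgMl_tmp; exact: cvg_id.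
      + apply: continuous_comp; last exact: continuous_sin.
        by apply: cvgMl_tmp; exact: cvg_id.
    - have cS : continuous (fun x => sin (z * x) * gauss1 a x).
        move=> x; apply: differentiable_continuous; apply/derivable1_diffP.
        by have := is_derive_sin_gauss z x; case.
      split.
      + by move=> x _; have := is_derive_sin_gauss z x; case.
      + by apply: cvg_at_right_filter; exact: cS.
      + by apply: cvg_at_left_filter; exact: cS.
    - by move=> x _; rewrite derive1E; have := is_derive_sin_gauss z x; case.
  rewrite (funext E); apply/norm_cvg0P.
  apply: (@squeeze_cvgr _ _ _ _ (fun=> 0) (fun n => 2 * (a^-1 * n.+1%:R^-1))).
  - apply: nearW => n; rewrite normr_ge0/= normrM ger0_norm// ler_wpM2l//.
    apply: le_trans (gauss1_le n a0); rewrite normrM (ger0_norm (gauss1_ge0 _ _)).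
    by rewrite ler_piMl ?gauss1_ge0// ler_norml sin_geN1 sin_le1.
  - exact: cvg_cst.
  - rewrite -[X in _ --> X](mulr0 2); apply: cvgMl_tmp.
    rewrite -[X in _ --> X](mulr0 a^-1); apply: cvgMl_tmp.
    exact: (@cvg_harmonic R).
exact: (cvg_unique _ cvI cv0).
Unshelve. all: by end_near.
Qed.

(** The Fourier transform of a Gaussian. Multiplied by
    [expR (z ^+ 2 / (4 * a))] the integral has derivative zero in [z], by
    [Rintegral_derive_gauss1], so that it equals its value at [z = 0]. *)
Lemma integral_cos_gauss1 (z : R) : itg leb (fun x => cos (z * x) * gauss1 a x) /\
  \int[leb]_x (cos (z * x) * gauss1 a x) = Num.sqrt (pi / a) * expR (- (z ^+ 2 / (4 * a))).
Proof.
have mcos (c : R) : measurable_fun setT (fun x : R => cos (c * x)).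
  apply: continuous_measurable_fun => x; apply: continuous_comp; last exact: continuous_cos.
  by apply: cvgMl_tmp; exact: cvg_id.
have icos c : itg leb (fun x => cos (c * x) * gauss1 a x).
  apply: (itg_le _ (itg_gauss1 a0)).
    by apply: measurable_funM; [exact: mcos|exact: measurable_gauss1].
  move=> x; rewrite normrM (ger0_norm (gauss1_ge0 _ _)) ler_piMl ?gauss1_ge0//.
  by rewrite ler_norml cos_geN1 cos_le1.
split => //.
pose f (z x : R) := expR (z ^+ 2 / (4 * a)) * cos (z * x) * gauss1 a x.
have fE c : \int[leb]_x f c x = expR (c ^+ 2 / (4 * a)) * \int[leb]_x (cos (c * x) * gauss1 a x).
  rewrite -RintegralZl//; last exact: icos.
  by apply: eq_Rintegral => x _; rewrite /f mulrA.
pose h c := \int[leb]_x f c x.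
have dfE c x : partial1of2 f c x = expR (c ^+ 2 / (4 * a)) * (c / (2 * a) * cos (c * x) - x *
  sin (c * x)) * gauss1 a x.
  by rewrite partial1of2E; have := is_derive_cos_exp (gauss1 a x) x c; case.
have h0 c : is_derive c (1 : R) h 0.
  pose M := `|c| + 1.
  pose G x := expR (M ^+ 2 / (4 * a)) * (M / (2 * a) * gauss1 a x + `|x| * gauss1 a x).
  have M0 : 0 <= M by rewrite addr_ge0.
  have H : forall t : R, `]c - 1, c + 1[%classic t -> `|t| <= M.
    move=> t; rewrite /= in_itv/= -ltr_distl => ht.
    rewrite /M -(subrK c t) addrC; apply: (le_trans (ler_normD _ _)).
    by rewrite lerD2l ltW.
  have K := @cvg_differentiation_under_integral R _ _ leb f setT measurableT c (c - 1) (c + 1) _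
    _ _ G _ _ _.
  have D : \int[leb]_(y in setT) partial1of2 f c y = 0.
    under eq_Rintegral do rewrite dfE.
    have [ig gE] := Rintegral_derive_gauss1 c.
    transitivity (\int[leb]_x (expR (c ^+ 2 / (4 * a)) / (2 * a) * ((c * cos (c * x) - 2 * a * x
      * sin (c * x)) * gauss1 a x))).
      by apply: eq_Rintegral => x _; field; rewrite gt_eqF.
    by rewrite RintegralZl// gE mulr0.
  rewrite D in K.
  have G0 y : 0 <= G y.
    apply: mulr_ge0; first exact: expR_ge0.
    apply: addr_ge0; apply: mulr_ge0; rewrite ?gauss1_ge0//.
    by rewrite divr_ge0// mulr_ge0// ltW.
  have hc : t^-1 *: (h (t + c) - h c) @[t --> 0^'] --> (0 : R).
    apply: K => //.
    - by rewrite /= in_itv/= gtrBl ltrDl ltr01.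
    - move=> x _; rewrite /f; under [X in _.-integrable _ X]eq_fun do rewrite /= -mulrA.
      by apply: (@itgZ _ _ _ leb); exact: icos.
    - by apply: (@itgZ _ _ _ leb); apply: itgD; [apply: itgZ; exact: itg_gauss1|exact: itg_xgauss1].
    - move=> t y /H tM _; rewrite dfE /G -mulrA normrM ger0_norm ?expR_ge0//.
      rewrite ler_pM ?expR_ge0//.
        rewrite ler_expR ler_wpM2r ?invr_ge0 ?mulr_ge0 ?(ltW a0)//.
        by rewrite -(real_normK (num_real t)) lerXn2r ?nnegrE.
      rewrite normrM (ger0_norm (gauss1_ge0 _ _)) -mulrDl ler_wpM2r ?gauss1_ge0//.
      apply: (le_trans (ler_normB _ _)); rewrite !normrM; apply: lerD; last first.
        by rewrite ler_piMr// ler_norml sin_geN1 sin_le1.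
      apply: (@le_trans _ _ (`|t| * `|(2 * a)^-1|)).
        by rewrite ler_piMr ?mulr_ge0// ler_norml cos_geN1 cos_le1.
      have i2a : 0 <= (2 * a)^-1 by rewrite invr_ge0 mulr_ge0// ltW.
      by rewrite (ger0_norm i2a); exact: ler_wpM2r.
  have E : (fun t : R => t^-1 *: ((h \o shift c) (t *: (1 : R)) - h c)) = (fun t => t^-1 *: (h
    (t + c) - h c)).
    by apply/funext => t; rewrite /= scaler1.
  apply: DeriveDef; first by rewrite /derivable E; apply/cvg_ex; exists 0.
  by rewrite /derive E; apply/cvg_lim.
have := @is_derive_0_is_cst R h z 0 h0.
rewrite /h !fE expr0n mul0r expR0 mul1r.
under [X in _ = X -> _]eq_Rintegral do rewrite mul0r cos0 mul1r.
have -> : \int[leb]_x gauss1 a x = Num.sqrt (pi / a).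
  rewrite /Rintegral; under eq_integral do rewrite -[X in gauss1 _ X]subr0.
  by rewrite integral_gauss1.
by move=> <-; rewrite expRN mulrC mulKf// gt_eqF// expR_gt0.
Qed.
End gaussian1.

Section gaussianN.
Context {R : realType}.
Notation leb := (@lebesgue_measure R).
Notation "'mu' n" := (@lebesgueN R n) (at level 10, n at level 8).
Variable a : R.
Hypothesis a0 : 0 < a.

Definition gaussN n (b : R) (x : 'rV[R]_n) : R := expR (- (b * dotp x x)).

Lemma gaussN_ge0 n b (x : 'rV[R]_n) : 0 <= gaussN b x. Proof. exact: expR_ge0. Qed.

Lemma measurable_gaussN n b : measurable_fun setT (@gaussN n b).
Proof.
apply: measurableT_comp => //; apply: measurable_funN.
by apply: measurable_funM => //; exact: measurable_dotp.
Qed.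

Lemma measurable_gaussNB n b (y : 'rV[R]_n) : measurable_fun setT (fun x : 'rV[R]_n => gaussN b
  (x - y)).
Proof.
apply: (measurableT_comp (@measurable_gaussN n b)).
by apply: measurable_rVB => //; exact: measurable_cst.
Qed.

Lemma gaussN_cons n b t (x : 'rV[R]_n) : gaussN b (rV_cons (t, x)) = gauss1 b t * gaussN b x.
Proof. by rewrite /gaussN /gauss1 dotp_cons mulrDr opprD expRD expr2. Qed.

Lemma integral_gaussN n (y : 'rV[R]_n) :
  (\int[mu n]_x (gaussN a (x - y))%:E = ((Num.sqrt (pi / a)) ^+ n)%:E)%E.
Proof.
elim: n y => [|n IH] y.
  rewrite integral_lebesgueN0; last by apply/measurable_EFinP; exact: measurable_gaussNB.
  by rewrite /gaussN /dotp big_ord0 mulr0 oppr0 expR0.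
rewrite ge0_integral_lebesgueNS; last 2 first.
  - by apply/measurable_EFinP; exact: measurable_gaussNB.
  - by move=> x; rewrite lee_fin gaussN_ge0.
rewrite -(rV_unconsK y); case: (rV_uncons y) => s z {y}.
transitivity (\int[leb]_t ((gauss1 a (t - s))%:E * ((Num.sqrt (pi / a)) ^+ n)%:E))%E.
  apply: eq_integral => t _; under eq_integral do rewrite rV_consB gaussN_cons EFinM.
  rewrite ge0_integralZl//; last 3 first.
  - by apply/measurable_EFinP; exact: measurable_gaussNB.
  - by move=> x _; rewrite lee_fin gaussN_ge0.
  - by rewrite lee_fin gauss1_ge0.
  by rewrite IH.
under eq_integral do rewrite muleC.
rewrite ge0_integralZl//; last 2 first.
- apply/measurable_EFinP; apply: (measurableT_comp (@measurable_gauss1 R a)).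
  exact: measurable_funB.
- by move=> x _; rewrite lee_fin gauss1_ge0.
by rewrite integral_gauss1// -EFinM exprSr.
Qed.

Lemma itg_gaussN n : itg (mu n) (@gaussN n a).
Proof.
apply/itgP; first exact: measurable_gaussN.
under eq_integral do rewrite ger0_norm ?gaussN_ge0// -[X in gaussN a X]subr0.
by rewrite integral_gaussN ltry.
Qed.

Lemma measurable_trig (f : R -> R) d (T : measurableType d) (g : T -> R) :
  continuous f -> measurable_fun setT g -> measurable_fun setT (f \o g).
Proof. by move=> cf mg; apply: measurableT_comp => //; exact: continuous_measurable_fun. Qed.

Lemma itg_bounded_gaussN n (f : 'rV[R]_n -> R) M : measurable_fun setT f ->
  (forall x, `|f x| <= M) -> itg (mu n) (fun x => f x * gaussN a x).
Proof.
move=> mf fM; apply: (itg_le _ (itgZ M (itg_gaussN n))).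
  by apply: measurable_funM => //; exact: measurable_gaussN.
by move=> x; rewrite normrM (ger0_norm (gaussN_ge0 _ _)) ler_wpM2r ?gaussN_ge0.
Qed.

Lemma measurable_cos_dotp n (z : 'rV[R]_n) : measurable_fun setT (fun x => cos (dotp x z)).
Proof.
by apply: measurable_trig; [exact: continuous_cos|apply: measurable_dotp => //;
  exact: measurable_cst].
Qed.

Lemma measurable_sin_dotp n (z : 'rV[R]_n) : measurable_fun setT (fun x => sin (dotp x z)).
Proof.
by apply: measurable_trig; [exact: continuous_sin|apply: measurable_dotp => //;
  exact: measurable_cst].
Qed.

Lemma itg_cos_gaussN n (z : 'rV[R]_n) : itg (mu n) (fun x => cos (dotp x z) * gaussN a x).
Proof.
apply: (@itg_bounded_gaussN _ _ 1); first exact: measurable_cos_dotp.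
by move=> x; rewrite ler_norml cos_geN1 cos_le1.
Qed.

Lemma itg_sin_gaussN n (z : 'rV[R]_n) : itg (mu n) (fun x => sin (dotp x z) * gaussN a x).
Proof.
apply: (@itg_bounded_gaussN _ _ 1); first exact: measurable_sin_dotp.
by move=> x; rewrite ler_norml sin_geN1 sin_le1.
Qed.

Lemma Rintegral_sin_gaussN n (z : 'rV[R]_n) : \int[mu n]_x (sin (dotp x z) * gaussN a x) = 0.
Proof.
have h := itg_sin_gaussN z.
have : \int[mu n]_x (sin (dotp x z) * gaussN a x) = - \int[mu n]_x (sin (dotp x z) * gaussN a x).
  rewrite -[LHS]Rintegral_rVN; last exact: itg_meas h.
  rewrite -mulN1r -RintegralZl//; apply: eq_Rintegral => x _.
  by rewrite dotpNl sinN /gaussN dotpNl (dotpC x (- x)) dotpNl opprK mulN1r mulNr.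
by move=> e; lra.
Qed.

(** Induction on the dimension with the addition formula for the cosine; the
    sine terms vanish by oddness. *)
Lemma Rintegral_cos_gaussN n (z : 'rV[R]_n) : \int[mu n]_x (cos (dotp x z) * gaussN a x) =
  (Num.sqrt (pi / a)) ^+ n * expR (- (dotp z z / (4 * a))).
Proof.
elim: n z => [|n IH] z.
  rewrite /Rintegral integral_lebesgueN0; last first.
    by apply/measurable_EFinP; exact: itg_meas (itg_cos_gaussN z).
  by rewrite /= /gaussN /dotp !big_ord0 cos0 mulr0 mul0r oppr0 expr0 !mul1r.
rewrite {1}/Rintegral Rintegral_lebesgueNS; last exact: itg_cos_gaussN.
rewrite -(rV_unconsK z); case: (rV_uncons z) => s y {z}.
rewrite dotp_cons.
have -> : (Num.sqrt (pi / a)) ^+ n.+1 * expR (- ((s * s + dotp y y) / (4 * a))) =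
    (Num.sqrt (pi / a) * expR (- (s ^+ 2 / (4 * a)))) *
    ((Num.sqrt (pi / a)) ^+ n * expR (- (dotp y y / (4 * a)))).
  by rewrite -expr2 (mulrDl (s ^+ 2)) opprD expRD exprS; ring.
have [ic <-] := integral_cos_gauss1 a0 s; rewrite -IH.
rewrite -RintegralZr//; congr fine; apply: eq_integral => t _.
transitivity (\int[mu n]_x (cos (s * t) * gauss1 a t * (cos (dotp x y) * gaussN a x) -
   sin (s * t) * gauss1 a t * (sin (dotp x y) * gaussN a x)))%:E.
  rewrite /Rintegral fineK.
    apply: eq_integral => x _; rewrite dotp_cons gaussN_cons cosD (mulrC t s).
    by congr EFin; ring.
  by apply: integrable_fin_num => //; apply: itgB; apply: itgZ;
    [exact: itg_cos_gaussN|exact: itg_sin_gaussN].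
rewrite RintegralB//; last 2 first.
- by apply: itgZ; exact: itg_cos_gaussN.
- by apply: itgZ; exact: itg_sin_gaussN.
rewrite !RintegralZl//; last 2 first.
- exact: itg_sin_gaussN.
- exact: itg_cos_gaussN.
by rewrite Rintegral_sin_gaussN mulr0 subr0.
Qed.

End gaussianN.

(** * The heat form *)
Section dominated_L2.
Context d (T : measurableType d) (R : realType) (mu : {measure set T -> \bar R}).

Lemma itg_ge0 (f : T -> R) : measurable_fun setT f -> (forall x, 0 <= f x) ->
  (\int[mu]_x (f x)%:E < +oo)%E -> itg mu f.
Proof.
move=> mf f0 fi; apply/(itgP _ mf); apply: le_lt_trans fi.
by rewrite le_eqVlt; apply/orP; left; apply/eqP/eq_integral => x _; rewrite ger0_norm.
Qed.

Lemma Rintegral_dominated (F : nat -> T -> R) (f g : T -> R) :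
  (forall n, measurable_fun setT (F n)) -> measurable_fun setT f -> itg mu g ->
  {ae mu, forall x, F n x @[n --> \oo] --> f x} -> (forall n x, `|F n x| <= g x) ->
  itg mu f /\ \int[mu]_x F n x @[n --> \oo] --> \int[mu]_x f x.
Proof.
move=> mF mf ig Ff Fg.
have := @dominated_convergence _ _ _ mu setT measurableT (fun n => EFin \o F n) (EFin \o f)
  (EFin \o g).
case.
- by move=> n; exact/measurable_EFinP.
- exact/measurable_EFinP.
- apply: filterS Ff => x Fx _; apply: cvg_EFin; [exact: nearW|exact: Fx].
- exact: ig.
- by apply: aeW => x n _; rewrite /= lee_fin.
move=> fi _ h; split => //.
by rewrite /Rintegral; apply: fine_cvg; rewrite fineK//; exact: integrable_fin_num fi.
Qed.

Lemma l2cvg_dominated (F : nat -> T -> R) (f : T -> R) :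
  (forall n, measurable_fun setT (F n)) -> sqint mu f ->
  (forall x, F n x @[n --> \oo] --> f x) -> (forall n x, `|F n x| <= `|f x|) ->
  l2cvg mu F f.
Proof.
move=> mF fi Ff FfB; have [mf if2] := (sqintP _ _).1 fi.
have [|||||_] := @Rintegral_dominated (fun n x => (F n x - f x) * (F n x - f x)) (fun=> 0) (fun
  x => 4 * f x ^+ 2).
- by move=> n; apply: measurable_funM; exact: measurable_funB.
- exact: measurable_cst.
- exact: itgZ.
- apply: aeW => x; rewrite -[X in _ --> X](mulr0 0).
  by apply: cvgM; rewrite -[X in _ --> X](subrr (f x)); apply: cvgB => //; exact: cvg_cst.
- move=> n x; rewrite -expr2 ger0_norm ?sqr_ge0//.
  have -> : 4 * f x ^+ 2 = (2 * `|f x|) ^+ 2 by rewrite exprMn real_normK ?num_real//; ring.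
  rewrite -(real_normK (num_real (_ - _))) lerXn2r ?nnegrE ?mulr_ge0//.
  by apply: (le_trans (ler_normB _ _)); have := FfB n x; lra.
by rewrite /Rintegral integral0.
Qed.

End dominated_L2.

Section heat.
Context {R : realType} {N : nat}.
Notation E := 'rV[R]_N.
Notation mu := (@lebesgueN R N).
Notation mu2 := (mu \x mu)%E.
Implicit Types (f g h : E -> R) (t : R).

Definition heat_kernel t (x y : E) : R := (Num.sqrt (4 * pi * t)) ^- N * gaussN (4 * t)^-1 (x - y).

Lemma heat_kernel_ge0 t x y : 0 <= heat_kernel t x y.
Proof. by rewrite mulr_ge0 ?gaussN_ge0// invr_ge0 exprn_ge0// sqrtr_ge0. Qed.

Lemma heat_kernelC t x y : heat_kernel t x y = heat_kernel t y x.
Proof.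
by rewrite /heat_kernel /gaussN -(opprB x y) (dotpC (- _)) dotpNl dotpC dotpNl opprK.
Qed.

Lemma measurable_heat_kernel t : measurable_fun setT (fun z : E * E => heat_kernel t z.1 z.2).
Proof.
apply: measurable_funM => //; apply: (measurableT_comp (@measurable_gaussN R N _)).
exact: measurable_rVB.
Qed.

Lemma measurable_heat_kernel1 t y : measurable_fun setT (fun x : E => heat_kernel t x y).
Proof. by apply: measurable_funM => //; exact: measurable_gaussNB. Qed.

Lemma measurable_heat_kernel2 t x : measurable_fun setT (fun y : E => heat_kernel t x y).
Proof. by under eq_fun do rewrite heat_kernelC; exact: measurable_heat_kernel1. Qed.

Lemma integral_heat_kernel1 t y : 0 < t -> (\int[mu]_x (heat_kernel t x y)%:E = 1)%E.
Proof.
move=> t0; have c0 : 0 < (4 * t)^-1 by rewrite invr_gt0 mulr_gt0.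
have s0 : 0 < Num.sqrt (4 * pi * t) by rewrite sqrtr_gt0 !mulr_gt0// pi_gt0.
under eq_integral do rewrite EFinM.
rewrite ge0_integralZl//; last 2 first.
- by apply/measurable_EFinP; exact: measurable_gaussNB.
- by move=> x _; rewrite lee_fin gaussN_ge0.
rewrite integral_gaussN// -EFinM invrK mulrCA mulrA mulVf// expf_neq0//.
by rewrite gt_eqF.
Qed.

Lemma integral_heat_kernel2 t x : 0 < t -> (\int[mu]_y (heat_kernel t x y)%:E = 1)%E.
Proof. by move=> t0; under eq_integral do rewrite heat_kernelC; exact: integral_heat_kernel1. Qed.

(** Half of the exponent gives the decay, and the other half is the kernel at
    the doubled time. *)
Lemma heat_kernel_far t r x y : 0 < t -> r ^+ 2 <= dotp (x - y) (x - y) ->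
  heat_kernel t x y <= expR (- (r ^+ 2 / (8 * t))) * (Num.sqrt 2) ^+ N * heat_kernel (2 * t) x y.
Proof.
move=> t0 rxy; rewrite /heat_kernel.
have s0 : 0 < Num.sqrt (4 * pi * t) by rewrite sqrtr_gt0 !mulr_gt0// pi_gt0.
have -> : 4 * pi * (2 * t) = 2 * (4 * pi * t) by ring.
have -> : gaussN (4 * t)^-1 (x - y) = gaussN (4 * (2 * t))^-1 (x - y) * gaussN (4 * (2 * t))^-1
  (x - y).
  by rewrite /gaussN -expRD; congr expR; field; rewrite gt_eqF.
set g0 := gaussN _ _.
rewrite (sqrtrM (4 * pi * t) (ler0n R 2)) (exprMn N (Num.sqrt 2)) (invfM (Num.sqrt 2 ^+ N)).
rewrite /g0 {g0}.
set g := gaussN _ _; set c := (Num.sqrt (4 * pi * t)) ^- N; set q := Num.sqrt 2 ^+ N.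
have q0 : q != 0 by rewrite expf_neq0// gt_eqF// sqrtr_gt0.
have -> : expR (- (r ^+ 2 / (8 * t))) * q * (q^-1 * c * g) = c * (expR (- (r ^+ 2 / (8 * t))) * g).
  by rewrite !mulrA mulfK//; ring.
rewrite ler_wpM2l//; first by rewrite invr_ge0 exprn_ge0// ltW.
rewrite ler_wpM2r ?gaussN_ge0// ler_expR lerN2.
have -> : 4 * (2 * t) = 8 * t by ring.
by rewrite mulrC ler_wpM2l// invr_ge0 mulr_ge0// ltW.
Qed.

(** The inner product of [f] with the heat flow of [g] at time [t]. As a double
    integral it is visibly symmetric, and monotone in nonnegative functions. *)
Definition heat_pairing t f g := \int[mu2]_z (f z.1 * g z.2 * heat_kernel t z.1 z.2).

Lemma measurable_heat_pairing t f g : measurable_fun setT f -> measurable_fun setT g ->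
  measurable_fun setT (fun z : E * E => f z.1 * g z.2 * heat_kernel t z.1 z.2).
Proof.
move=> mf mg; apply: measurable_funM; last exact: measurable_heat_kernel.
by apply: measurable_funM; apply: measurableT_comp => //.
Qed.

Lemma integral_sqr_heat_kernel1 t f : 0 < t -> sqint mu f ->
  (\int[mu2]_z (f z.1 ^+ 2 * heat_kernel t z.1 z.2)%:E = (inner mu f f)%:E)%E.
Proof.
move=> t0 fi; have mf := sqint_meas fi.
rewrite fubini_tonelli1; last 2 first.
- apply/measurable_EFinP; apply: measurable_funM; last exact: measurable_heat_kernel.
  by apply: measurable_funX; exact: measurableT_comp.
- by move=> z; rewrite lee_fin mulr_ge0 ?sqr_ge0 ?heat_kernel_ge0.
rewrite -integral_sqr//; apply: eq_integral => x _; rewrite /fubini_F/=.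
under eq_integral do rewrite EFinM.
rewrite ge0_integralZl//; last 3 first.
- by apply/measurable_EFinP; exact: measurable_heat_kernel2.
- by move=> y _; rewrite lee_fin heat_kernel_ge0.
- by rewrite lee_fin sqr_ge0.
by rewrite integral_heat_kernel2// mule1.
Qed.

Lemma integral_sqr_heat_kernel2 t f : 0 < t -> sqint mu f ->
  (\int[mu2]_z (f z.2 ^+ 2 * heat_kernel t z.1 z.2)%:E = (inner mu f f)%:E)%E.
Proof.
move=> t0 fi; have mf := sqint_meas fi.
rewrite fubini_tonelli2; last 2 first.
- apply/measurable_EFinP; apply: measurable_funM; last exact: measurable_heat_kernel.
  by apply: measurable_funX; exact: measurableT_comp.
- by move=> z; rewrite lee_fin mulr_ge0 ?sqr_ge0 ?heat_kernel_ge0.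
rewrite -integral_sqr//; apply: eq_integral => x _; rewrite /fubini_G/=.
under eq_integral do rewrite EFinM.
rewrite ge0_integralZl//; last 3 first.
- by apply/measurable_EFinP; exact: measurable_heat_kernel1.
- by move=> y _; rewrite lee_fin heat_kernel_ge0.
- by rewrite lee_fin sqr_ge0.
by rewrite integral_heat_kernel1// mule1.
Qed.

Let itg1 t f : 0 < t -> sqint mu f -> itg mu2 (fun z => f z.1 ^+ 2 * heat_kernel t z.1 z.2).
Proof.
move=> t0 fi; have mf := sqint_meas fi; apply: itg_ge0.
- apply: measurable_funM; last exact: measurable_heat_kernel.
  by apply: measurable_funX; exact: measurableT_comp.
- by move=> z; rewrite mulr_ge0 ?sqr_ge0 ?heat_kernel_ge0.
by rewrite integral_sqr_heat_kernel1// ltry.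
Qed.

Let itg2 t f : 0 < t -> sqint mu f -> itg mu2 (fun z => f z.2 ^+ 2 * heat_kernel t z.1 z.2).
Proof.
move=> t0 fi; have mf := sqint_meas fi; apply: itg_ge0.
- apply: measurable_funM; last exact: measurable_heat_kernel.
  by apply: measurable_funX; exact: measurableT_comp.
- by move=> z; rewrite mulr_ge0 ?sqr_ge0 ?heat_kernel_ge0.
by rewrite integral_sqr_heat_kernel2// ltry.
Qed.

Let heat_pairing_AMpt t f g (z : E * E) : `|f z.1 * g z.2 * heat_kernel t z.1 z.2| <=
  2^-1 * (f z.1 ^+ 2 * heat_kernel t z.1 z.2 + g z.2 ^+ 2 * heat_kernel t z.1 z.2).
Proof.
rewrite normrM (ger0_norm (heat_kernel_ge0 _ _ _)) -mulrDl (mulrA 2^-1); apply: ler_wpM2r;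
  first exact: heat_kernel_ge0.
rewrite normrM -(real_normK (num_real (f _))) -(real_normK (num_real (g _))).
set a := `|f _|; set b := `|g _|; have := sqr_ge0 (a - b); nra.
Qed.

Lemma itg_heat_pairing t f g : 0 < t -> sqint mu f -> sqint mu g ->
  itg mu2 (fun z => f z.1 * g z.2 * heat_kernel t z.1 z.2).
Proof.
move=> t0 fi gi; apply: itg_le (@heat_pairing_AMpt t f g).
  by apply: measurable_heat_pairing; [exact: (sqint_meas fi)|exact: (sqint_meas gi)].
by apply: itgZ; apply: itgD; [exact: (itg1 t0 fi)|exact: (itg2 t0 gi)].
Qed.

(** The kernel has unit mass in each variable, so the heat flow is a
    contraction of L2. *)
Lemma heat_pairing_AM t f g : 0 < t -> sqint mu f -> sqint mu g ->
  `|heat_pairing t f g| <= 2^-1 * (inner mu f f + inner mu g g).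
Proof.
move=> t0 fi gi; apply: (le_trans (le_normr_Rintegral _ _)) => //.
  exact: itg_heat_pairing.
have -> : 2^-1 * (inner mu f f + inner mu g g) =
    \int[mu2]_z (2^-1 * (f z.1 ^+ 2 * heat_kernel t z.1 z.2 + g z.2 ^+ 2 * heat_kernel t z.1 z.2)).
  rewrite RintegralZl//; last by apply: itgD; [exact: (itg1 t0 fi)|exact: (itg2 t0 gi)].
  rewrite RintegralD//; [|exact: (itg1 t0 fi)|exact: (itg2 t0 gi)].
  by rewrite /Rintegral integral_sqr_heat_kernel1// integral_sqr_heat_kernel2.
apply: le_Rintegral => //.
- by apply: itg_norm; exact: itg_heat_pairing.
- by apply: itgZ; apply: itgD; [exact: (itg1 t0 fi)|exact: (itg2 t0 gi)].
Qed.

Lemma heat_pairingDl t f g h : 0 < t -> sqint mu f -> sqint mu g -> sqint mu h ->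
  heat_pairing t (fun x => f x + g x) h = heat_pairing t f h + heat_pairing t g h.
Proof.
move=> t0 fi gi hi; rewrite /heat_pairing -RintegralD//; [|exact: itg_heat_pairing..].
by apply: eq_Rintegral => z _; rewrite !mulrDl.
Qed.

Lemma heat_pairingZl t c f h : 0 < t -> sqint mu f -> sqint mu h ->
  heat_pairing t (fun x => c * f x) h = c * heat_pairing t f h.
Proof.
move=> t0 fi hi; rewrite /heat_pairing -RintegralZl//; last exact: itg_heat_pairing.
by apply: eq_Rintegral => z _; rewrite !mulrA.
Qed.

Lemma heat_pairingC t f g : 0 < t -> sqint mu f -> sqint mu g ->
  heat_pairing t f g = heat_pairing t g f.
Proof.
move=> t0 fi gi; rewrite /heat_pairing /Rintegral.
rewrite -integral12_prod_meas1; last exact: itg_heat_pairing.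
rewrite -integral21_prod_meas1; last exact: itg_heat_pairing.
rewrite /fubini_F /fubini_G /=.
apply: (congr1 fine).
apply: (@eq_integral _ _ _ mu setT) => x _.
apply: (@eq_integral _ _ _ mu setT) => y _.
by rewrite (mulrC (f x)) heat_kernelC.
Qed.

Lemma heat_pairing_ge0 t f g : (forall x, 0 <= f x) -> (forall x, 0 <= g x) ->
  0 <= heat_pairing t f g.
Proof.
by move=> f0 g0; apply: Rintegral_ge0 => z _; rewrite mulr_ge0 ?heat_kernel_ge0// mulr_ge0.
Qed.

(** The form of the identity minus the heat flow. It is a finite substitute for
    the form of the Laplacian: bounded on L2, and with an integral kernel whose
    sign off the diagonal is known. *)
Definition heat_form t f g := inner mu f g - heat_pairing t f g.

Lemma heat_formC t f g : 0 < t -> sqint mu f -> sqint mu g -> heat_form t f g = heat_form t g f.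
Proof. by move=> *; rewrite /heat_form innerC heat_pairingC. Qed.

Lemma heat_formDl t f g h : 0 < t -> sqint mu f -> sqint mu g -> sqint mu h ->
  heat_form t (fun x => f x + g x) h = heat_form t f h + heat_form t g h.
Proof. by move=> *; rewrite /heat_form innerDl// heat_pairingDl//; ring. Qed.

Lemma heat_formZl t c f h : 0 < t -> sqint mu f -> sqint mu h ->
  heat_form t (fun x => c * f x) h = c * heat_form t f h.
Proof. by move=> *; rewrite /heat_form innerZl// heat_pairingZl//; ring. Qed.

Lemma heat_formDr t f g h : 0 < t -> sqint mu f -> sqint mu g -> sqint mu h ->
  heat_form t h (fun x => f x + g x) = heat_form t h f + heat_form t h g.
Proof. by move=> *; rewrite heat_formC ?heat_formDl ?(heat_formC _ (f := h))//; exact: sqintD. Qed.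

Lemma heat_formZr t c f h : 0 < t -> sqint mu f -> sqint mu h ->
  heat_form t h (fun x => c * f x) = c * heat_form t h f.
Proof. by move=> *; rewrite heat_formC ?heat_formZl ?(heat_formC _ (f := h))//; exact: sqintZ. Qed.

Lemma heat_form_ge0 t f : 0 < t -> sqint mu f -> 0 <= heat_form t f f.
Proof. by move=> t0 fi; have /ler_normlP[_] := heat_pairing_AM t0 fi fi; rewrite /heat_form;
  lra. Qed.

Lemma heat_form_le t f : 0 < t -> sqint mu f -> heat_form t f f <= 2 * inner mu f f.
Proof. by move=> t0 fi; have /ler_normlP[] := heat_pairing_AM t0 fi fi; rewrite /heat_form;
  lra. Qed.

Lemma heat_form_sqrD t f g : 0 < t -> sqint mu f -> sqint mu g ->
  heat_form t (fun x => f x + g x) (fun x => f x + g x) = heat_form t f f + 2 * heat_form t f g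
    + heat_form t g g.
Proof.
move=> t0 fi gi; have fgi := sqintD fi gi.
by rewrite heat_formDl// !heat_formDr// (heat_formC t0 gi fi); ring.
Qed.

Lemma heat_form_AM t f g : 0 < t -> sqint mu f -> sqint mu g ->
  `|heat_form t f g| <= 2^-1 * (heat_form t f f + heat_form t g g).
Proof.
move=> t0 fi gi; have ni : sqint mu (fun x => -1 * g x) by exact: sqintZ.
have h1 := heat_form_ge0 t0 (sqintD fi gi); have h2 := heat_form_ge0 t0 (sqintD fi ni).
rewrite heat_form_sqrD// in h1; rewrite heat_form_sqrD// !heat_formZr// heat_formZl// in h2.
by rewrite ler_norml; lra.
Qed.

Lemma heat_form_sqrD_le t f g : 0 < t -> sqint mu f -> sqint mu g ->
  heat_form t (fun x => f x + g x) (fun x => f x + g x) <= 2 * (heat_form t f f + heat_form t g g).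
Proof.
by move=> t0 fi gi; rewrite heat_form_sqrD//; have /ler_normlP[] := heat_form_AM t0 fi gi; lra.
Qed.

End heat.

(** * Continuity of the heat flow at time zero *)
Section heat_limit.
Import HBNNSimple.
Context {R : realType} {N : nat}.
Notation E := 'rV[R]_N.
Notation mu := (@lebesgueN R N).
Implicit Types (f g h : E -> R).

Definition invS (n : nat) : R := n.+1%:R^-1.

Lemma invS_gt0 n : 0 < invS n. Proof. by rewrite invr_gt0. Qed.

Lemma cvg_invS : invS n @[n --> \oo] --> (0 : R). Proof. exact: (@cvg_harmonic R). Qed.

Lemma sqint_indic (A : set E) : measurable A -> (mu A < +oo)%E -> sqint mu \1_A.
Proof.
move=> mA Aoo; apply/sqintP; split; first exact: measurable_indic.
have -> : (fun x => \1_A x ^+ 2) = \1_A :> (E -> R).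
  by apply/funext => x; rewrite indicE; case: (_ \in _); rewrite ?expr1n ?expr0n.
apply: itg_ge0 => //.
by rewrite integral_indic// setIT.
Qed.

Lemma itg_heat_kernel2 t (x : E) : 0 < t -> itg mu (heat_kernel t x).
Proof.
move=> t0; apply: itg_ge0; [exact: measurable_heat_kernel2|by move=> y; exact: heat_kernel_ge0|].
by rewrite integral_heat_kernel2// ltry.
Qed.

(** A sequence of times is enough: these functions form a vector space that is
    closed under L2 limits, and the aim is to show that all of L2 is reached. *)
Definition heat_vanishing f := sqint mu f /\ heat_form (invS n) f f @[n --> \oo] --> (0 : R).

Lemma heat_vanishingD f g : heat_vanishing f -> heat_vanishing g ->
  heat_vanishing (fun x => f x + g x).
Proof.
move=> [fi f0] [gi g0]; split; first exact: sqintD.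
apply: (@squeeze_cvgr _ _ _ _ (fun=> 0) (fun n => 2 * (heat_form (invS n) f f + heat_form (invS
  n) g g))).
- apply: nearW => n; rewrite heat_form_ge0 ?invS_gt0//=; last exact: sqintD.
  by rewrite heat_form_sqrD_le ?invS_gt0.
- exact: cvg_cst.
- rewrite (_ : 0 = 2 * (0 + 0) :> R); last by rewrite addr0 mulr0.
  by apply: cvgMl_tmp; exact: cvgD.
Qed.

Lemma heat_vanishingZ c f : heat_vanishing f -> heat_vanishing (fun x => c * f x).
Proof.
move=> [fi f0]; split; first exact: sqintZ.
have -> : (fun n => heat_form (invS n) (fun x => c * f x) (fun x => c * f x)) =
    (fun n => c * (c * heat_form (invS n) f f)).
  apply/funext => n; rewrite heat_formZl ?invS_gt0//; last exact: sqintZ.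
  by rewrite heat_formZr ?invS_gt0.
rewrite (_ : 0 = c * (c * 0) :> R); last by rewrite !mulr0.
by apply: cvgMl_tmp; exact: cvgMl_tmp.
Qed.

Lemma heat_vanishing0 : heat_vanishing (fun=> 0).
Proof.
split; first exact: sqint0.
rewrite (_ : (fun n => _) = (fun=> 0)); first exact: cvg_cst.
apply/funext => n; rewrite /heat_form /inner /heat_pairing.
under eq_Rintegral do rewrite mulr0; under [X in _ - X]eq_Rintegral do rewrite !mul0r.
by rewrite /Rintegral !integral0 subrr.
Qed.

Lemma heat_vanishingB f g : heat_vanishing f -> heat_vanishing g ->
  heat_vanishing (fun x => f x - g x).
Proof.
move=> sf sg; have := heat_vanishingD sf (heat_vanishingZ (-1) sg).
by under [X in heat_vanishing X -> _]eq_fun do rewrite mulN1r.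
Qed.

Lemma heat_vanishing_sum (I : Type) (r : seq I) (F : I -> E -> R) :
  (forall i, heat_vanishing (F i)) -> heat_vanishing (fun x => \sum_(i <- r) F i x).
Proof.
move=> sF; elim: r => [|i r IH].
  by under [X in heat_vanishing X]eq_fun do rewrite big_nil; exact: heat_vanishing0.
by under [X in heat_vanishing X]eq_fun do rewrite big_cons; exact: heat_vanishingD.
Qed.

(** The heat form is bounded by twice the squared norm, uniformly in the time. *)
Lemma heat_vanishing_lim (F : nat -> E -> R) f : (forall n, heat_vanishing (F n)) -> sqint mu f ->
  l2cvg mu F f -> heat_vanishing f.
Proof.
move=> sF fi Ff; split => //; apply/cvgrPdist_le => e e0.
have e8 : 0 < e / 8 by rewrite divr_gt0.
have [k _ /(_ k (leqnn k)) /=] := (cvgrPdist_le _ _).1 Ff _ e8.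
rewrite sub0r normrN ger0_norm ?inner_ge0// => kP.
have [Fki Fk0] := sF k.
have e4 : 0 < e / 4 by rewrite divr_gt0.
move: Fk0 => /cvgrPdist_le/(_ _ e4); apply: filterS => n.
have t0 := invS_gt0 n.
rewrite !sub0r !normrN !ger0_norm ?heat_form_ge0// => h1.
have rki : sqint mu (fun x => -1 * (F k x - f x)) by apply: sqintZ; exact: sqintB.
have := heat_form_sqrD_le t0 Fki rki.
rewrite (_ : (fun x => F k x + _) = f); last by apply/funext => x; ring.
have := heat_form_le t0 rki.
rewrite innerZl// ?innerZr//; [|exact: sqintB..].
lra.
Qed.

(** At a point of an open set the heat that stays in the set tends to one,
    because the kernel concentrates ([heat_kernel_far]); then dominated
    convergence. *)
Lemma heat_vanishing_open (U : set E) : open U -> (mu U < +oo)%E -> heat_vanishing \1_U.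
Proof.
move=> oU Uoo; have mU := open_measurable_rV oU.
have Ui := sqint_indic mU Uoo; split => //.
have mI : measurable_fun setT (\1_U : E -> R) by exact: measurable_indic.
(* the heat flow of the indicator at time [invS n] *)
pose m n x := \int[mu]_y (\1_U y * heat_kernel (invS n) x y).
have ik n x (f : E -> R) : measurable_fun setT f -> (forall y, 0 <= f y <= 1) ->
    itg mu (fun y => f y * heat_kernel (invS n) x y).
  move=> mf f01; apply: itg_ge0.
  - by apply: measurable_funM => //; exact: measurable_heat_kernel2.
  - by move=> y; have /andP[? _] := f01 y; rewrite mulr_ge0 ?heat_kernel_ge0.
  - apply: (@le_lt_trans _ _ 1%E); last exact: ltry.
    rewrite -(integral_heat_kernel2 x (invS_gt0 n)); apply: ge0_le_integral => //.
    + by move=> y _; have /andP[? _] := f01 y; rewrite lee_fin mulr_ge0 ?heat_kernel_ge0.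
    + by apply/measurable_EFinP; apply: measurable_funM => //; exact: measurable_heat_kernel2.
    + by apply/measurable_EFinP; exact: measurable_heat_kernel2.
    + by move=> y _; have /andP[_ ?] := f01 y; rewrite lee_fin ler_piMl ?heat_kernel_ge0.
have ind01 (A : set E) y : 0 <= (\1_A y : R) <= 1.
  by rewrite indicE; case: (_ \in _); rewrite ?lexx ?ler01.
have m1 n : \int[mu]_x (\1_U x * m n x) = heat_pairing (invS n) \1_U \1_U.
  rewrite /heat_pairing /Rintegral -integral12_prod_meas1;
    last exact: (itg_heat_pairing (invS_gt0 n) Ui Ui).
  apply: (congr1 fine); apply: eq_integral => x _; rewrite /fubini_F/=.
  rewrite EFinM /m fineK; last by apply: integrable_fin_num => //; exact: ik.
  rewrite -integralZl//; last exact: ik.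
  by apply: eq_integral => y _; rewrite -EFinM mulrA.
have m01 n x : 0 <= m n x <= 1.
  rewrite Rintegral_ge0/=; last by move=> y _; have /andP[? _] := ind01 U y;
    rewrite mulr_ge0 ?heat_kernel_ge0.
  rewrite -[leRHS](_ : \int[mu]_y heat_kernel (invS n) x y = 1);
    last by rewrite /Rintegral integral_heat_kernel2 ?invS_gt0.
  apply: le_Rintegral => //; first exact: ik.
    exact: itg_heat_kernel2 (invS_gt0 n).
  by move=> y _; have /andP[_ ?] := ind01 U y; rewrite ler_piMl ?heat_kernel_ge0.
have mm n : measurable_fun setT (m n).
  apply: (@measurableT_comp _ _ _ _ _ _ (@fine R)) => //.
  apply: (measurable_fun_fubini_tonelli_F (fun z : E * E => (\1_U z.2 * heat_kernel (invS n) z.1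
    z.2)%:E)).
    apply/measurable_EFinP; apply: measurable_funM; last exact: measurable_heat_kernel.
    exact: (measurableT_comp mI).
  by move=> z; have /andP[? _] := ind01 U z.2; rewrite lee_fin mulr_ge0 ?heat_kernel_ge0.
have m_cvg x : U x -> m n x @[n --> \oo] --> (1 : R).
  move=> Ux; have /nbhs_ballP[e /= e0 eU] := open_nbhs_nbhs (conj oU Ux).
  pose C : R := Num.sqrt 2 ^+ N.
  have C0 : 0 <= C by rewrite exprn_ge0.
  apply/cvgrPdist_le => d d0.
  have : C * (8 / e ^+ 2 * invS n) @[n --> \oo] --> C * (8 / e ^+ 2 * (0 : R)).
    by apply: cvgMl_tmp; apply: cvgMl_tmp; exact: cvg_invS.
  rewrite !mulr0 => /cvgrPdist_le/(_ _ d0); apply: filterS => n.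
  rewrite sub0r normrN => h.
  have /andP[_ mle1] := m01 n x.
  rewrite ger0_norm ?subr_ge0//; apply: (le_trans _ (le_trans (ler_norm _) h)).
  have -> : 1 - m n x = \int[mu]_y ((1 - \1_U y) * heat_kernel (invS n) x y).
    have E1 : \int[mu]_y heat_kernel (invS n) x y = 1 by rewrite /Rintegral
      integral_heat_kernel2 ?invS_gt0.
    rewrite -[X in X - _]E1 /m -RintegralB//.
    - by apply: eq_Rintegral => y _; rewrite mulrBl mul1r.
    - exact: itg_heat_kernel2 (invS_gt0 n).
    - exact: ik.
  have t0 := invS_gt0 n; have tt0 : 0 < 2 * invS n by rewrite mulr_gt0.
  have i2 : itg mu (heat_kernel (2 * invS n) x) by exact: itg_heat_kernel2.
  apply: (@le_trans _ _ (\int[mu]_y (expR (- (e ^+ 2 / (8 * invS n))) * C * heat_kernel (2 *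
    invS n) x y))).
    apply: le_Rintegral => //.
    - apply: ik; first exact: measurable_funB.
      by move=> y; have := ind01 U y; lra.
    - exact: itgZ.
    - move=> y _; rewrite indicE; have [yU|/negP nyU] := boolP (y \in U).
        by rewrite subrr mul0r !mulr_ge0 ?expR_ge0 ?heat_kernel_ge0.
      rewrite subr0 mul1r; apply: heat_kernel_far => //.
      rewrite leNgt; apply/negP => lt; apply: nyU; rewrite inE; apply: eU; split => // i j.
      rewrite ord1 /ball/=; apply: (@le_lt_trans _ _ (enorm (x - y))).
        by have := coord_le_enorm (x - y) j; rewrite !mxE.
      by rewrite -ltr_sqr ?nnegrE ?enorm_ge0 ?ltW// enorm_sqr.
  rewrite RintegralZl// [X in _ * X](_ : _ = 1) ?mulr1;
    last by rewrite /Rintegral integral_heat_kernel2.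
  rewrite mulrC ler_wpM2l// expRN -[leRHS]invrK lef_pV2 ?posrE ?expR_gt0 ?invr_gt0 ?mulr_gt0
    ?invr_gt0 ?exprn_gt0//.
  apply: le_trans (expR_ge1Dx _); rewrite ler_wpDl//.
  by rewrite le_eqVlt; apply/orP; left; apply/eqP; field; rewrite !gt_eqF.
have Iid x : \1_U x * \1_U x = \1_U x :> R.
  by rewrite indicE; case: (_ \in _); rewrite ?mul1r ?mul0r.
have Iint : itg mu (\1_U : E -> R).
  have := itgM Ui Ui; by under [X in itg _ X -> _]eq_fun do rewrite Iid.
have [|||_] := @Rintegral_dominated _ _ _ mu (fun n x => \1_U x * m n x) \1_U \1_U
  (fun n => measurable_funM mI (mm n)) mI.
- exact: Iint.
- apply: aeW => x; have [xU|nxU] := boolP (x \in U).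
    rewrite indicE xU; rewrite -[X in _ --> X](mulr1 1).
    by apply: cvgMl_tmp; apply: m_cvg; rewrite inE in xU.
  rewrite indicE (negbTE nxU); under eq_fun do rewrite mul0r; exact: cvg_cst.
- move=> n x; have /andP[h0 h1] := ind01 U x; have /andP[h2 h3] := m01 n x.
  by rewrite ger0_norm ?mulr_ge0// ler_piMr.
rewrite (funext m1) => h.
have dE : inner mu \1_U \1_U = \int[mu]_x (\1_U x : R).
  by apply: eq_Rintegral => x _; rewrite Iid.
rewrite -[X in _ --> X](subrr (inner mu \1_U \1_U)) [X in _ --> _ - X]dE.
by apply: cvgB => //; exact: cvg_cst.
Qed.

Lemma sigma_open_rV : (measurable : set (set E)) = <<s (open : set (set E)) >>.
Proof.
apply/seteqP; split => [A mA|A].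
  pose F := <<s (open : set (set E)) >>.
  have cF (i : 'I_N) (Y : set R) : measurable Y -> F ((fun x : E => x ord0 i) @^-1` Y).
    have mE : (measurable : set (set R)) = <<s @RGenOpens.G R >> by exact:
      (RGenOpens.measurableE R).
    move=> mY; have {mE mY} : <<s @RGenOpens.G R >> Y.
      exact: (eq_rect _ (fun F : set (set R) => F Y) mY _ mE).
    move: Y; apply: (@smallest_sub _ _ (RGenOpens.G (R := R)) [set Y | F ((fun x : E => x ord0
      i) @^-1` Y)]).
      split => /=.
      - by rewrite preimage_set0; exact: sigma_algebra0.
      - by move=> B FB; rewrite setTD preimage_setC -setTD; exact: sigma_algebraCD.
      - by move=> G FG; rewrite preimage_bigcup; exact: sigma_algebra_bigcup.
    move=> _ [a [b ->]]; apply: sub_sigma_algebra.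
    by apply: open_comp; [move=> x _;
      exact: (@coord_continuous R 1 N ord0 i x)|exact: interval_open].
  move: A mA; apply: smallest_sub; first exact: smallest_sigma_algebra.
  by rewrite -bigcup_seq/= => B [i _] [Y mY <-] /=; rewrite setTI; exact: cF.
apply: smallest_sub => [|U oU]; last exact: open_measurable_rV.
exact: sigma_algebra_measurable.
Qed.

(** Open sets are stable under intersection and generate the sigma-algebra, so
    that Dynkin's theorem applies; the ball keeps all measures finite. *)
Lemma heat_vanishing_bounded (m : nat) (A : set E) : measurable A ->
  heat_vanishing (\1_(A `&` eball 0 m%:R)).
Proof.
move=> mA; pose D : set E := eball 0 m%:R.
have mD : measurable D by exact: measurable_eball.
have Doo B : measurable B -> (mu (B `&` D) < +oo)%E.
  move=> mB; apply: le_lt_trans (lebesgueN_eball_lty 0 m%:R).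
  by apply: le_measure; rewrite ?inE//; exact: measurableI.
have sD : heat_vanishing \1_D.
  by apply: heat_vanishing_open; [exact: open_eball|exact: lebesgueN_eball_lty].
move: (mA); rewrite sigma_open_rV; move: A {mA}.
apply: (@dynkin_induction _ _ (open : set (set E)) (fun A => heat_vanishing \1_(A `&` D))) => //.
- exact: sigma_open_rV.
- by move=> A B oA oB; exact: openI.
- by rewrite setTI.
- move=> U oU; apply: heat_vanishing_open; first by apply: openI => //; exact: open_eball.
  exact: (Doo _ (open_measurable_rV oU)).
- move=> A mA sA; rewrite (_ : \1_(~` A `&` D) = (fun x => \1_D x - \1_(A `&` D) x)).
    exact: heat_vanishingB.
  apply/funext => x; rewrite !indicE !in_setI in_setC.
  by case: (x \in A); case: (x \in D); rewrite /= ?subrr ?subr0.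
- move=> F mF tF sF.
  apply: (@heat_vanishing_lim (fun n x => \sum_(k <- iota 0 n) \1_(F k `&` D) x)).
  + by move=> n; exact: heat_vanishing_sum.
  + by apply: sqint_indic; [apply: measurableI => //; exact: bigcup_measurable|apply: Doo;
    exact: bigcup_measurable].
  + have key x k n : F k x -> D x -> \sum_(j <- iota 0 n) (\1_(F j `&` D) x : R) = (k < n)%:R.
      move=> Fk Dx; elim: n => [|n IH]; first by rewrite big_nil.
      rewrite -addn1 iotaD big_cat IH /= big_seq1 add0n addn1 ltnS indicE in_setI (mem_set Dx)
        andbT.
      have [kn|kn|kn] := ltngtP k n.
      * rewrite (_ : (x \in F n) = false) ?addr0 ?(ltnW kn)//.
        apply/negP; rewrite inE => Fn; have E1 := tF k n I I (ex_intro _ x (conj Fk Fn)).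
        by rewrite E1 ltnn in kn.
      * rewrite (_ : (x \in F n) = false) ?addr0 ?leqNgt ?kn//.
        apply/negP; rewrite inE => Fn; have E1 := tF k n I I (ex_intro _ x (conj Fk Fn)).
        by rewrite E1 ltnn in kn.
      * by rewrite -kn (mem_set Fk) add0r.
    have key0 x n : ~ ((\bigcup_k F k) `&` D) x -> \sum_(j <- iota 0 n) (\1_(F j `&` D) x : R) = 0.
      move=> nx; rewrite big1_seq// => j _; rewrite indicE memNset// => -[Fj Dx].
      by apply: nx; split => //; exists j.
    apply: l2cvg_dominated.
    * move=> n; apply: measurable_sum => j; apply: measurable_indic.
      exact: measurableI.
    * by apply: sqint_indic; [apply: measurableI => //; exact: bigcup_measurable|apply: Doo;
      exact: bigcup_measurable].
    * move=> x; have [xU|nxU] := pselect (((\bigcup_k F k) `&` D) x).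
        rewrite indicE mem_set//; case: xU => -[k _ Fk] Dx.
        apply: cvg_near_cst; exists k.+1 => // n /= kn.
        by rewrite (key x k)// kn.
      rewrite indicE memNset//; under eq_fun do rewrite key0//; exact: cvg_cst.
    * move=> n x; have [xU|nxU] := pselect (((\bigcup_k F k) `&` D) x).
        rewrite indicE mem_set//; case: xU => -[k _ Fk] Dx.
        by rewrite (key x k)// normr1 ger0_norm// lern1; case: (k < n)%N.
      by rewrite key0// normr0.
Qed.

Definition trunc n (f : E -> R) (x : E) : R := f x * \1_(eball 0 n%:R) x.

Lemma measurable_trunc n f : measurable_fun setT f -> measurable_fun setT (trunc n f).
Proof. by move=> mf; apply: measurable_funM => //; apply: measurable_indic;
  exact: measurable_eball. Qed.

Lemma trunc_le n f x : `|trunc n f x| <= `|f x|.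
Proof.
by rewrite /trunc normrM ler_piMr// indicE; case: (_ \in _); rewrite ?normr0 ?normr1.
Qed.

Lemma sqint_trunc n f : sqint mu f -> sqint mu (trunc n f).
Proof.
move=> fi; apply: (sqint_le _ fi (@trunc_le n f)).
by apply: measurable_trunc; exact: (sqint_meas fi).
Qed.

Lemma trunc_cvg f x : trunc n f x @[n --> \oo] --> f x.
Proof.
apply: cvg_near_cst; near=> n.
rewrite /trunc indicE mem_set ?mulr1// /eball/= subr0.
by near: n; exact: nbhs_infty_gtr.
Unshelve. all: by end_near. Qed.

Lemma trunc_l2cvg f : sqint mu f -> l2cvg mu (fun n => trunc n f) f.
Proof.
move=> fi; apply: l2cvg_dominated => //.
- by move=> n; apply: measurable_trunc; exact: (sqint_meas fi).
- by move=> x; exact: trunc_cvg.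
- by move=> n x; exact: trunc_le.
Qed.

(** Approximation from below by simple functions, cut off to balls. *)
Lemma heat_vanishing_ge0 f : sqint mu f -> (forall x, 0 <= f x) -> heat_vanishing f.
Proof.
move=> fi f0; have mf := sqint_meas fi.
have mEf : measurable_fun setT (EFin \o f) by exact/measurable_EFinP.
pose a := nnsfun_approx measurableT mEf.
have ac x : a n x @[n --> \oo] --> f x.
  have /fine_cvgP[_] := @cvg_nnsfun_approx _ _ _ _ measurableT (EFin \o f) mEf (fun x _ => f0 x)
    x I.
  by [].
have a_nd x : {homo (fun n => a n x) : n m / (n <= m)%N >-> n <= m}.
  by move=> n m nm; have /lefP := nd_nnsfun_approx measurableT mEf nm; exact.
have ale n x : a n x <= f x.
  rewrite -(cvg_lim _ (ac x))//; apply: limr_ge; first by apply/cvg_ex; exists (f x).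
  by exists n => // m /=; exact: a_nd.
apply: (@heat_vanishing_lim (fun n => trunc n (a n))) => //.
- move=> n; rewrite /trunc.
  under [X in heat_vanishing X]eq_fun do rewrite fimfunE fsbig_finite// mulr_suml.
  apply: heat_vanishing_sum => y.
  under [X in heat_vanishing X]eq_fun do rewrite -mulrA.
  apply: heat_vanishingZ.
  rewrite (_ : (fun x => _) = \1_((a n @^-1` [set y]) `&` eball 0 n%:R)).
    by apply: heat_vanishing_bounded; exact: measurable_funPTI.
  by apply/funext => x; rewrite !indicE in_setI; case: (_ \in _); rewrite ?mul1r ?mul0r.
- apply: l2cvg_dominated => //.
  + by move=> n; apply: measurable_trunc; exact: measurable_funP.
  + move=> x; rewrite -[X in _ --> X]mulr1; apply: cvgM; first exact: ac.
    have := @trunc_cvg (cst 1) x; rewrite /trunc/=.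
    by under eq_fun do rewrite mul1r.
  + move=> n x; apply: (le_trans (@trunc_le n _ x)).
    by rewrite !ger0_norm.
Qed.

(** The heat flow is strongly continuous at time zero. *)
Lemma heat_form_invS_cvg0 f : sqint mu f -> heat_form (invS n) f f @[n --> \oo] --> (0 : R).
Proof.
move=> fi; suff : heat_vanishing f by case.
have mf := sqint_meas fi.
have pi_ : sqint mu (fun x => Num.max (f x) 0).
  apply: (sqint_le _ fi); first exact: measurable_maxr.
  by move=> x; rewrite ger0_norm ?le_max ?lexx ?orbT// ge_max ler_norm normr_ge0.
have ni : sqint mu (fun x => Num.max (- f x) 0).
  apply: (sqint_le _ fi); first by apply: measurable_maxr => //; exact: measurable_funN.
  by move=> x; rewrite ger0_norm ?le_max ?lexx ?orbT// ge_max -normrN ler_norm normr_ge0.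
have -> : f = (fun x => Num.max (f x) 0 - Num.max (- f x) 0).
  apply/funext => x; have [h|h] := leP 0 (f x).
    by rewrite max_r ?subr0// oppr_le0.
  by rewrite max_l ?sub0r ?opprK// oppr_ge0 ltW.
by apply: heat_vanishingB; apply: heat_vanishing_ge0 => // x; rewrite le_max lexx orbT.
Qed.

End heat_limit.

(** * The Hartley transform on L2 *)
Section product_Rintegral.
Context d1 d2 (T1 : measurableType d1) (T2 : measurableType d2) (R : realType).
Variables (m1 : {sigma_finite_measure set T1 -> \bar R}) (m2 : {sigma_finite_measure set T2 ->
  \bar R}).

Lemma Rintegral_prod1 (F : T1 * T2 -> R) : itg (m1 \x m2)%E F ->
  (forall x, itg m2 (fun y => F (x, y))) ->
  \int[(m1 \x m2)%E]_z F z = \int[m1]_x \int[m2]_y F (x, y).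
Proof.
move=> Fi F1; rewrite /Rintegral -integral12_prod_meas1//.
apply: (congr1 fine); apply: eq_integral => x _; rewrite fineK//.
by apply: integrable_fin_num => //; exact: F1.
Qed.

Lemma Rintegral_prod2 (F : T1 * T2 -> R) : itg (m1 \x m2)%E F ->
  (forall y, itg m1 (fun x => F (x, y))) ->
  \int[(m1 \x m2)%E]_z F z = \int[m2]_y \int[m1]_x F (x, y).
Proof.
move=> Fi F2; rewrite /Rintegral -integral21_prod_meas1//.
apply: (congr1 fine); apply: eq_integral => x _; rewrite fineK//.
by apply: integrable_fin_num => //; exact: F2.
Qed.

Lemma itg_tensor (f : T1 -> R) (g : T2 -> R) : itg m1 f -> itg m2 g ->
  itg (m1 \x m2)%E (fun z => f z.1 * g z.2).
Proof.
move=> fi gi; have mf := itg_meas fi; have mg := itg_meas gi.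
have mF : measurable_fun setT (fun z : T1 * T2 => f z.1 * g z.2).
  by apply: measurable_funM; exact: measurableT_comp.
apply/(itgP _ mF).
rewrite (fubini_tonelli1 (fun z => `|f z.1 * g z.2|%:E)); last 2 first.
- by apply/measurable_EFinP; exact: measurableT_comp.
- by move=> z; rewrite lee_fin.
rewrite (_ : (\int[m1]_x _ = \int[m1]_x (\int[m2]_y `|g y| * `|f x|)%:E)%E); last first.
  apply: eq_integral => x _; rewrite /fubini_F/=.
  rewrite -RintegralZr//; last exact: itg_norm.
  rewrite /Rintegral fineK; first by apply: eq_integral => y _; rewrite normrM mulrC.
  apply: integrable_fin_num => //.
  have := itgZ `|f x| (itg_norm gi).
  by under [X in itg _ X -> _]eq_fun do rewrite mulrC.
exact: (integrable_lty measurableT (itgZ (\int[m2]_y `|g y|) (itg_norm fi))).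
Qed.

End product_Rintegral.

Section hartley.
Context {R : realType} {N : nat}.
Notation E := 'rV[R]_N.
Notation mu := (@lebesgueN R N).
Implicit Types (f g h k : E -> R) (t : R).

Lemma heat_form_cvg t (F G : nat -> E -> R) f g : 0 < t ->
  (forall n, sqint mu (F n)) -> sqint mu f -> (forall n, sqint mu (G n)) -> sqint mu g ->
  l2cvg mu F f -> l2cvg mu G g -> heat_form t (F n) (G n) @[n --> \oo] --> heat_form t f g.
Proof.
move=> t0; apply: (@form_cvg _ _ _ _ (heat_form t) 2).
- by move=> *; exact: heat_formDl.
- by move=> *; exact: heat_formZl.
- by move=> *; exact: heat_formC.
- by move=> u ui; rewrite heat_form_ge0// heat_form_le.
Qed.

(** The kernel of the Hartley transform, the real counterpart of the complex
    exponential. *)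
Definition cas (x : R) : R := cos x + sin x.

Lemma cas_le2 x : `|cas x| <= 2.
Proof.
apply: (le_trans (ler_normD _ _)).
have h1 : `|cos x| <= 1 by rewrite ler_norml cos_geN1 cos_le1.
have h2 : `|sin x| <= 1 by rewrite ler_norml sin_geN1 sin_le1.
lra.
Qed.

Lemma casM x y : cas x * cas y = cos (x - y) + sin (x + y).
Proof. by rewrite /cas cosB sinD; ring. Qed.

Lemma measurable_cas d (T : measurableType d) (f : T -> R) :
  measurable_fun setT f -> measurable_fun setT (fun x => cas (f x)).
Proof.
move=> mf; apply: measurable_funD.
  exact: (measurable_trig (@continuous_cos R) mf).
exact: (measurable_trig (@continuous_sin R) mf).
Qed.

Lemma measurable_cas_dotp (y : E) : measurable_fun setT (fun x : E => cas (dotp x y)).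
Proof. by apply: measurable_cas; apply: measurable_dotp => //; exact: measurable_cst. Qed.

Lemma itg_cas f (y : E) : itg mu f -> itg mu (fun x => f x * cas (dotp x y)).
Proof.
move=> fi; apply: (itg_le _ (itgZ 2 (itg_norm fi))).
  by apply: measurable_funM; [exact: (itg_meas fi)|exact: measurable_cas_dotp].
by move=> x; rewrite normrM mulrC ler_wpM2r// cas_le2.
Qed.

(** The difference of the real and imaginary parts of the Fourier transform.
    It carries the same information in one real function, and it is its own
    inverse up to a constant. *)
Definition hartley f (y : E) : R := \int[mu]_x (f x * cas (dotp x y)).

Lemma hartley_le f y : itg mu f -> `|hartley f y| <= 2 * \int[mu]_x `|f x|.
Proof.
move=> fi; apply: (le_trans (le_normr_Rintegral _ (itg_cas y fi))) => //.
rewrite -RintegralZl//; last exact: itg_norm.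
apply: le_Rintegral => //.
- by apply: itg_norm; exact: itg_cas.
- by apply: itgZ; exact: itg_norm.
- by move=> x _; rewrite normrM mulrC ler_wpM2r// cas_le2.
Qed.

Lemma measurable_hartley f : measurable_fun setT f -> measurable_fun setT (hartley f).
Proof.
move=> mf; pose F (z : E * E) : \bar R := (f z.1 * cas (dotp z.1 z.2))%:E.
have mF : measurable_fun setT F.
  apply/measurable_EFinP; apply: measurable_funM; first exact: measurableT_comp.
  by apply: measurable_cas; exact: measurable_dotp.
apply: (@measurableT_comp _ _ _ _ _ _ (@fine R)) => //.
rewrite (_ : (fun y => _) = (fun y => \int[mu]_x (fun z => F (z.1, z.2))^\+ (x, y) -
    \int[mu]_x (fun z => F (z.1, z.2))^\- (x, y)))%E; last first.
  apply/funext => y; rewrite integralE; congr (_ - _)%E; apply: eq_integral => x _.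
    by rewrite !funeposE.
  by rewrite !funenegE.
have FE : (fun z => F (z.1, z.2)) = F by apply/funext; case.
rewrite FE; apply: emeasurable_funB.
  apply: (measurable_fun_fubini_tonelli_G (F^\+)%E); first exact: measurable_funepos.
  by move=> z; rewrite funeposE le_max lexx orbT.
apply: (measurable_fun_fubini_tonelli_G (F^\-)%E); first exact: measurable_funeneg.
by move=> z; rewrite funenegE le_max lexx orbT.
Qed.

Lemma itg_hartleyM f k : itg mu f -> itg mu k -> itg mu (fun y => hartley f y * k y).
Proof.
move=> fi ki; apply: (itg_le _ (itgZ (2 * \int[mu]_x `|f x|) (itg_norm ki))).
  apply: measurable_funM; last exact: (itg_meas ki).
  by apply: measurable_hartley; exact: (itg_meas fi).
by move=> y; rewrite normrM ler_wpM2r// hartley_le.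
Qed.

Lemma hartley_sym f k : itg mu f -> itg mu k ->
  \int[mu]_y (hartley f y * k y) = \int[mu]_x (f x * hartley k x).
Proof.
move=> fi ki; have mf := itg_meas fi; have mk := itg_meas ki.
pose F (z : E * E) : R := f z.1 * k z.2 * cas (dotp z.1 z.2).
have mF : measurable_fun setT F.
  apply: measurable_funM; first by apply: measurable_funM; exact: measurableT_comp.
  by apply: measurable_cas; exact: measurable_dotp.
have Fi : itg (mu \x mu)%E F.
  apply: (itg_le mF (itgZ 2 (itg_norm (itg_tensor fi ki)))) => z.
  by rewrite /F normrM mulrC ler_wpM2r//; exact: cas_le2.
transitivity (\int[(mu \x mu)%E]_z F z).
  rewrite Rintegral_prod2//.
    apply: eq_Rintegral => y _; rewrite mulrC -RintegralZl//; last exact: itg_cas.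
    by apply: eq_Rintegral => x _; rewrite /F/= mulrCA mulrA.
  move=> y; rewrite /F/=.
  under [X in itg _ X]eq_fun do rewrite (mulrC (f _)) -mulrA.
  by apply: itgZ; exact: itg_cas.
have Fx x y : F (x, y) = f x * (k y * cas (dotp y x)).
  by rewrite /F/= dotpC mulrA.
rewrite Rintegral_prod1//.
  apply: eq_Rintegral => x _; rewrite -RintegralZl//; last exact: itg_cas.
  by apply: eq_Rintegral => y _; rewrite Fx.
move=> x; under [X in itg _ X]eq_fun do rewrite Fx.
by apply: itgZ; exact: itg_cas.
Qed.

Lemma itg_cas_gaussN t (x : E) : 0 < t -> itg mu (fun y => cas (dotp y x) * gaussN t y).
Proof.
move=> t0; apply: (itg_bounded_gaussN t0) => [|y]; first exact: measurable_cas_dotp.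
exact: cas_le2.
Qed.

(** By [casM] the product of two waves is the cosine of a difference, whose
    Gaussian integral is the heat kernel, and an odd function. *)
Lemma hartley_cas_gaussN t (x y : E) : 0 < t ->
  hartley (fun z => cas (dotp z x) * gaussN t z) y = (2 * pi) ^+ N * heat_kernel t x y.
Proof.
move=> t0; rewrite /hartley.
transitivity (\int[mu]_z (cos (dotp z (x - y)) * gaussN t z + sin (dotp z (x + y)) * gaussN t z)).
  apply: eq_Rintegral => z _.
  rewrite mulrAC casM -mulrDl !(dotpC z) dotpBl dotpDl.
  by rewrite !(dotpC _ z).
rewrite RintegralD//; [|exact: itg_cos_gaussN|exact: itg_sin_gaussN].
rewrite Rintegral_cos_gaussN// Rintegral_sin_gaussN// addr0 /heat_kernel /gaussN mulrA.
congr (_ * expR (- _)); last by rewrite mulrC.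
have s0 : 0 < Num.sqrt (4 * pi * t) by rewrite sqrtr_gt0 !mulr_gt0// pi_gt0.
rewrite -exprVn -exprMn; congr (_ ^+ _).
apply: (mulIf (lt0r_neq0 s0)); rewrite mulfVK ?gt_eqF//.
have -> : 2 * pi = Num.sqrt ((2 * pi) ^+ 2) :> R.
  by rewrite sqrtr_sqr ger0_norm// mulr_ge0// pi_ge0.
rewrite -sqrtrM; last by rewrite divr_ge0 ?pi_ge0// ltW.
by congr Num.sqrt; field; rewrite gt_eqF.
Qed.

Lemma itg_gaussN_hartley t f : 0 < t -> itg mu f -> itg mu (fun y => hartley f y * gaussN t y).
Proof. by move=> t0 fi; apply: itg_hartleyM => //; exact: itg_gaussN. Qed.

Lemma itg_heat_kernelM t g (x : E) : 0 < t -> itg mu g -> itg mu (fun y => g y * heat_kernel t x y).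
Proof.
move=> t0 gi.
have C0 : 0 <= (Num.sqrt (4 * pi * t)) ^- N :> R by rewrite invr_ge0 exprn_ge0// sqrtr_ge0.
apply: (itg_le _ (itgZ ((Num.sqrt (4 * pi * t)) ^- N) (itg_norm gi))).
  by apply: measurable_funM; [exact: (itg_meas gi)|exact: measurable_heat_kernel2].
move=> y; rewrite normrM mulrC ler_wpM2r// ger0_norm ?heat_kernel_ge0// /heat_kernel ler_piMr//.
by rewrite /gaussN -expR0 ler_expR oppr_le0 mulr_ge0 ?dotp_ge0// invr_ge0 mulr_ge0// ltW.
Qed.

(** Two uses of the symmetry of the transform bring the Gaussian weight to the
    transform of a Gaussian wave, which is the heat kernel. *)
Lemma gaussian_parseval_L1 t f g : 0 < t -> itg mu f -> itg mu g -> sqint mu f -> sqint mu g ->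
  \int[mu]_y (hartley f y * (hartley g y * gaussN t y)) = (2 * pi) ^+ N * heat_pairing t f g.
Proof.
move=> t0 fi gi f2 g2.
rewrite hartley_sym//; last exact: itg_gaussN_hartley.
have E1 x : hartley (fun y => hartley g y * gaussN t y) x = (2 * pi) ^+ N * \int[mu]_y (g y *
  heat_kernel t x y).
  rewrite {1}/hartley.
  transitivity (\int[mu]_y (hartley g y * (cas (dotp y x) * gaussN t y))).
    by apply: eq_Rintegral => y _; rewrite -mulrA (mulrC (gaussN _ _)).
  rewrite hartley_sym//; last exact: itg_cas_gaussN.
  rewrite -RintegralZl//; last exact: itg_heat_kernelM.
  by apply: eq_Rintegral => y _; rewrite hartley_cas_gaussN//; ring.
under eq_Rintegral do rewrite E1 mulrCA.
have E2 x : f x * \int[mu]_y (g y * heat_kernel t x y) = \int[mu]_y (f x * g y * heat_kernel t x y).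
  rewrite -RintegralZl//; last exact: itg_heat_kernelM.
  by apply: eq_Rintegral => y _; rewrite mulrA.
under eq_Rintegral do rewrite E2.
have ix x : itg mu (fun y => f x * g y * heat_kernel t x y).
  by under [X in itg _ X]eq_fun do rewrite -mulrA; apply: itgZ; exact: itg_heat_kernelM.
have hi := itg_heat_pairing t0 f2 g2.
rewrite RintegralZl//; last first.
  have := integrable_fubini_F hi; apply: eq_integrable => // x _ /=.
  by rewrite /fubini_F /Rintegral fineK//; apply: integrable_fin_num => //; exact: ix.
by rewrite /heat_pairing Rintegral_prod1.
Qed.

Lemma hartleyD f g : itg mu f -> itg mu g ->
  hartley (fun x => f x + g x) = (fun y => hartley f y + hartley g y).
Proof.
move=> fi gi; apply/funext => y; rewrite /hartley -RintegralD//; [|exact: itg_cas..].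
by apply: eq_Rintegral => x _; rewrite mulrDl.
Qed.

Lemma hartleyB f g : itg mu f -> itg mu g ->
  hartley (fun x => f x - g x) = (fun y => hartley f y - hartley g y).
Proof.
move=> fi gi; apply/funext => y; rewrite /hartley -RintegralB//; [|exact: itg_cas..].
by apply: eq_Rintegral => x _; rewrite mulrBl.
Qed.

Lemma gaussN_le1 t (y : E) : 0 <= t -> gaussN t y <= 1.
Proof. by move=> t0; rewrite /gaussN -expR0 ler_expR oppr_le0 mulr_ge0// dotp_ge0. Qed.

Lemma gaussN_invS_cvg (y : E) : gaussN (invS n) y @[n --> \oo] --> (1 : R).
Proof.
rewrite -expR0 -[X in expR X]oppr0; apply: (@continuous_cvg _ _ _ _ _ _ (@expR R)).
  exact: continuous_expR.
by apply: cvgN; rewrite -[X in _ --> X](mul0r (dotp y y)); apply: cvgMr_tmp; exact: cvg_invS.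
Qed.

(** The Gaussian weight in [gaussian_parseval_L1] is removed by monotone
    convergence on the side of frequencies, and by the continuity of the heat
    flow at time zero on the other side. *)
Lemma plancherel_L1 f : itg mu f -> sqint mu f ->
  sqint mu (hartley f) /\ inner mu (hartley f) (hartley f) = (2 * pi) ^+ N * inner mu f f.
Proof.
move=> fi f2; have mf := itg_meas fi; have mh := measurable_hartley mf.
pose g n y : \bar R := (hartley f y ^+ 2 * gaussN (invS n) y)%:E.
have mg n : measurable_fun setT (g n).
  apply/measurable_EFinP; apply: measurable_funM; last exact: measurable_gaussN.
  exact: measurable_funX.
have g0 n y : (0 <= g n y)%E by rewrite lee_fin mulr_ge0 ?sqr_ge0 ?gaussN_ge0.
have gE n : (\int[mu]_y g n y = ((2 * pi) ^+ N * heat_pairing (invS n) f f)%:E)%E.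
  rewrite -gaussian_parseval_L1 ?invS_gt0// /Rintegral fineK.
    by apply: eq_integral => y _; rewrite /g expr2 mulrA.
  apply: integrable_fin_num => //; apply: itg_hartleyM => //.
  by apply: itg_gaussN_hartley => //; exact: invS_gt0.
have glim y : limn (g ^~ y) = (hartley f y ^+ 2)%:E.
  apply/cvg_lim => //; apply: cvg_EFin; first exact: nearW.
  rewrite -[X in _ --> X]mulr1; apply: cvgMl_tmp; exact: gaussN_invS_cvg.
have key : (\int[mu]_y (hartley f y ^+ 2)%:E = ((2 * pi) ^+ N * inner mu f f)%:E)%E.
  have := @cvg_monotone_convergence _ _ _ mu setT measurableT g mg (fun n y _ => g0 n y).
  move=> /(_ _)/cvg_lim; under [X in _ -> _ -> _ = X]eq_integral do rewrite glim.
  move=> <- //; last first.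
    move=> y _ m n mn; rewrite /g lee_fin ler_wpM2l ?sqr_ge0// /gaussN ler_expR lerN2.
    by rewrite ler_wpM2r ?dotp_ge0// /invS lef_pV2 ?posrE// ler_nat ltnS.
  apply/cvg_lim => //; under eq_fun do rewrite gE.
  apply: cvg_EFin; first exact: nearW.
  apply: cvgMl_tmp.
  have -> : (fun n => heat_pairing (invS n) f f) = (fun n => inner mu f f - heat_form (invS n) f f).
    by apply/funext => n; rewrite /heat_form opprB addrC subrK.
  by rewrite -[X in _ --> X]subr0; apply: cvgB; [exact: cvg_cst|exact: heat_form_invS_cvg0].
have h2 : sqint mu (hartley f).
  apply/sqintP; split => //; apply: itg_ge0 => //; first exact: measurable_funX.
    by move=> y; rewrite sqr_ge0.
  by rewrite key ltry.
by split => //; apply: EFin_inj; rewrite -key integral_sqr.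
Qed.

Lemma parseval_L1 f g : itg mu f -> sqint mu f -> itg mu g -> sqint mu g ->
  inner mu (hartley f) (hartley g) = (2 * pi) ^+ N * inner mu f g.
Proof.
move=> fi f2 gi g2.
have [hf Ef] := plancherel_L1 fi f2; have [hg Eg] := plancherel_L1 gi g2.
have [_] := plancherel_L1 (itgD fi gi) (sqintD f2 g2).
rewrite hartleyD// !inner_sqrD// Ef Eg => e.
have alg (c a b v x : R) : c * a + 2 * x + c * b = c * (a + 2 * v + b) -> x = c * v.
  by clear; lra.
exact: alg e.
Qed.

Lemma itg_trunc n f : sqint mu f -> itg mu (trunc n f).
Proof. by move=> fi; apply: itgM => //; apply: sqint_indic;
  [exact: measurable_eball|exact: lebesgueN_eball_lty]. Qed.

(** The graph of the L2 extension of the transform, with the truncations that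
    define the Fourier transform. A relation between representatives avoids a
    choice of values on null sets. *)
Definition is_hartley f h := [/\ sqint mu f, sqint mu h & l2cvg mu (fun n => hartley (trunc n
  f)) h].

Lemma sqint_hartley_trunc n f : sqint mu f -> sqint mu (hartley (trunc n f)).
Proof. by move=> fi; have [] := plancherel_L1 (itg_trunc n fi) (sqint_trunc n fi). Qed.

Lemma is_hartley_parseval f h g k : is_hartley f h -> is_hartley g k ->
  inner mu h k = (2 * pi) ^+ N * inner mu f g.
Proof.
move=> [f2 h2 fh] [g2 k2 gk].
have := inner_cvg (fun n => sqint_hartley_trunc n f2) h2 (fun n => sqint_hartley_trunc n g2) k2
  fh gk.
have : (2 * pi) ^+ N * inner mu (trunc n f) (trunc n g) @[n --> \oo] --> (2 * pi) ^+ N * inner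
  mu f g.
  apply: cvgMl_tmp; apply: inner_cvg => //; try (by move=> n; exact: sqint_trunc);
    exact: trunc_l2cvg.
have E n : inner mu (hartley (trunc n f)) (hartley (trunc n g)) = (2 * pi) ^+ N * inner mu
  (trunc n f) (trunc n g).
  by apply: parseval_L1; [exact: itg_trunc|exact: sqint_trunc|exact: itg_trunc|exact: sqint_trunc].
by rewrite (funext E) => c1 c2; exact: (cvg_unique _ c2 c1).
Qed.

(** By Plancherel the transforms of the truncations form a Cauchy sequence. *)
Lemma is_hartley_exists f : sqint mu f -> exists h, is_hartley f h.
Proof.
move=> f2.
have [n|e e0|h [h2 fh]] := @L2_complete _ _ _ mu (fun n => hartley (trunc n f)); last by exists h.
  exact: sqint_hartley_trunc.
pose c : R := (2 * pi) ^+ N.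
have c0 : 0 < c by rewrite exprn_gt0// mulr_gt0// pi_gt0.
have e4 : 0 < e / (4 * c) by rewrite divr_gt0// mulr_gt0.
have [n0 _ /= n0P] := (cvgrPdist_le _ _).1 (trunc_l2cvg f2) _ e4.
exists n0 => m n m0 nn0.
have ti j := itg_trunc j f2; have t2 j := sqint_trunc j f2.
rewrite -hartleyB//.
have [_ ->] := plancherel_L1 (itgB (ti m) (ti n)) (sqintB (t2 m) (t2 n)).
have -> : (fun x => trunc m f x - trunc n f x) =
    (fun x => (trunc m f x - f x) + (-1) * (trunc n f x - f x)).
  by apply/funext => x; ring.
have bi j : sqint mu (fun x => trunc j f x - f x) by exact: sqintB.
have := inner_sqrD_le (bi m) (sqintZ (-1) (bi n)).
rewrite innerZl// ?innerZr//; last exact: sqintZ.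
have := n0P m m0; have := n0P n nn0.
rewrite !sub0r !normrN !ger0_norm ?inner_ge0// -/c !ler_pdivlMr ?mulr_gt0//.
set a := inner mu _ _; set b := inner mu _ _; set d := inner mu _ _ => h1 h2 h3.
apply: (@le_trans _ _ (c * (2 * (b + -1 * (-1 * a))))); first by rewrite ler_wpM2l// ltW.
lra.
Qed.

(** The transform is an involution up to a constant, because it is symmetric
    and multiplies inner products by that constant. *)
Lemma is_hartley_inv f h : is_hartley f h -> is_hartley h (fun x => (2 * pi) ^+ N * f x).
Proof.
move=> fh; have [f2 h2 fhc] := fh; have [k hkT] := is_hartley_exists h2; have [_ k2 hkc] := hkT.
have c2 : sqint mu (fun x => (2 * pi) ^+ N * f x) by exact: sqintZ.
pose r x := k x - (2 * pi) ^+ N * f x.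
have r2 : sqint mu r by exact: sqintB.
(* Against a truncation of [r], both the second transform of [f] and the
   multiple of [f] have the inner product that [f] has with a double transform. *)
have orth m : inner mu r (trunc m r) = 0.
  have gi := itg_trunc m r2; have g2 := sqint_trunc m r2.
  have [l gl] := is_hartley_exists g2; have [_ l2 glc] := gl.
  have E1 : inner mu h l = (2 * pi) ^+ N * inner mu f (trunc m r) by exact: is_hartley_parseval.
  have hal : {ae mu, forall x, l x = hartley (trunc m r) x}.
    have : l2cvg mu (fun n => hartley (trunc n (trunc m r))) (hartley (trunc m r)).
      have [hg _] := plancherel_L1 gi g2.
      apply/cvgrPdist_le => e e0; exists m => // n /= mn.
      have -> : trunc n (trunc m r) = trunc m r.
        apply/funext => x; rewrite /trunc indicE.
        have [|_] := boolP (x \in eball 0 m%:R); last by rewrite mulr0 mul0r.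
        rewrite inE /eball/= => xm; rewrite indicE mem_set ?mulr1//=.
        by apply: (lt_le_trans xm); rewrite ler_nat.
      by rewrite /inner; under eq_Rintegral do rewrite subrr mulr0;
        rewrite /Rintegral integral0 subr0 normr0 ltW.
    have [hg _] := plancherel_L1 gi g2.
    exact: (l2cvg_uniq (fun n => sqint_hartley_trunc n g2) l2 hg glc).
  have [hg _] := plancherel_L1 gi g2.
  have E2 : inner mu k (trunc m r) = inner mu h (hartley (trunc m r)).
    have gcst : forall n : nat, sqint mu (trunc m r) by [].
    have c1 := inner_cvg (fun n => sqint_hartley_trunc n h2) k2 gcst g2 hkc (@l2cvg_cst _ _ _ mu
      (trunc m r)).
    have hcst : forall n : nat, sqint mu (hartley (trunc m r)) by [].
    have c3 := inner_cvg (fun n => sqint_trunc n h2) h2 hcst hg (trunc_l2cvg h2) (@l2cvg_cst _ _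
      _ mu (hartley (trunc m r))).
    have E n : inner mu (hartley (trunc n h)) (trunc m r) = inner mu (trunc n h) (hartley (trunc
      m r)).
      by apply: hartley_sym => //; exact: itg_trunc.
    by rewrite (funext E) in c1; exact: (cvg_unique _ c1 c3).
  rewrite /r innerBl// innerZl// -/r -E1 E2.
  rewrite (innerC _ h l) (eq_ae_inner l2 hg (sqint_meas h2) hal) innerC.
  by rewrite subrr.
have r0 : inner mu r r = 0.
  have rcst : forall n : nat, sqint mu r by [].
  have c1 := inner_cvg rcst r2 (fun n => sqint_trunc n r2) r2 (@l2cvg_cst _ _ _ mu r)
    (trunc_l2cvg r2).
  by rewrite (funext orth) in c1; exact: (cvg_unique _ c1 (cvg_cst _)).
have kc : {ae mu, forall x, r x = 0} by exact: inner_eq0.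
split => //.
have hki := fun n => sqint_hartley_trunc n h2.
have : l2cvg mu (fun n x => hartley (trunc n h) x - 0) (fun x => k x - r x).
  apply: l2cvgB => //; first by move=> n; exact: sqint0.
  rewrite /l2cvg (_ : (fun n => _) = fun=> 0); first exact: cvg_cst.
  by apply/funext => n; rewrite -[RHS]r0; apply: eq_Rintegral => x _; rewrite sub0r mulrNN.
rewrite (_ : (fun x => k x - r x) = (fun x => (2 * pi) ^+ N * f x)); last first.
  by apply/funext => x; rewrite /r opprB addrC subrK.
by under [X in l2cvg _ X _ -> _]eq_fun do under eq_fun do rewrite subr0.
Qed.

Lemma sqint_gaussN t h : 0 <= t -> sqint mu h -> sqint mu (fun y => h y * gaussN t y).
Proof.
move=> t0 h2; apply: (sqint_le _ h2).
  by apply: measurable_funM; [exact: (sqint_meas h2)|exact: measurable_gaussN].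
by move=> y; rewrite normrM (ger0_norm (gaussN_ge0 _ _)) ler_piMr// gaussN_le1.
Qed.

Lemma gaussian_parseval t f h g k : 0 < t -> is_hartley f h -> is_hartley g k ->
  inner mu h (fun y => k y * gaussN t y) = (2 * pi) ^+ N * heat_pairing t f g.
Proof.
move=> t0 [f2 h2 fh] [g2 k2 gk].
have t0' := ltW t0.
pose G n y := hartley (trunc n g) y * gaussN t y.
have G2 n : sqint mu (G n) by apply: sqint_gaussN => //; exact: sqint_hartley_trunc.
have kG2 : sqint mu (fun y => k y * gaussN t y) by exact: sqint_gaussN.
have Gk : l2cvg mu G (fun y => k y * gaussN t y).
  apply: (@squeeze_cvgr _ _ _ _ (fun=> 0) (fun n => inner mu (fun x => hartley (trunc n g) x - k
    x) (fun x => hartley (trunc n g) x - k x))) => //.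
    apply: nearW => n; rewrite inner_ge0/=.
    have b2 : sqint mu (fun x => hartley (trunc n g) x - k x) by apply: sqintB => //;
      exact: sqint_hartley_trunc.
    apply: le_Rintegral => //.
    - by apply: itgM; exact: sqintB.
    - exact: itgM.
    - move=> y _; rewrite /G -mulrBl mulrACA ler_piMr// -?expr2 ?sqr_ge0//.
      by rewrite exprn_ile1// ?gaussN_ge0 ?gaussN_le1.
  exact: cvg_cst.
have c1 := inner_cvg (fun n => sqint_hartley_trunc n f2) h2 G2 kG2 fh Gk.
have Etr n : inner mu (hartley (trunc n f)) (G n) = (2 * pi) ^+ N * heat_pairing t (trunc n f)
  (trunc n g).
  by rewrite -gaussian_parseval_L1//;
    [exact: itg_trunc|exact: itg_trunc|exact: sqint_trunc|exact: sqint_trunc].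
rewrite (funext Etr) in c1.
have hE (u v : E -> R) : heat_pairing t u v = inner mu u v - heat_form t u v by rewrite
  /heat_form opprB addrC subrK.
have tf n := sqint_trunc n f2; have tg n := sqint_trunc n g2.
have c3 : (2 * pi) ^+ N * (inner mu (trunc n f) (trunc n g) - heat_form t (trunc n f) (trunc n
  g)) @[n --> \oo]
    --> (2 * pi) ^+ N * (inner mu f g - heat_form t f g).
  apply: cvgMl_tmp; apply: cvgB; first by apply: inner_cvg => //; exact: trunc_l2cvg.
  by apply: heat_form_cvg => //; exact: trunc_l2cvg.
have hE' n : (2 * pi) ^+ N * heat_pairing t (trunc n f) (trunc n g) =
    (2 * pi) ^+ N * (inner mu (trunc n f) (trunc n g) - heat_form t (trunc n f) (trunc n g)).
  by rewrite hE.
by rewrite hE; rewrite (funext hE') in c1; exact: (cvg_unique _ c1 c3).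
Qed.

(** The heat flow multiplies the transform by a Gaussian. *)
Lemma is_hartley_heat_form t f h g k : 0 < t -> is_hartley f h -> is_hartley g k ->
  \int[mu]_y (h y * k y * (1 - gaussN t y)) = (2 * pi) ^+ N * heat_form t f g.
Proof.
move=> t0 fh gk; have [f2 h2 _] := fh; have [g2 k2 _] := gk.
rewrite /heat_form mulrBr -(is_hartley_parseval fh gk) -(gaussian_parseval t0 fh gk).
rewrite -innerBr//; last by apply: sqint_gaussN => //; exact: ltW.
by apply: eq_Rintegral => y _; ring.
Qed.

End hartley.

(** * Subordination of the fractional powers *)
Section subordination.
Context {R : realType}.
Notation leb := (@lebesgue_measure R).
Implicit Types (s c t l : R).

Lemma itg_oppr (f : R -> R) : itg leb f -> itg leb (fun t => f (- t)).
Proof.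
move=> fi; have mf := itg_meas fi.
have mfN : measurable_fun setT (fun t => f (- t)).
  by apply: measurableT_comp => //; exact: measurable_oppr.
apply/itgP; first exact: mfN.
rewrite (ge0_integral_oppr (f := fun t => `|f t|%:E))//.
- by apply/itgP.
- by apply/measurable_EFinP; exact: measurableT_comp.
Qed.

Lemma itg_expR_abs c : 0 < c -> itg leb (fun t => expR (- (c * `|t|))).
Proof.
move=> c0; pose g t := c^-1 * (exponential_pdf c t + exponential_pdf c (- t)).
have gi : itg leb g.
  apply: itgZ; apply: itgD; last apply: itg_oppr; exact: integrable_exponential_pdf.
have mabs : measurable_fun setT (fun t : R => expR (- (c * `|t|))).
  apply: measurableT_comp => //; apply: measurable_funN.
  by apply: measurable_funM => //; exact: measurable_cst.
apply: (itg_le _ gi); first exact: mabs.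
move=> t; rewrite ger0_norm ?expR_ge0// /g.
have p0 x : 0 <= exponential_pdf c x by apply: exponential_pdf_ge0; exact: ltW.
rewrite ler_pdivlMl//.
have [t0|t0] := leP 0 t.
  rewrite ger0_norm// -[leLHS]addr0; apply: lerD => //.
  by rewrite /exponential_pdf patchE mem_set ?mulNr//= in_itv/= t0.
rewrite ltr0_norm// -[leLHS]add0r; apply: lerD => //.
by rewrite /exponential_pdf patchE mem_set ?mulNr//= in_itv/= oppr_ge0 (ltW t0).
Qed.

(** The heat exchanged between separated functions is [O(min t 1)]; this is the
    corresponding density in the logarithmic time. *)
Definition subord_majorant s t : R := expR (- (s * t)) * Num.min (expR t) 1.

Lemma subord_majorant_ge0 s t : 0 <= subord_majorant s t.
Proof. by rewrite /subord_majorant mulr_ge0 ?expR_ge0// le_min expR_ge0 ler01. Qed.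

Lemma measurable_expRN s : measurable_fun setT (fun t : R => expR (- (s * t))).
Proof.
apply: measurableT_comp => //; apply: measurable_funN.
by apply: measurable_funM => //; exact: measurable_cst.
Qed.

(** The bounds [0 < s] and [s < 1] give exponential decay towards large and
    towards small times. *)
Lemma itg_subord_majorant s : 0 < s -> s < 1 -> itg leb (subord_majorant s).
Proof.
move=> s0 s1; pose c := Num.min s (1 - s).
have c0 : 0 < c by rewrite lt_min s0 subr_gt0.
have [cs c1s] : c <= s /\ c <= 1 - s by rewrite !ge_min lexx lexx orbT.
apply: (itg_le _ (itg_expR_abs c0)).
  apply: measurable_funM; first exact: measurable_expRN.
  by apply: measurable_minr => //; exact: measurable_cst.
move=> t; rewrite ger0_norm ?subord_majorant_ge0// /subord_majorant.
have [t0|t0] := leP 0 t.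
  rewrite ger0_norm//; apply: (@le_trans _ _ (expR (- (s * t)))).
    by rewrite ler_piMr ?expR_ge0// ge_min lexx orbT.
  by rewrite ler_expR lerN2 ler_wpM2r.
rewrite ltr0_norm//; apply: (@le_trans _ _ (expR (- (s * t)) * expR t)).
  by rewrite ler_wpM2l ?expR_ge0// ge_min lexx.
rewrite -expRD ler_expR; have := ler_wnM2r (ltW t0 : t <= 0) c1s.
by rewrite mulrBl mul1r mulrN opprK; lra.
Qed.

(** The density of [t^(-1-s) (1 - exp (- l t)) dt] after the change of variable
    from [t] to [expR t]: in the logarithmic time the scaling by [l] is a
    translation. *)
Definition subord_density s l t : R := expR (- (s * t)) * (1 - expR (- (l * expR t))).

Lemma subord_density_ge0 s l t : 0 <= l -> 0 <= subord_density s l t.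
Proof.
move=> l0; rewrite /subord_density mulr_ge0 ?expR_ge0// subr_ge0 -expR0 ler_expR oppr_le0.
by rewrite mulr_ge0// expR_ge0.
Qed.

Lemma subord_density_le s t : subord_density s 1 t <= subord_majorant s t.
Proof.
rewrite /subord_density /subord_majorant ler_wpM2l ?expR_ge0// le_min mul1r; apply/andP; split.
  by have := expR_ge1Dx (- expR t); lra.
by rewrite lerBlDr lerDl expR_ge0.
Qed.

Lemma measurable_subord_density s l : measurable_fun setT (subord_density s l).
Proof.
apply: measurable_funM; first exact: measurable_expRN.
apply: measurable_funB => //; apply: measurableT_comp => //; apply: measurable_funN.
by apply: measurable_funM => //; exact: measurable_cst.
Qed.

Lemma continuous_subord_density s l : continuous (subord_density s l).
Proof.
move=> t; apply: cvgM.
  apply: (@continuous_comp _ _ _ (fun t => - (s * t)) expR); last exact: continuous_expR.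
  by apply: cvgN; apply: cvgMl_tmp; exact: cvg_id.
apply: cvgB; first exact: cvg_cst.
apply: (@continuous_comp _ _ _ (fun t => - (l * expR t)) expR); last exact: continuous_expR.
by apply: cvgN; apply: cvgMl_tmp; exact: continuous_expR.
Qed.

Definition subord_const s : R := \int[leb]_t subord_density s 1 t.

Lemma itg_subord_density1 s : 0 < s -> s < 1 -> itg leb (subord_density s 1).
Proof.
move=> s0 s1; apply: (itg_le _ (itg_subord_majorant s0 s1)); first exact: measurable_subord_density.
move=> t.
by rewrite ger0_norm ?subord_density_ge0 ?subord_density_le.
Qed.

Lemma subord_const_gt0 s : 0 < s -> s < 1 -> 0 < subord_const s.
Proof.
move=> s0 s1; have wi := itg_subord_density1 s0 s1.
have c0 : 0 <= subord_const s by apply: Rintegral_ge0 => t _; exact: subord_density_ge0.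
rewrite lt_neqAle c0 andbT; apply/eqP => c00.
have h : (\int[leb]_t `|(subord_density s 1 t)%:E| = 0)%E.
  transitivity ((subord_const s)%:E); last by rewrite -c00.
  rewrite /subord_const /Rintegral fineK; last by apply: integrable_fin_num.
  by apply: eq_integral => t _; rewrite gee0_abs// lee_fin subord_density_ge0.
move/ae_eq_integral_abs : h => /(_ measurableT)[].
  by apply/measurable_EFinP; exact: measurable_subord_density.
move=> A [mA A0 sA].
have : (leb `[0%R, 1%R]%classic <= leb A)%E.
  apply: le_measure; rewrite ?inE// => t _; apply: sA => /= /(_ I)/eqP.
  rewrite eqe /subord_density mulf_eq0 gt_eqF ?expR_gt0//= subr_eq0 => /eqP h.
  have : expR (- (1 * expR t)) < 1 by rewrite mul1r -expR0 ltr_expR oppr_lt0 expR_gt0.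
  by rewrite -h ltxx.
by rewrite A0 lebesgue_measure_itv/= lte_fin ltr01 oppr0 adde0 lee_fin ler10.
Qed.

Lemma ge0_integral_shift (f : R -> R) c : continuous f -> (forall x, 0 <= f x) ->
  (\int[leb]_t (f (t + c))%:E = \int[leb]_t (f t)%:E)%E.
Proof.
move=> cf f0; pose F t : R := t + c.
have dF t : is_derive t 1 F 1.
  by rewrite -[X in is_derive _ _ _ X]addr0; apply: is_deriveD.
have F' : derive1 F = fun=> 1 by apply/funext => t; rewrite derive1E; exact: derive_val.
rewrite (@increasing_ge0_integration_by_substitutionT _ F f)//.
- by apply: eq_integral => t _; rewrite F' /= /F; congr EFin; rewrite -[LHS]mulr1.
- by move=> x y xy; rewrite /F ltrD2r.
- by rewrite F'; exact: cst_continuous.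
- by rewrite F'; exact: is_cvg_cst.
- by rewrite F'; exact: is_cvg_cst.
- exact: cvg_addrr_Ny.
- exact: cvg_addrr.
Qed.

(** Fractional powers are superpositions of the multipliers of the identity
    minus the heat flow: the translation of [t] by [ln l] reduces the integral
    to its value at [l = 1]. *)
Lemma subordination s l : 0 < s -> s < 1 -> 0 <= l ->
  (\int[leb]_t (subord_density s l t)%:E = (subord_const s * l `^ s)%:E)%E.
Proof.
move=> s0 s1; rewrite le_eqVlt => /predU1P[<-|l0].
  rewrite powR0 ?gt_eqF// mulr0 -[RHS](@integral0 _ _ _ leb setT).
  by apply: eq_integral => t _; rewrite /subord_density mul0r oppr0 expR0 subrr mulr0.
have E t : subord_density s l t = l `^ s * subord_density s 1 (t + ln l).
  rewrite /subord_density /powR gt_eqF// mulrA -expRD mul1r [expR (t + _)]expRD lnK ?posrE//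
    (mulrC l).
  by congr (expR _ * _); ring.
under eq_integral do rewrite E EFinM.
have mw : measurable_fun setT (fun t => (subord_density s 1 (t + ln l))%:E).
  apply/measurable_EFinP; apply: continuous_measurable_fun => t.
  apply: (@continuous_comp _ _ _ (fun t => t + ln l) (subord_density s 1));
    last exact: continuous_subord_density.
  by apply: cvgD; [exact: cvg_id|exact: cvg_cst].
have w0 t : setT t -> (0 <= (subord_density s 1 (t + ln l))%:E)%E by rewrite lee_fin
  subord_density_ge0.
have lp : (0 <= (l `^ s)%:E)%E by rewrite lee_fin powR_ge0.
rewrite (@ge0_integralZl _ _ _ leb setT measurableT _ mw _ w0 lp).
rewrite ge0_integral_shift; [|exact: continuous_subord_density|by move=> t;
  exact: subord_density_ge0].
rewrite -[X in (_ * X)%E]fineK; first by rewrite mulrC EFinM.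
by apply: integrable_fin_num => //; exact: itg_subord_density1.
Qed.

End subordination.

(** * The space H^s and the fractional Laplacian *)
Section sobolev.
Context {R : realType} {N : nat}.
Notation E := 'rV[R]_N.
Notation mu := (@lebesgueN R N).
Notation leb := (@lebesgue_measure R).
Variable s : R.
Hypotheses (s0 : 0 < s) (s1 : s < 1).
Implicit Types (f g h k a b : E -> R) (t : R).

(** The integrand, in logarithmic time, of the form of the fractional
    Laplacian; see [fraclap_form]. *)
Definition weighted_form f g t : R := expR (- (s * t)) * heat_form (expR t) f g.

Lemma weighted_form_ge0 f t : sqint mu f -> 0 <= weighted_form f f t.
Proof. by move=> f2; rewrite /weighted_form mulr_ge0 ?expR_ge0 ?heat_form_ge0 ?expR_gt0. Qed.

Lemma measurable_multiplier h : measurable_fun setT h -> measurable_fun setT (multiplier s h).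
Proof.
move=> mh; apply: measurable_funM => //.
apply: (measurableT_comp (measurable_powR s)).
by have := @measurable_enorm R N _ _ (@id E) (@measurable_id _ _ _).
Qed.

Lemma powR_enorm (y : E) : dotp y y `^ s = (enorm y `^ s) ^+ 2.
Proof. by rewrite -enorm_sqr !expr2 powRM// enorm_ge0. Qed.

Lemma itg_mulN_gaussN t f g : 0 <= t -> sqint mu f -> sqint mu g ->
  itg mu (fun y => f y * g y * (1 - gaussN t y)).
Proof.
move=> t0 f2 g2.
have -> : (fun y : E => f y * g y * (1 - gaussN t y)) =
    (fun y => f y * g y - f y * (g y * gaussN t y)) by apply/funext => y; ring.
by apply: itgB; apply: itgM => //; exact: sqint_gaussN.
Qed.

Definition hartley_density h (z : E * measurableTypeR R) : R := h z.1 ^+ 2 * subord_density s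
  (dotp z.1 z.1) z.2.

Lemma measurable_hartley_density h : sqint mu h -> measurable_fun setT (EFin \o hartley_density h).
Proof.
move=> /sqint_meas mh; apply/measurable_EFinP; apply: measurable_funM.
  by apply: measurable_funX; exact: (measurableT_comp mh).
apply: measurable_funM.
  by apply: (measurableT_comp (measurable_expRN s)); exact: measurable_snd.
apply: measurable_funB => //; apply: measurableT_comp => //; apply: measurable_funN.
apply: measurable_funM; last by apply: measurableT_comp => //; exact: measurable_snd.
apply: measurable_dotp; exact: measurable_fst.
Qed.

Lemma hartley_density_ge0 h z : (0 <= (EFin \o hartley_density h) z)%E.
Proof. by rewrite lee_fin /hartley_density mulr_ge0 ?sqr_ge0 ?subord_density_ge0// dotp_ge0. Qed.

Lemma hartley_density_fst f h t : is_hartley f h ->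
  (\int[mu]_y (hartley_density h (y, t))%:E = ((2 * pi) ^+ N * weighted_form f f t)%:E)%E.
Proof.
move=> fh; have [f2 h2 _] := fh; have t0 := expR_gt0 t.
have i1 := itg_mulN_gaussN (ltW t0) h2 h2.
rewrite /weighted_form mulrCA -(is_hartley_heat_form t0 fh fh) -RintegralZl//.
rewrite /Rintegral fineK; last by apply: integrable_fin_num => //; exact: itgZ.
apply: eq_integral => y _; congr EFin; rewrite /hartley_density /subord_density /gaussN /=.
by rewrite (mulrC (dotp y y)); ring.
Qed.

Lemma measurable_weighted_form_diag f : sqint mu f -> measurable_fun setT (weighted_form f f).
Proof.
move=> f2; have [h fh] := is_hartley_exists f2; have [_ h2 _] := fh.
have m1 := measurable_fun_fubini_tonelli_G (m1 := mu) (EFin \o hartley_density h)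
  (measurable_hartley_density h2) (@hartley_density_ge0 h).
have m2 : measurable_fun setT (fun t : measurableTypeR R => (((2 * pi) ^+ N * weighted_form f f
  t)%:E : \bar R)).
  rewrite (_ : (fun t => _) = fubini_G mu (EFin \o hartley_density h))//.
  by apply/funext => t; rewrite /fubini_G/= (hartley_density_fst t fh).
have c0 : (2 * pi) ^+ N != 0 :> R by rewrite gt_eqF// exprn_gt0// mulr_gt0// pi_gt0.
have -> : weighted_form f f = (fun t => ((2 * pi) ^+ N)^-1 * ((2 * pi) ^+ N * weighted_form f f t)).
  by apply/funext => t; rewrite mulrA mulVf ?mul1r.
apply: measurable_funM; first exact: measurable_cst.
exact/measurable_EFinP.
Qed.

(** [subordination] at each frequency; Tonelli's theorem then exchanges the
    integrals over the frequencies and over the times. *)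
Lemma tonelli_weighted_form f h : is_hartley f h ->
  ((subord_const s)%:E * \int[mu]_y (multiplier s h y ^+ 2)%:E =
   ((2 * pi) ^+ N)%:E * \int[leb]_t (weighted_form f f t)%:E)%E.
Proof.
move=> fh; have [f2 h2 _] := fh; have mh := sqint_meas h2.
have c0 : (0 <= ((2 * pi) ^+ N)%:E :> \bar R)%E by rewrite lee_fin exprn_ge0// mulr_ge0// pi_ge0.
have mq : measurable_fun setT (fun t : measurableTypeR R => (weighted_form f f t)%:E).
  by apply/measurable_EFinP; exact: measurable_weighted_form_diag.
have q0 t : setT t -> (0 <= (weighted_form f f t)%:E)%E by rewrite lee_fin weighted_form_ge0.
rewrite -(@ge0_integralZl _ _ _ leb setT measurableT _ mq _ q0 c0).
have mm : measurable_fun setT (fun y : E => (multiplier s h y ^+ 2)%:E).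
  by apply/measurable_EFinP; apply: measurable_funX; exact: measurable_multiplier.
have m0 y : setT y -> (0 <= (multiplier s h y ^+ 2)%:E)%E by rewrite lee_fin sqr_ge0.
have cs0 : (0 <= (subord_const s)%:E)%E by rewrite lee_fin ltW// subord_const_gt0.
rewrite -(@ge0_integralZl _ _ _ mu setT measurableT _ mm _ m0 cs0).
have := fubini_tonelli (m1 := mu) (m2 := leb) (EFin \o hartley_density h)
  (measurable_hartley_density h2) (@hartley_density_ge0 h).
rewrite (_ : (\int[leb]_t _ = \int[leb]_t (((2 * pi) ^+ N)%:E * (weighted_form f f t)%:E))%E);
  last first.
  by apply: eq_integral => t _; exact: (hartley_density_fst t fh).
move=> <-; apply: eq_integral => y _.
have mw : measurable_fun setT (fun t : measurableTypeR R => (subord_density s (dotp y y) t)%:E).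
  by apply/measurable_EFinP; exact: measurable_subord_density.
have w0 t : setT t -> (0 <= (subord_density s (dotp y y) t)%:E)%E by rewrite lee_fin
  subord_density_ge0// dotp_ge0.
have hy0 : (0 <= (h y ^+ 2)%:E)%E by rewrite lee_fin sqr_ge0.
transitivity ((h y ^+ 2)%:E * (subord_const s * dotp y y `^ s)%:E)%E.
  by rewrite powR_enorm /multiplier -!EFinM; congr EFin; rewrite exprMn; ring.
rewrite -subordination// ?dotp_ge0//.
by rewrite -(@ge0_integralZl _ _ _ leb setT measurableT _ mw _ w0 hy0).
Qed.

Lemma is_hartleyD f g h k : is_hartley f h -> is_hartley g k ->
  is_hartley (fun x => f x + g x) (fun x => h x + k x).
Proof.
move=> [f2 h2 fh] [g2 k2 gk]; split; [exact: sqintD|exact: sqintD|].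
have : l2cvg mu (fun n x => hartley (trunc n f) x + hartley (trunc n g) x) (fun x => h x + k x).
  by apply: l2cvgD => // n; exact: sqint_hartley_trunc.
rewrite (_ : (fun n x => _) = (fun n => hartley (trunc n (fun x => f x + g x))))//.
apply/funext => n; rewrite (_ : trunc n (fun x => f x + g x) = fun x => trunc n f x + trunc n g x).
  by apply/funext => y; rewrite hartleyD//; exact: itg_trunc.
by apply/funext => x; rewrite /trunc mulrDl.
Qed.

Lemma is_hartleyZ c f h : is_hartley f h -> is_hartley (fun x => c * f x) (fun x => c * h x).
Proof.
move=> [f2 h2 fh]; split; [exact: sqintZ|exact: sqintZ|].
have : l2cvg mu (fun n x => c * hartley (trunc n f) x) (fun x => c * h x).
  by apply: l2cvgZ => // n; exact: sqint_hartley_trunc.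
rewrite (_ : (fun n x => _) = (fun n => hartley (trunc n (fun x => c * f x))))//.
apply/funext => n; apply/funext => y; rewrite /hartley -RintegralZl//.
  by apply: eq_Rintegral => x _; rewrite /trunc; ring.
by apply: itg_cas; exact: itg_trunc.
Qed.

Lemma sqint_rVN f : sqint mu f -> sqint mu (fun x => f (- x)).
Proof.
move=> /sqintP[mf fi]; apply/sqintP.
have mfN : measurable_fun setT (fun x : E => f (- x)) by exact: (measurableT_comp mf
  measurable_rVN).
split => //; apply: itg_ge0.
- exact: measurable_funX.
- by move=> x; rewrite sqr_ge0.
- have m2 : measurable_fun setT (fun x => (f x ^+ 2)%:E) by apply/measurable_EFinP;
  exact: measurable_funX.
  rewrite (ge0_integral_rVN m2)//; last by move=> x; rewrite lee_fin sqr_ge0.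
  have /integrableP[_] := fi; rewrite (eq_integral (fun x => (f x ^+ 2)%:E))// => x _.
  by rewrite gee0_abs// lee_fin sqr_ge0.
Qed.

Lemma inner_rVN f g : sqint mu f -> sqint mu g ->
  inner mu (fun x => f (- x)) (fun x => g (- x)) = inner mu f g.
Proof.
move=> /sqint_meas mf /sqint_meas mg.
by rewrite /inner (@Rintegral_rVN _ _ (fun x => f x * g x))//; exact: measurable_funM.
Qed.

(** The even part of the Hartley transform is the real part of the Fourier
    transform, and its odd part, with the sign below, is the imaginary part. *)
Definition evenp h (y : E) : R := 2^-1 * (h y + h (- y)).
Definition oddp h (y : E) : R := 2^-1 * (h (- y) - h y).

Lemma sqint_evenp h : sqint mu h -> sqint mu (evenp h).
Proof. by move=> h2; apply: sqintZ; apply: sqintD => //; exact: sqint_rVN. Qed.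

Lemma sqint_oddp h : sqint mu h -> sqint mu (oddp h).
Proof. by move=> h2; apply: sqintZ; apply: sqintB => //; exact: sqint_rVN. Qed.

Lemma multiplier_evenp h : multiplier s (evenp h) = evenp (multiplier s h).
Proof. by apply/funext => y; rewrite /multiplier /evenp enormN; ring. Qed.

Lemma multiplier_oddp h : multiplier s (oddp h) = oddp (multiplier s h).
Proof. by apply/funext => y; rewrite /multiplier /oddp enormN; ring. Qed.

Lemma Rintegral_restrict n f (F : E -> R) :
  \int[mu]_(x in eball 0 n%:R) (f x * F x) = \int[mu]_x (trunc n f x * F x).
Proof.
rewrite Rintegral_mkcond; apply: eq_Rintegral => x _.
rewrite patchE /trunc indicE; case: (x \in _); first by rewrite mulr1.
by rewrite mulr0 mul0r.
Qed.

Lemma fourier_reE n f : sqint mu f -> fourier_re f n = evenp (hartley (trunc n f)).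
Proof.
move=> f2; have fi := itg_trunc n f2; apply/funext => y.
rewrite /fourier_re Rintegral_restrict /evenp /hartley -RintegralD//;
  [|exact: itg_cas|exact: itg_cas].
rewrite -RintegralZl//; last by apply: itgD; exact: itg_cas.
apply: eq_Rintegral => x _; rewrite /cas [dotp x (- y)]dotpC dotpNl cosN sinN (dotpC y); lra.
Qed.

Lemma fourier_imE n f : sqint mu f -> fourier_im f n = oddp (hartley (trunc n f)).
Proof.
move=> f2; have fi := itg_trunc n f2; apply/funext => y.
rewrite /fourier_im; under eq_Rintegral do rewrite -mulrN.
rewrite Rintegral_restrict /oddp /hartley -RintegralB//; [|exact: itg_cas|exact: itg_cas].
rewrite -RintegralZl//; last by apply: itgB; exact: itg_cas.
apply: eq_Rintegral => x _; rewrite /cas [dotp x (- y)]dotpC dotpNl cosN sinN (dotpC y); lra.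
Qed.

Lemma l2cvg_rVN (F : nat -> E -> R) f : (forall n, sqint mu (F n)) -> sqint mu f -> l2cvg mu F f ->
  l2cvg mu (fun n x => F n (- x)) (fun x => f (- x)).
Proof.
move=> F2 f2; rewrite /l2cvg; apply: cvg_trans; apply: near_eq_cvg; apply: nearW => n.
by rewrite (inner_rVN (sqintB (F2 n) f2) (sqintB (F2 n) f2)).
Qed.

Lemma is_fourier_is_hartley f h : is_hartley f h -> is_fourier f (evenp h) (oddp h).
Proof.
move=> [f2 h2 fh].
have H2 n := sqint_hartley_trunc n f2.
have HN2 n : sqint mu (fun y => hartley (trunc n f) (- y)) by exact: sqint_rVN.
have hN2 := sqint_rVN h2.
have fhN := l2cvg_rVN H2 h2 fh.
split => //; [exact: sqint_evenp|exact: sqint_oddp| |].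
- rewrite /cvgL2 l2cvgP => [|n|]; [|by rewrite fourier_reE//;
  exact: sqint_evenp|exact: sqint_evenp].
  rewrite (_ : fourier_re f = fun n => evenp (hartley (trunc n f))); last by apply/funext => n;
    exact: fourier_reE.
  by apply: l2cvgZ; [move=> n; exact: sqintD|exact: sqintD|exact: l2cvgD].
- rewrite /cvgL2 l2cvgP => [|n|]; [|by rewrite fourier_imE//; exact: sqint_oddp|exact: sqint_oddp].
  rewrite (_ : fourier_im f = fun n => oddp (hartley (trunc n f))); last by apply/funext => n;
    exact: fourier_imE.
  by apply: l2cvgZ; [move=> n; exact: sqintB|exact: sqintB|exact: l2cvgB].
Qed.

Lemma is_hartley_is_fourier f a b : is_fourier f a b -> is_hartley f (fun y => a y - b y).
Proof.
move=> [f2 a2 b2 fa fb]; split => //; first exact: sqintB.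
have r2 n : sqint mu (fourier_re f n) by rewrite fourier_reE//; apply: sqint_evenp;
  exact: sqint_hartley_trunc.
have i2 n : sqint mu (fourier_im f n) by rewrite fourier_imE//; apply: sqint_oddp;
  exact: sqint_hartley_trunc.
move: fa fb; rewrite /cvgL2 !l2cvgP// => fa fb.
have := l2cvgB r2 a2 i2 b2 fa fb.
rewrite (_ : (fun n x => _) = fun n => hartley (trunc n f))//.
by apply/funext => n; apply/funext => y; rewrite fourier_reE// fourier_imE// /evenp /oddp; lra.
Qed.

(** Membership in [H^s] by means of the heat flow alone ([HsP]). In this form it
    can be checked for truncated functions, about whose Fourier transforms
    nothing is known. *)
Definition finite_energy f := sqint mu f /\ (\int[leb]_t (weighted_form f f t)%:E < +oo)%E.

Let cs0 : 0 < subord_const s. Proof. exact: subord_const_gt0. Qed.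
Let c0 : 0 < (2 * pi) ^+ N :> R. Proof. by rewrite exprn_gt0// mulr_gt0// pi_gt0. Qed.

Lemma lty_pmul (c : R) (x : \bar R) : 0 < c -> (0 <= x)%E -> (c%:E * x < +oo)%E = (x < +oo)%E.
Proof.
by move=> cp; case: x => [r||]//; rewrite ?gt0_muley ?lte_fin// -EFinM !ltry.
Qed.

Lemma sqint_multiplier f h : is_hartley f h ->
  (\int[leb]_t (weighted_form f f t)%:E < +oo)%E <-> sqint mu (multiplier s h).
Proof.
move=> fh; have [f2 h2 _] := fh; have key := tonelli_weighted_form fh.
have mm : measurable_fun setT (multiplier s h) by apply: measurable_multiplier;
  exact: sqint_meas h2.
have m0 : (0 <= \int[mu]_y (multiplier s h y ^+ 2)%:E)%E.
  by apply: integral_ge0 => y _; rewrite lee_fin sqr_ge0.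
have q0 : (0 <= \int[leb]_t (weighted_form f f t)%:E)%E.
  by apply: integral_ge0 => t _; rewrite lee_fin weighted_form_ge0.
rewrite -(lty_pmul c0 q0) -key (lty_pmul cs0 m0); split=> [fin|/sqintP[_ i2]].
  by apply/sqintP; split => //; apply: itg_ge0; [exact: measurable_funX|move=> y; rewrite sqr_ge0|].
by have := integrable_lty measurableT i2.
Qed.

(** In [tonelli_weighted_form] one side is finite exactly on [H^s], and the
    other only involves the heat flow. *)
Lemma HsP f : Hs s f <-> finite_energy f.
Proof.
split=> [[a [b [fab ma mb]]]|[f2 fin]].
  have fh := is_hartley_is_fourier fab; have [f2 h2 _] := fh; split => //.
  apply/(sqint_multiplier fh).
  rewrite (_ : multiplier s _ = fun y => multiplier s a y - multiplier s b y); first exact: sqintB.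
  by apply/funext => y; rewrite /multiplier mulrBr.
have [h fh] := is_hartley_exists f2; have [_ h2 _] := fh.
move/(sqint_multiplier fh) : fin => m2.
exists (evenp h), (oddp h); split; first exact: is_fourier_is_hartley.
- by rewrite multiplier_evenp; exact: sqint_evenp.
- by rewrite multiplier_oddp; exact: sqint_oddp.
Qed.

(** The inverse transform of the multiplied transform is a fractional
    Laplacian, hence so is the representative that [fraclap] chooses. *)
Lemma fraclapP f : Hs s f ->
  exists h, is_hartley f h /\ is_hartley (fraclap (s / 2) f) (multiplier s h).
Proof.
move=> [a [b [fab ma mb]]].
have s2 : 2 * (s / 2) = s by field.
have : is_fraclap (s / 2) f (fraclap (s / 2) f).
  rewrite /fraclap; apply: xgetPex.
  have fh := is_hartley_is_fourier fab; set h := fun y => _ in fh.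
  have m2 : sqint mu (multiplier s h).
    rewrite (_ : multiplier s _ = fun y => multiplier s a y - multiplier s b y);
      first exact: sqintB.
    by apply/funext => y; rewrite /multiplier mulrBr.
  have [k mk] := is_hartley_exists m2.
  have := is_hartleyZ ((2 * pi) ^+ N)^-1 (is_hartley_inv mk).
  rewrite (_ : (fun x => _ * (_ * multiplier s h x)) = multiplier s h); last first.
    by apply/funext => x; rewrite mulrA mulVf ?mul1r// gt_eqF.
  move=> gm; exists (fun x => ((2 * pi) ^+ N)^-1 * k x), (evenp h), (oddp h).
  by rewrite s2 multiplier_evenp multiplier_oddp; split; exact: is_fourier_is_hartley.
move=> [a' [b' [fab' gab]]]; exists (fun y => a' y - b' y).
split; first exact: is_hartley_is_fourier.
have := is_hartley_is_fourier gab; rewrite s2.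
rewrite (_ : (fun y => _ - _) = multiplier s (fun y => a' y - b' y))//.
by apply/funext => y; rewrite /multiplier mulrBr.
Qed.

End sobolev.

Section polarisation.
Context {R : realType} {N : nat}.
Notation E := 'rV[R]_N.
Notation mu := (@lebesgueN R N).
Notation leb := (@lebesgue_measure R).
Variable s : R.
Hypotheses (s0 : 0 < s) (s1 : s < 1).
Implicit Types (f g h k : E -> R) (t : R).
Notation weighted_form := (weighted_form s).
Notation fe := (finite_energy s).

Lemma weighted_formD f g t : sqint mu f -> sqint mu g ->
  weighted_form (fun x => f x + g x) (fun x => f x + g x) t = weighted_form f f t + 2 *
    weighted_form f g t + weighted_form g g t.
Proof. by move=> f2 g2; rewrite /weighted_form heat_form_sqrD ?expR_gt0//; ring. Qed.

Lemma finite_energyP f : fe f <-> sqint mu f /\ itg leb (weighted_form f f).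
Proof.
split=> [[f2 fin]|[f2 fi]]; split => //.
  apply: itg_ge0 => //; last by move=> t; exact: weighted_form_ge0.
  exact: measurable_weighted_form_diag.
have := integrable_lty measurableT fi.
by [].
Qed.

Lemma measurable_weighted_form f g : sqint mu f -> sqint mu g ->
  measurable_fun setT (weighted_form f g).
Proof.
move=> f2 g2; have fg2 := sqintD f2 g2.
have -> : weighted_form f g = fun t => 2^-1 * (weighted_form (fun x => f x + g x) (fun x => f x
  + g x) t - (weighted_form f f t + weighted_form g g t)).
  by apply/funext => t; rewrite weighted_formD//; lra.
apply: measurable_funM; first exact: measurable_cst.
apply: measurable_funB; first exact: measurable_weighted_form_diag.
by apply: measurable_funD; exact: measurable_weighted_form_diag.
Qed.

Lemma itg_weighted_form f g : fe f -> fe g -> itg leb (weighted_form f g).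
Proof.
move=> /finite_energyP[f2 fi] /finite_energyP[g2 gi].
apply: (itg_le _ (itgZ 2^-1 (itgD fi gi))); first exact: measurable_weighted_form.
move=> t; rewrite /weighted_form normrM (ger0_norm (expR_ge0 _)) -mulrDr mulrCA.
by rewrite ler_wpM2l ?expR_ge0// heat_form_AM ?expR_gt0.
Qed.

Lemma finite_energyD f g : fe f -> fe g -> fe (fun x => f x + g x).
Proof.
move=> ff gg; have /finite_energyP[f2 fi] := ff; have /finite_energyP[g2 gi] := gg;
  apply/finite_energyP; split; first exact: sqintD.
rewrite (_ : weighted_form _ _ = fun t => weighted_form f f t + 2 * weighted_form f g t +
  weighted_form g g t).
  by apply: itgD => //; apply: itgD => //; apply: itgZ; exact: itg_weighted_form.
by apply/funext => t; rewrite weighted_formD.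
Qed.

Lemma finite_energyZ c f : fe f -> fe (fun x => c * f x).
Proof.
move=> /finite_energyP[f2 fi]; apply/finite_energyP; split; first exact: sqintZ.
rewrite (_ : weighted_form _ _ = fun t => c * (c * weighted_form f f t)); first by do 2 apply: itgZ.
by apply/funext => t; rewrite /weighted_form heat_formZl ?heat_formZr ?expR_gt0//;
  [ring|exact: sqintZ].
Qed.

Lemma finite_energy0 : fe (fun _ : E => 0).
Proof.
apply/finite_energyP; split; first exact: sqint0.
rewrite (_ : weighted_form _ _ = fun=> 0); first exact: itg0.
apply/funext => t; rewrite /weighted_form;
  have := @heat_formZl _ _ (expR t) 0 (fun=> 0) (fun=> 0) (expR_gt0 t) (sqint0 mu) (sqint0 mu).
by rewrite !mul0r => ->; rewrite mulr0.
Qed.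

Lemma finite_energy_sum n (F : 'I_n -> E -> R) : (forall i, fe (F i)) ->
  fe (fun x => \sum_(i < n) F i x).
Proof.
elim: n F => [|n IH] F Fi; first by under eq_fun do rewrite big_ord0; exact: finite_energy0.
under eq_fun do rewrite big_ord_recr; apply: finite_energyD => //.
by apply: IH.
Qed.

(** [tonelli_weighted_form] and Parseval on the diagonal, then polarisation. *)
Lemma fraclap_form f g : Hs s f -> Hs s g ->
  \int[mu]_x (fraclap (s / 2) f x * fraclap (s / 2) g x) =
  (subord_const s)^-1 * \int[leb]_t weighted_form f g t.
Proof.
have cs0 : subord_const s != 0 by rewrite gt_eqF// subord_const_gt0.
have c0 : (2 * pi) ^+ N != 0 :> R by rewrite gt_eqF// exprn_gt0// mulr_gt0// pi_gt0.
have alg (c a b v x : R) : c * (a + 2 * v + b) = c * a + 2 * x + c * b -> c * v = x.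
  by clear; lra.
have diag u h U : is_hartley u h -> is_hartley U (multiplier s h) -> fe u ->
    subord_const s * inner mu U U = \int[leb]_t weighted_form u u t.
  move=> uh Uh /finite_energyP[u2 ui]; have [U2 m2 _] := Uh.
  have := tonelli_weighted_form s0 s1 uh; rewrite integral_sqr// (is_hartley_parseval Uh Uh).
  have -> : (\int[leb]_t (weighted_form u u t)%:E = (\int[leb]_t (weighted_form u u t))%:E)%E.
    by rewrite /Rintegral fineK//; exact: integrable_fin_num ui.
  by rewrite -!EFinM => -[/eqP]; rewrite mulrCA => /eqP/(mulfI c0).
move=> Hf Hg; have ff := (HsP s0 s1 f).1 Hf; have fg := (HsP s0 s1 g).1 Hg.
have /finite_energyP[f2 fi] := ff; have /finite_energyP[g2 gi] := fg.
have [h [fh Fh]] := fraclapP Hf; have [k [gk Gk]] := fraclapP Hg.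
have [F2' _ _] := Fh; have [G2' _ _] := Gk.
have df := diag _ _ _ fh Fh ff; have dg := diag _ _ _ gk Gk fg.
have FG := is_hartleyD Fh Gk.
rewrite (_ : (fun x => multiplier s h x + _) = multiplier s (fun y => h y + k y)) in FG; last first.
  by apply/funext => y; rewrite /multiplier mulrDr.
have := diag _ _ _ (is_hartleyD fh gk) FG (finite_energyD ff fg).
rewrite inner_sqrD//.
have -> : \int[leb]_t weighted_form (fun x => f x + g x) (fun x => f x + g x) t =
    \int[leb]_t weighted_form f f t + 2 * \int[leb]_t weighted_form f g t + \int[leb]_t
      weighted_form g g t.
  have fgi := itg_weighted_form ff fg.
  under eq_Rintegral do rewrite weighted_formD//.
  rewrite RintegralD//; last by apply: itgD => //; exact: itgZ.
  by rewrite RintegralD//; [rewrite RintegralZl|exact: itgZ].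
rewrite -df -dg -/(inner mu _ _) => e; apply: (mulfI cs0); rewrite mulrA divff// mul1r.
exact: alg e.
Qed.

End polarisation.

(** * Bounds for the exchange of heat *)
Section heat_bounds.
Context {R : realType} {N : nat}.
Notation E := 'rV[R]_N.
Notation mu := (@lebesgueN R N).
Notation mu2 := (mu \x mu)%E.
Implicit Types (f g h k : E -> R) (t : R).

(** The heat flow does not exceed the maximum of its initial value. *)
Lemma heat_pairing_le_cst t f g M : 0 < t -> sqint mu f -> sqint mu g -> itg mu g ->
  (forall x, f x <= M) -> (forall x, 0 <= g x) -> heat_pairing t f g <= M * \int[mu]_x g x.
Proof.
move=> t0 f2 g2 gi fM g0; have mg := itg_meas gi.
have mG : measurable_fun setT (fun z : E * E => g z.2 * heat_kernel t z.1 z.2).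
  by apply: measurable_funM; [exact: measurableT_comp|exact: measurable_heat_kernel].
have mGE : measurable_fun setT (fun z : E * E => (g z.2 * heat_kernel t z.1 z.2)%:E) by
  exact/measurable_EFinP.
have G0 (z : E * E) : (0 <= (g z.2 * heat_kernel t z.1 z.2)%:E)%E by rewrite lee_fin mulr_ge0//
  heat_kernel_ge0.
have IG : (\int[mu2]_z (g z.2 * heat_kernel t z.1 z.2)%:E = (\int[mu]_x g x)%:E)%E.
  rewrite (fubini_tonelli2 (fun z : E * E => (g z.2 * heat_kernel t z.1 z.2)%:E))//.
  rewrite /Rintegral fineK; last exact: integrable_fin_num gi.
  apply: eq_integral => y _; rewrite /fubini_G/=.
  under eq_integral do rewrite EFinM.
  rewrite ge0_integralZl//; last 3 first.
  - by apply/measurable_EFinP; exact: measurable_heat_kernel1.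
  - by move=> x _; rewrite lee_fin heat_kernel_ge0.
  - by rewrite lee_fin.
  by rewrite integral_heat_kernel1// mule1.
have Gi : itg mu2 (fun z : E * E => g z.2 * heat_kernel t z.1 z.2).
  by apply: itg_ge0 => //; rewrite IG ltry.
have -> : M * \int[mu]_x g x = \int[mu2]_z (M * (g z.2 * heat_kernel t z.1 z.2)).
  by rewrite RintegralZl//; congr (_ * _); rewrite [in RHS]/Rintegral IG.
apply: le_Rintegral => //; [exact: itg_heat_pairing|exact: itgZ|].
by move=> z _; rewrite -mulrA ler_wpM2r// mulr_ge0// heat_kernel_ge0.
Qed.

Lemma heat_pairing_le_sep t f g K : 0 < t -> sqint mu f -> sqint mu g -> itg mu f -> itg mu g ->
  (forall x, 0 <= f x) -> (forall x, 0 <= g x) ->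
  (forall x y, f x != 0 -> g y != 0 -> heat_kernel t x y <= K) ->
  heat_pairing t f g <= K * (\int[mu]_x f x * \int[mu]_x g x).
Proof.
move=> t0 f2 g2 fi gi f0 g0 hK.
have ti := itg_tensor fi gi.
have -> : K * (\int[mu]_x f x * \int[mu]_x g x) = \int[mu2]_z (K * (f z.1 * g z.2)).
  rewrite RintegralZl//; congr (_ * _).
  rewrite Rintegral_prod1//=; last by move=> x; exact: itgZ.
  under [RHS]eq_Rintegral do rewrite RintegralZl//.
  by rewrite RintegralZr.
apply: le_Rintegral => //; [exact: itg_heat_pairing|exact: itgZ|].
move=> z _; rewrite mulrC.
have [->|fz] := eqVneq (f z.1) 0; first by rewrite !(mul0r, mulr0).
have [->|gz] := eqVneq (g z.2) 0; first by rewrite !(mul0r, mulr0).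
by rewrite ler_wpM2r ?mulr_ge0// hK.
Qed.

(** Off the diagonal the exponential factor of the kernel beats the power of
    the time. A bound linear in small times is what makes the interaction of
    separated functions integrable against the subordination density. *)
Lemma heat_kernel_sep r : 0 < r -> exists C, 0 < C /\ forall t (x y : E), 0 < t ->
  r ^+ 2 <= dotp (x - y) (x - y) -> heat_kernel t x y <= C * Num.min t 1.
Proof.
move=> r0; pose a := r ^+ 2 / 4; pose b := Num.min 1 (a / N.+1%:R).
have a0 : 0 < a by rewrite divr_gt0// exprn_gt0.
have b0 : 0 < b by rewrite lt_min ltr01 divr_gt0.
(* With [w = 1 / t], the singular factor of the kernel is at most
   [(1 + w) ^+ N] and [min t 1] is at least [(1 + w)^-1], so the exponential
   has to dominate [(1 + w) ^+ N.+1]. *)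
exists (b ^+ N.+1)^-1; split; first by rewrite invr_gt0 exprn_gt0.
move=> t x y t0 rxy; pose w := t^-1.
have w0 : 0 < w by rewrite invr_gt0.
have h1 : (Num.sqrt (4 * pi * t)) ^- N <= (1 + w) ^+ N.
  have w1 : 0 <= 1 + w by rewrite addr_ge0// ltW.
  rewrite -exprVn; apply: lerXn2r; rewrite ?nnegrE ?invr_ge0 ?sqrtr_ge0//.
  rewrite -sqrtrV; last by rewrite !mulr_ge0// ?pi_ge0 ?ltW.
  rewrite -[leRHS](ger0_norm w1) -sqrtr_sqr ler_wsqrtr//.
  have := pi_ge2 R => p2.
  have h : (4 * pi * t)^-1 <= w.
    rewrite lef_pV2 ?posrE ?mulr_gt0 ?pi_gt0//; nra.
  by apply: (le_trans h); nra.
have h2 : gaussN (4 * t)^-1 (x - y) <= expR (- (a * w)).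
  rewrite /gaussN ler_expR lerN2 (_ : a * w = (4 * t)^-1 * r ^+ 2); last by rewrite /a /w;
    field; rewrite gt_eqF.
  by rewrite ler_wpM2l// invr_ge0 mulr_ge0// ltW.
have h3 : b ^+ N.+1 * (1 + w) ^+ N.+1 <= expR (a * w).
  rewrite -exprMn (_ : a * w = a / N.+1%:R * w * N.+1%:R); last by field; rewrite gt_eqF.
  rewrite (mulrC (a / N.+1%:R * w)) expRM_natl.
  have w1 : 0 < 1 + w by rewrite addr_gt0.
  apply: lerXn2r; rewrite ?nnegrE ?expR_ge0 ?(ltW (mulr_gt0 b0 w1))//.
  apply: le_trans (expR_ge1Dx _); rewrite mulrDr mulr1 lerD//; first by rewrite ge_min lexx.
  by rewrite ler_wpM2r ?ge_min ?lexx ?orbT// ltW.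
have h4 : (1 + w)^-1 <= Num.min t 1.
  have w1 : 0 < 1 + w by rewrite addr_gt0.
  rewrite le_min; apply/andP; split.
    by rewrite -[leRHS]invrK lef_pV2 ?posrE// -/w lerDr.
  by rewrite invf_le1// lerDl ltW.
rewrite /heat_kernel; apply: (@le_trans _ _ ((1 + w) ^+ N * expR (- (a * w)))).
  by apply: ler_pM => //; rewrite ?gaussN_ge0 ?invr_ge0 ?exprn_ge0 ?sqrtr_ge0.
apply: (@le_trans _ _ ((b ^+ N.+1)^-1 * (1 + w)^-1)); last first.
  by rewrite ler_wpM2l// invr_ge0 exprn_ge0// ltW.
have w1 : 0 < 1 + w by rewrite addr_gt0.
rewrite -invfM expRN ler_pdivrMr ?expR_gt0// mulrC ler_pdivlMr ?mulr_gt0 ?exprn_gt0//.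
by rewrite mulrCA -exprSr.
Qed.

End heat_bounds.

(** * The peaks of a function and their fractional energy *)
Section truncation.
Context {R : realType} {N : nat}.
Notation E := 'rV[R]_N.
Notation mu := (@lebesgueN R N).
Notation leb := (@lebesgue_measure R).
Variable s : R.
Hypotheses (s0 : 0 < s) (s1 : s < 1).
Implicit Types (f g h : E -> R) (t : R).

Lemma heat_form0l t f : 0 < t -> sqint mu f -> heat_form t (fun _ : E => 0) f = 0.
Proof.
move=> t0 f2; have := @heat_formZl _ _ t 0 (fun=> 0) f t0 (sqint0 mu) f2.
by rewrite !mul0r.
Qed.

Lemma heat_form_suml t k (c : 'I_k -> R) (F : 'I_k -> E -> R) f : 0 < t ->
  (forall i, sqint mu (F i)) -> sqint mu f ->
  heat_form t (fun x => \sum_(i < k) c i * F i x) f = \sum_(i < k) c i * heat_form t (F i) f.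
Proof.
move=> t0; elim: k c F => [|k IH] c F F2 f2.
  rewrite big_ord0 -[RHS](heat_form0l t0 f2); congr heat_form.
  by apply/funext => x; rewrite big_ord0.
rewrite big_ord_recr/= -IH// -heat_formZl// -heat_formDl//; last 2 first.
- by apply: sqint_sum => i; exact: sqintZ.
- exact: sqintZ.
by congr heat_form; apply/funext => x; rewrite big_ord_recr.
Qed.

Lemma heat_form_sumr t k (c : 'I_k -> R) (F : 'I_k -> E -> R) f : 0 < t ->
  (forall i, sqint mu (F i)) -> sqint mu f ->
  heat_form t f (fun x => \sum_(i < k) c i * F i x) = \sum_(i < k) c i * heat_form t f (F i).
Proof.
move=> t0 F2 f2; rewrite heat_formC//; last by apply: sqint_sum => i; exact: sqintZ.
by rewrite heat_form_suml//; apply: eq_bigr => i _; rewrite heat_formC.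
Qed.

(** An inequality between heat forms at all times passes to the forms of the
    fractional Laplacian. *)
Lemma fraclap_form_le u v phi K : Hs s u -> Hs s v -> Hs s phi ->
  (forall t, 0 < t -> heat_form t v v <= heat_form t u phi + K * Num.min t 1) ->
  \int[mu]_x (fraclap (s / 2) v x ^+ 2) <=
  \int[mu]_x (fraclap (s / 2) u x * fraclap (s / 2) phi x) +
    (subord_const s)^-1 * (K * \int[leb]_t subord_majorant s t).
Proof.
move=> uH vH phiH key; rewrite Rintegral_sqr.
have -> : inner mu (fraclap (s / 2) v) (fraclap (s / 2) v) = _ := fraclap_form s0 s1 vH vH.
rewrite (fraclap_form s0 s1 uH phiH).
have ci : 0 <= (subord_const s)^-1 by rewrite invr_ge0 ltW// subord_const_gt0.
rewrite -mulrDr ler_wpM2l//.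
have wi := itg_subord_majorant s0 s1.
have fu := (HsP s0 s1 u).1 uH; have fv := (HsP s0 s1 v).1 vH; have fphi := (HsP s0 s1 phi).1 phiH.
have upi := itg_weighted_form fu fphi; have vi := itg_weighted_form fv fv.
have -> : K * \int[leb]_t subord_majorant s t = \int[leb]_t (K * subord_majorant s t) by rewrite
  RintegralZl.
rewrite -RintegralD//; last exact: itgZ.
apply: (le_Rintegral measurableT vi (itgD upi (itgZ K wi))) => t _.
rewrite /weighted_form /subord_majorant mulrCA -mulrDr ler_wpM2l ?expR_ge0//.
by apply: key; exact: expR_gt0.
Qed.

Variables (k : nat) (A : 'I_k -> set E) (r : R) (u : E -> R) (th : R).
Hypotheses (mA : forall j, measurable (A j)) (r0 : 0 < r) (th0 : 0 < th).
Hypothesis sepA : forall i j x y, i != j -> A i x -> A j y -> r ^+ 2 <= dotp (x - y) (x - y).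
Hypotheses (u2 : sqint mu u) (u0 : forall x, 0 <= u x).
Hypothesis uA : forall x, (forall j, ~ A j x) -> u x <= th.

(** Where [th] bounds [u] outside the sets [A j], the restriction to one of these
    sets creates no jump. *)
Definition excess (j : 'I_k) (x : E) : R := Num.max (u x - th) 0 * \1_(A j) x.
Local Notation psi := excess.
Let I j := \int[mu]_x psi j x.

Lemma excess_ge0 j x : 0 <= psi j x.
Proof. by rewrite /psi mulr_ge0// ?le_max ?lexx ?orbT// indicE. Qed.

Lemma measurable_excess j : measurable_fun setT (psi j).
Proof.
have mu_ := sqint_meas u2; apply: measurable_funM; last exact: measurable_indic.
by apply: measurable_maxr => //; apply: measurable_funB.
Qed.

Lemma excess_le j x : psi j x <= u x.
Proof.
rewrite /psi indicE; case: (_ \in _); rewrite ?mulr1 ?mulr0//.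
by rewrite ge_max u0 andbT; have := th0; lra.
Qed.

Lemma sqint_excess j : sqint mu (psi j).
Proof.
apply: (sqint_le _ u2); first exact: measurable_excess.
by move=> x; rewrite !ger0_norm ?u0 ?excess_ge0 ?excess_le.
Qed.

Lemma excess_neq0 j x : psi j x != 0 -> A j x /\ th < u x.
Proof.
rewrite /psi indicE; have [|_] := boolP (x \in A j); last by rewrite mulr0 eqxx.
rewrite inE => Ax; rewrite mulr1; case: (leP (u x - th) 0) => [|h]; first by rewrite eqxx.
by split => //; rewrite -subr_gt0.
Qed.

Lemma excess_disj i j x : i != j -> psi i x * psi j x = 0.
Proof.
move=> ij; have [->|/excess_neq0[Ai _]] := eqVneq (psi i x) 0; first by rewrite mul0r.
have [->|/excess_neq0[Aj _]] := eqVneq (psi j x) 0; first by rewrite mulr0.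
have := sepA ij Ai Aj; rewrite subrr.
have -> : dotp (0 : E) 0 = 0 by rewrite -enorm_sqr enorm0 expr0n.
by rewrite leNgt exprn_gt0.
Qed.

Lemma excess_le_sqr j x : psi j x <= th^-1 * u x ^+ 2.
Proof.
have [->|/excess_neq0[_ h]] := eqVneq (psi j x) 0.
  by rewrite mulr_ge0 ?sqr_ge0// invr_ge0 ltW.
rewrite (le_trans (excess_le j x))// ler_pdivlMl// expr2 ler_wpM2r// ltW//.
Qed.

Lemma itg_excess j : itg mu (psi j).
Proof.
have [_ ui] := (sqintP mu u).1 u2.
apply: (itg_le _ (itgZ th^-1 ui)); first exact: measurable_excess.
by move=> x; rewrite ger0_norm ?excess_ge0 ?excess_le_sqr.
Qed.

Lemma sum_excess x : \sum_(j < k) psi j x = Num.max (u x - th) 0.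
Proof.
have [[j Aj]|h] := pselect (exists j, A j x).
  rewrite (bigD1 j)//= big1 ?addr0.
    by rewrite /psi indicE mem_set ?mulr1.
  move=> i ij; rewrite /psi indicE memNset ?mulr0// => Ai.
  have := sepA ij Ai Aj; rewrite subrr.
  have -> : dotp (0 : E) 0 = 0 by rewrite -enorm_sqr enorm0 expr0n.
  by rewrite leNgt exprn_gt0.
rewrite big1 => [|j _]; last by rewrite /psi indicE memNset ?mulr0// => Aj; apply: h; exists j.
apply/esym/max_idPr; rewrite subr_le0; apply: uA => j Aj; apply: h; by exists j.
Qed.

Let tau x := u x - \sum_(j < k) psi j x.

Let tauE x : tau x = Num.min (u x) th.
Proof. rewrite /tau sum_excess; have [h|h] := leP (u x) th; have [h'|h'] := leP (u x - th) 0;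
  lra. Qed.

Let tau2 : sqint mu tau.
Proof. by apply: sqintB => //; apply: sqint_sum => j; exact: sqint_excess. Qed.

(** Where a peak is positive, [tau] has its maximal value [th], above which the
    heat flow cannot rise. *)
Let heat_form_tau t j : 0 < t -> 0 <= heat_form t tau (psi j).
Proof.
move=> t0; rewrite /heat_form subr_ge0.
have h := @heat_pairing_le_cst _ _ t tau (psi j) th t0 tau2 (sqint_excess j) (itg_excess j).
apply: (le_trans (h _ (excess_ge0 j))).
  by move=> x; rewrite tauE ge_min lexx orbT.
rewrite -RintegralZl//; last exact: itg_excess.
rewrite le_eqVlt; apply/orP; left; apply/eqP; apply: eq_Rintegral => x _.
have [->|/excess_neq0[_ h']] := eqVneq (psi j x) 0; first by rewrite !mulr0.
by rewrite tauE (min_idPr _)// ltW.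
Qed.

Variable C : R.
Hypothesis C0 : 0 <= C.
Hypothesis kernel_sep : forall t (x y : E), 0 < t -> r ^+ 2 <= dotp (x - y) (x - y) ->
  heat_kernel t x y <= C * Num.min t 1.

Let I0 j : 0 <= I j.
Proof. by apply: Rintegral_ge0 => x _; exact: excess_ge0. Qed.

Let q t i j := heat_form t (psi i) (psi j).

Let qC t i j : 0 < t -> q t i j = q t j i.
Proof. by move=> t0; rewrite /q heat_formC//; exact: sqint_excess. Qed.

(** Only the exchanged heat is left when the supports are disjoint. *)
Let q_off t i j : 0 < t -> i != j -> - (C * Num.min t 1 * (I i * I j)) <= q t i j <= 0.
Proof.
move=> t0 ij; rewrite /q /heat_form.
have -> : inner mu (psi i) (psi j) = 0.
  rewrite /inner; under eq_Rintegral do rewrite excess_disj//.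
  by rewrite /Rintegral integral0.
rewrite sub0r oppr_le0 heat_pairing_ge0 ?andbT; [|exact: excess_ge0|exact: excess_ge0].
rewrite lerN2; apply: heat_pairing_le_sep => //; try exact: sqint_excess; try exact: itg_excess;
  try exact: excess_ge0.
by move=> x y /excess_neq0[Ax _] /excess_neq0[Ay _]; apply: kernel_sep => //; exact: sepA ij Ax Ay.
Qed.

Let Itot := \sum_(j < k) I j.

Let uE : u = fun x => tau x + \sum_(j < k) 1 * psi j x.
Proof. by apply/funext => x; rewrite /tau; under [X in _ + X]eq_bigr do rewrite mul1r;
  rewrite subrK. Qed.

Let heat_form_u t j : 0 < t -> \sum_(i < k) q t i j <= heat_form t u (psi j).
Proof.
move=> t0; rewrite [in leRHS]uE heat_formDl//; last 2 first.
- by apply: sqint_sum => i; apply: sqintZ; exact: sqint_excess.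
- exact: sqint_excess.
rewrite heat_form_suml//; [|exact: sqint_excess|exact: sqint_excess].
by under [X in _ <= _ + X]eq_bigr do rewrite mul1r; rewrite lerDr heat_form_tau.
Qed.

(** The form of [u] and one peak is at least the energy of the peak up to the
    interactions. The arithmetic-geometric mean inequality then bounds this
    energy by that of [u]: the peaks inherit finite energy. *)
Lemma heat_form_excess_le t j : 0 < t ->
  heat_form t (psi j) (psi j) <= heat_form t u u + 2 * (C * (I j * Itot)) * Num.min t 1.
Proof.
move=> t0; have := heat_form_u j t0.
have := heat_form_AM t0 u2 (sqint_excess j) => /(le_trans (ler_norm _)) h1 h2.
have : q t j j - C * Num.min t 1 * (I j * Itot) <= \sum_(i < k) q t i j.
  rewrite (bigD1 j)//= lerD2l.
  apply: (@le_trans _ _ (\sum_(i < k | i != j) - (C * Num.min t 1 * (I i * I j)))); last first.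
    by apply: ler_sum => i ij; have /andP[] := q_off t0 ij.
  rewrite sumrN lerN2 -mulr_sumr ler_wpM2l//.
    by rewrite mulr_ge0// le_min (ltW t0) ler01.
  rewrite -mulr_suml mulrC ler_wpM2l// /Itot [leRHS](bigD1 j)//= lerDr; exact: I0.
rewrite -/(q t j j) in h1 *; lra.
Qed.

Lemma Hs_excess j : Hs s u -> Hs s (psi j).
Proof.
move=> /(HsP s0 s1)/finite_energyP[_ ui]; apply/(HsP s0 s1)/finite_energyP.
have p2 := sqint_excess j; split => //.
have wi := itg_subord_majorant s0 s1.
apply: (itg_le _ (itgD ui (itgZ (2 * (C * (I j * Itot))) wi)));
  first exact: measurable_weighted_form_diag.
move=> t; rewrite ger0_norm ?weighted_form_ge0// /weighted_form /subord_majorant mulrCA -mulrDr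
  ler_wpM2l ?expR_ge0//.
by apply: heat_form_excess_le; exact: expR_gt0.
Qed.

Variable c : 'I_k -> R.
Let v x := \sum_(j < k) c j * psi j x.
Let phi x := \sum_(j < k) c j ^+ 2 * psi j x.
Let J := \sum_(j < k) c j ^+ 2 * I j.

(** Both forms are expanded in the peaks. By symmetry the difference is half
    the sum of the [(c i - c j) ^+ 2] times the heat exchanged between different
    peaks; the term of [u] below the peaks has the good sign
    ([heat_form_tau]). *)
Lemma heat_form_excess_form t : 0 < t ->
  heat_form t v v <= heat_form t u phi + 2 * (C * (Itot * J)) * Num.min t 1.
Proof.
move=> t0; have p2 := sqint_excess.
have v2 : sqint mu v by apply: sqint_sum => i; exact: sqintZ.
rewrite /v heat_form_suml// /phi heat_form_sumr//.
apply: (@le_trans _ _ (\sum_(j < k) c j ^+ 2 * \sum_(i < k) q t i j + 2 * (C * (Itot * J)) *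
  Num.min t 1)); last first.
  by rewrite lerD2r; apply: ler_sum => j _; rewrite ler_wpM2l ?sqr_ge0// heat_form_u.
under eq_bigr do rewrite -/v /v heat_form_sumr//.
have -> : \sum_(j < k) c j ^+ 2 * (\sum_(i < k) q t i j) =
    \sum_(i < k) \sum_(j < k) 2^-1 * (c i ^+ 2 + c j ^+ 2) * q t i j.
  transitivity (\sum_(i < k) \sum_(j < k) (2^-1 * c i ^+ 2 * q t i j + 2^-1 * c j ^+ 2 * q t i
    j)); last first.
    by apply: eq_bigr => i _; apply: eq_bigr => j _; ring.
  under [RHS]eq_bigr do rewrite big_split/=.
  rewrite big_split/= [X in _ = _ + X]exchange_big/= -big_split/=.
  apply: eq_bigr => j _; rewrite -!mulr_sumr.
  have -> : \sum_(i < k) q t j i = \sum_(i < k) q t i j by apply: eq_bigr => i _; exact: qC.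
  by field.
have -> : 2 * (C * (Itot * J)) * Num.min t 1 =
    \sum_(i < k) \sum_(j < k) (c i ^+ 2 + c j ^+ 2) * (C * Num.min t 1 * (I i * I j)).
  transitivity (C * Num.min t 1 * (\sum_(i < k) \sum_(j < k) (c i ^+ 2 * I i * I j + I i * (c j
    ^+ 2 * I j)))).
    under eq_bigr do rewrite big_split/= -!mulr_sumr.
    by rewrite big_split/= -!mulr_suml -/J -/Itot; ring.
  rewrite mulr_sumr; apply: eq_bigr => i _; rewrite mulr_sumr; apply: eq_bigr => j _; ring.
rewrite -big_split/=; apply: ler_sum => i _; rewrite -big_split/= mulr_sumr; apply: ler_sum => j _.
rewrite -/(q t i j).
have [<-|ij] := eqVneq i j.
  have h : 0 <= (c i ^+ 2 + c i ^+ 2) * (C * Num.min t 1 * (I i * I i)).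
    by rewrite mulr_ge0 ?addr_ge0 ?sqr_ge0// !mulr_ge0// le_min (ltW t0) ler01.
  have -> : c i * (c i * q t i i) = 2^-1 * (c i ^+ 2 + c i ^+ 2) * q t i i by field.
  by rewrite lerDl.
have /andP[h1 h2] := q_off t0 ij.
set K := C * _ * _ in h1 *.
have h3 : 0 <= (c i - c j) ^+ 2 * (q t i j + K) by rewrite mulr_ge0 ?sqr_ge0//; lra.
have h4 : 0 <= (c i + c j) ^+ 2 * K by rewrite mulr_ge0 ?sqr_ge0//; lra.
nra.
Qed.

Lemma fraclap_excess_form : Hs s u ->
  \int[mu]_x (fraclap (s / 2) v x ^+ 2) <=
  \int[mu]_x (fraclap (s / 2) u x * fraclap (s / 2) phi x) +
    (subord_const s)^-1 * (2 * (C * (Itot * J)) * \int[leb]_t subord_majorant s t).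
Proof.
move=> uH; have pH j := Hs_excess j uH.
have sumH (d : 'I_k -> R) : Hs s (fun x => \sum_(j < k) d j * psi j x).
  apply/(HsP s0 s1); apply: finite_energy_sum => // j; apply: finite_energyZ => //.
  by apply/(HsP s0 s1).
exact: (fraclap_form_le uH (sumH c) (sumH (fun j => c j ^+ 2)) heat_form_excess_form).
Qed.

End truncation.

(** * The Rayleigh quotient on the span of the peaks *)
Section pointwise.
Context {R : realType}.
Implicit Types (p y th : R).

Lemma powR_mul1 p y : 0 < y -> y `^ p = y `^ (p - 1) * y.
Proof.
move=> y0; rewrite -[X in _ = _ * X](powRr1 (ltW y0)) -powRD ?subrK//.
by rewrite (gt_eqF y0) implybT.
Qed.

(** Where [y] is large the superlinear term decides; where [y] is comparable to
    the threshold [th], its power is small compared with the potential, and the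
    potential term [Vx * th] decides. The two ranges are separated at
    [2 * p / (p - 1) * th]. *)
Lemma peak_ineq p th y Vx Vm dl c0 : 1 < p -> 0 < th -> th < y -> Vm <= Vx ->
  dl <= Vm * th / 4 -> (2 * p / (p - 1) * th) `^ (p - 1) <= Vm / 4 ->
  0 <= c0 -> c0 <= th `^ (p - 1) * (p - 1) / 2 -> c0 * (2 * p / (p - 1)) <= Vm / 2 ->
  y `^ p - Vx * y + dl + Vx * (y - th) - p * y `^ (p - 1) * (y - th) + c0 * (y - th) <= 0.
Proof.
move=> p1 th0 thy VV hdl hth c00 hc1 hc2.
set K := 2 * p / (p - 1) in hth hc2.
have p10 : 0 < p - 1 by rewrite subr_gt0.
have KE : K * (p - 1) = 2 * p by rewrite /K; field; rewrite gt_eqF.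
have y0 : 0 < y by exact: lt_trans thy.
rewrite (powR_mul1 p y0).
have thle : th `^ (p - 1) <= y `^ (p - 1) by apply: ge0_ler_powR;
  rewrite ?nnegrE ?(ltW th0) ?(ltW y0) ?(ltW thy) ?(ltW p10).
have Y0 : 0 <= y `^ (p - 1) by exact: powR_ge0.
have Vth : Vm * th <= Vx * th by rewrite ler_wpM2r// ltW.
set Y := y `^ (p - 1) in thle Y0 *; set W := th `^ (p - 1) in hc1 thle.
have [hy|hy] := leP (K * th) y.
- have h1 : (p - 1) * (K * th) <= (p - 1) * y by rewrite ler_wpM2l// ltW.
  have h2 : Y * (p * th - (p - 1) * y) <= Y * (- ((p - 1) * y / 2)).
    by rewrite ler_wpM2l//; rewrite mulrA (mulrC (p - 1)) KE in h1; lra.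
  have h3 : W * ((p - 1) * y / 2) <= Y * ((p - 1) * y / 2).
    by rewrite ler_wpM2r// divr_ge0// mulr_ge0// ltW.
  have h4 : c0 * y <= W * (p - 1) / 2 * y by rewrite ler_wpM2r// ltW.
  have h5 : 0 <= c0 * th by rewrite mulr_ge0// ltW.
  have h6 : Vm * th / 4 <= Vm * th.
    have : 0 <= Vm by have := powR_ge0 (K * th) (p - 1); lra.
    move=> Vm0; have : 0 <= Vm * th by rewrite mulr_ge0// ltW.
    lra.
  have e : Y * y - Vx * y + dl + Vx * (y - th) - p * Y * (y - th) + c0 * (y - th)
     = Y * (p * th - (p - 1) * y) + (dl - Vx * th) + (c0 * y - c0 * th) by ring.
  rewrite e; lra.
- have Kth0 : 0 <= K * th by exact: le_trans (ltW y0) (ltW hy).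
  have YK : Y <= Vm / 4.
    apply: le_trans hth; apply: ge0_ler_powR; rewrite ?nnegrE ?(ltW p10) ?(ltW y0) ?(ltW hy)//.
  have h1 : Y * (p * th - (p - 1) * y) <= Y * th.
    rewrite ler_wpM2l//; have : (p - 1) * th <= (p - 1) * y by rewrite ler_wpM2l// ltW.
    lra.
  have h2 : Y * th <= Vm / 4 * th by rewrite ler_wpM2r// ltW.
  have h3 : c0 * (y - th) <= c0 * (K * th) by rewrite ler_wpM2l//; lra.
  have h4 : c0 * K * th <= Vm / 2 * th by rewrite ler_wpM2r// ltW.
  have e : Y * y - Vx * y + dl + Vx * (y - th) - p * Y * (y - th) + c0 * (y - th)
     = Y * (p * th - (p - 1) * y) + (dl - Vx * th) + c0 * (y - th) by ring.
  rewrite e; lra.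
Qed.

End pointwise.

Section finite_sums.
Context d (T : measurableType d) (R : realType) (mu : {measure set T -> \bar R}).

Lemma Rintegral_sumZ n (F : 'I_n -> T -> R) (c : 'I_n -> R) : (forall j, itg mu (F j)) ->
  itg mu (fun x => \sum_(j < n) c j * F j x) /\
  \int[mu]_x \sum_(j < n) c j * F j x = \sum_(j < n) c j * \int[mu]_x F j x.
Proof.
elim: n F c => [|n IH] F c Fi.
  split; first by under eq_fun do rewrite big_ord0; exact: itg0.
  rewrite big_ord0; under eq_Rintegral do rewrite big_ord0.
  by rewrite /Rintegral integral0.
have [I1 I2] := IH (fun j => F (widen_ord (leqnSn n) j)) (fun j => c (widen_ord (leqnSn n) j))
  (fun j => Fi _).
have Il : itg mu (fun x => c ord_max * F ord_max x) := itgZ _ (Fi _).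
split; first by under eq_fun do rewrite big_ord_recr; exact: itgD.
under eq_Rintegral do rewrite big_ord_recr.
rewrite (RintegralD measurableT I1 Il) I2 big_ord_recr/=; congr (_ + _).
by rewrite RintegralZl//; exact: (Fi ord_max).
Qed.

End finite_sums.

Section one_solution.
Context {R : realType} {N : nat}.
Notation E := 'rV[R]_N.
Notation mu := (@lebesgueN R N).
Notation leb := (@lebesgue_measure R).
Variables (s p eps : R) (V u : E -> R) (Vm VM M : R).
Hypotheses (s0 : 0 < s) (s1 : s < 1) (p1 : 1 < p).
Hypotheses (mV : measurable_fun setT V) (VVm : forall x, Vm <= V x) (VVM : forall x, `|V x| <= VM).
Hypothesis sol : positive_solution s p eps V u.

Let u_gt0 x : 0 < u x. Proof. by have [_ h _] := sol. Qed.
Let uH : Hs s u. Proof. by have [_ _ []] := sol. Qed.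
Let weak phi : Hs s phi -> eps `^ (2 * s) *
       \int[mu]_x (fraclap (s / 2) u x * fraclap (s / 2) phi x)
     + \int[mu]_x (V x * u x * phi x) = \int[mu]_x (u x `^ p * phi x).
Proof. by have [_ _ [_ h]] := sol; exact: h. Qed.

Let u2 : sqint mu u. Proof. by have [] := (HsP s0 s1 u).1 uH. Qed.

Let itg_bdd (B : E -> R) b f : measurable_fun setT B -> (forall x, `|B x| <= b) -> itg mu f ->
  itg mu (fun x => B x * f x).
Proof.
move=> mB Bb fi; apply: (itg_le _ (itgZ b (itg_norm fi))).
  by apply: measurable_funM => //; exact: (itg_meas fi).
by move=> x; rewrite normrM ler_wpM2r.
Qed.

(** Tested against itself, the equation makes the energy a multiple of its
    quadratic part, so that bounded energy bounds the mass. *)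
Lemma mass_le_energy :
  (p - 1) / (2 * (p + 1)) * (Vm * \int[mu]_x (u x ^+ 2)) <= energy s p eps V u.
Proof.
have [h [fh Fh]] := fraclapP uH; have [F2' _ _] := Fh.
have Fi : itg mu (fun x => fraclap (s / 2) u x ^+ 2) by have [_] := (sqintP mu _).1 F2'.
have ui : itg mu (fun x => u x ^+ 2) by have [_] := (sqintP mu _).1 u2.
have Vi := itg_bdd mV VVM ui.
have W := weak uH.
(* an equality of integrands: finiteness of the integral is not at stake *)
have Wr : \int[mu]_x (u x `^ p * u x) = \int[mu]_x (`|u x| `^ (p + 1)).
  apply: eq_Rintegral => x _; rewrite ger0_norm ?ltW// [in RHS]powR_mul1//.
  by rewrite addrK.
have Wl : \int[mu]_x (eps `^ (2 * s) * fraclap (s / 2) u x ^+ 2 + V x * u x ^+ 2) =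
   eps `^ (2 * s) * \int[mu]_x (fraclap (s / 2) u x * fraclap (s / 2) u x)
     + \int[mu]_x (V x * u x * u x).
  rewrite RintegralD//; last exact: itgZ.
  rewrite RintegralZl//; congr (_ * _ + _).
  by apply: eq_Rintegral => x _; rewrite expr2 mulrA.
rewrite /energy -Wr Wl W.
have VV : Vm * \int[mu]_x (u x ^+ 2) <= \int[mu]_x (u x `^ p * u x).
  rewrite -W -Wl -RintegralZl//; apply: le_Rintegral => //; first exact: itgZ.
    by apply: itgD => //; exact: itgZ.
  move=> x _; have h1 : 0 <= eps `^ (2 * s) * fraclap (s / 2) u x ^+ 2.
    by rewrite mulr_ge0 ?powR_ge0 ?sqr_ge0.
  have h2 : Vm * u x ^+ 2 <= V x * u x ^+ 2 by rewrite ler_wpM2r ?sqr_ge0.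
  lra.
have p10 : 0 < p + 1 by rewrite addr_gt0//; exact: lt_trans p1.
have -> : forall z, 2^-1 * z - (p + 1)^-1 * z = (p - 1) / (2 * (p + 1)) * z.
  by move=> z; field; rewrite gt_eqF.
by rewrite ler_wpM2l// divr_ge0 ?mulr_ge0// ?subr_ge0 ltW.
Qed.

Hypothesis uM : forall x, u x <= M.
Variables (k : nat) (A : 'I_k -> set E) (r th C : R).
Hypotheses (mA : forall j, measurable (A j)) (r0 : 0 < r) (th0 : 0 < th).
Hypothesis sepA : forall i j x y, i != j -> A i x -> A j y -> r ^+ 2 <= dotp (x - y) (x - y).
Hypothesis uA : forall x, (forall j, ~ A j x) -> u x <= th.
Hypothesis C0 : 0 <= C.
Hypothesis kernel_sep : forall t (x y : E), 0 < t -> r ^+ 2 <= dotp (x - y) (x - y) ->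
  heat_kernel t x y <= C * Num.min t 1.
Notation psi := (excess A u th).
Let u0 x : 0 <= u x. Proof. exact: ltW. Qed.
Let p2 j : sqint mu (psi j) := sqint_excess mA th0 u2 u0 j.

(** Above the height [th] a function is at most its square divided by [th]. *)
Lemma excess_mass : \sum_(j < k) \int[mu]_x psi j x <= th^-1 * \int[mu]_x (u x ^+ 2).
Proof.
have ui : itg mu (fun x => u x ^+ 2) by have [_] := (sqintP mu _).1 u2.
have pi_ j := itg_excess mA th0 u2 u0 j.
have [si sE] := Rintegral_sumZ (fun=> 1) pi_.
rewrite (eq_bigr (fun j => 1 * \int[mu]_x psi j x)) => [|j _]; last by rewrite mul1r.
rewrite -sE.
have oneE x : \sum_(j < k) 1 * psi j x = \sum_(j < k) psi j x by under eq_bigr do rewrite mul1r.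
rewrite -RintegralZl//; apply: le_Rintegral => //; first exact: itgZ.
move=> x _; rewrite oneE (sum_excess r0 sepA uA) ge_max; apply/andP; split; last first.
  by rewrite mulr_ge0 ?sqr_ge0// invr_ge0 ltW.
have := sqr_ge0 (u x - th); rewrite ler_pdivlMl//.
have := mulr_gt0 th0 th0; have := u0 x; have := th0; nra.
Qed.

Variables (dl c0 : R) (c : 'I_k -> R).
Let v x := \sum_(j < k) c j * psi j x.
Let phi x := \sum_(j < k) c j ^+ 2 * psi j x.

(** At each point at most one peak contributes. *)
Let vphi x : exists d z, [/\ 0 <= d, z = 0 \/ (z = u x - th /\ th < u x), phi x = d * z & v x ^+
  2 = d * z ^+ 2].
Proof.
have [[j jx]|h] := pselect (exists j, psi j x != 0).
  have o i : i != j -> psi i x = 0.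
    move=> ij; have /eqP := excess_disj u th r0 sepA x ij.
    by rewrite mulf_eq0 (negbTE jx) orbF => /eqP.
  exists (c j ^+ 2), (psi j x); split; first exact: sqr_ge0.
  - right; have [Aj hj] := excess_neq0 jx; split => //.
    rewrite /excess indicE mem_set// mulr1; apply/max_idPl.
    by rewrite subr_ge0 ltW.
  - rewrite /phi (bigD1 j)//= big1 ?addr0// => i ij; by rewrite o// mulr0.
  - rewrite /v (bigD1 j)//= big1 ?addr0 ?exprMn// => i ij; by rewrite o// mulr0.
have o i : psi i x = 0 by apply/eqP/negPn/negP => ni; apply: h; exists i.
exists 0, 0; split => //; [by left| |].
- by rewrite /phi big1 ?mul0r// => i _; rewrite o mulr0.
- by rewrite /v big1 ?mul0r ?expr0n// => i _; rewrite o mulr0.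
Qed.

Hypotheses (hdl : dl <= Vm * th / 4) (hth : (2 * p / (p - 1) * th) `^ (p - 1) <= Vm / 4)
  (c00 : 0 <= c0) (hc1 : c0 <= th `^ (p - 1) * (p - 1) / 2) (hc2 : c0 * (2 * p / (p - 1)) <= Vm
    / 2).
Hypothesis eps_dl : eps `^ (2 * s) * ((subord_const s)^-1 * (2 * C * \int[leb]_t subord_majorant
  s t)
  * (th^-1 * \int[mu]_x (u x ^+ 2))) <= dl.

(** The equation tested against [phi] removes the fractional form, up to the
    interaction of the peaks, which enters through [dl]; the rest is a pointwise
    matter for [peak_ineq]. *)
Lemma rayleigh_excess : ~ ae0 v -> rayleigh s p eps V u v <= - c0.
Proof.
move=> v0.
have v2 : sqint mu v by apply: sqint_sum => j; exact: sqintZ.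
have psH j : Hs s (psi j) := Hs_excess s0 s1 mA r0 th0 sepA u2 u0 uA C0 kernel_sep j uH.
have phiH : Hs s phi.
  apply/(HsP s0 s1); apply: finite_energy_sum => // j; apply: finite_energyZ => //.
  by apply/(HsP s0 s1).
have phi2 : sqint mu phi by apply: sqint_sum => j; exact: sqintZ.
have pi_ j := itg_excess mA th0 u2 u0 j.
have vi : itg mu (fun x => v x ^+ 2) by have [_] := (sqintP mu _).1 v2.
have form := fraclap_excess_form s0 s1 mA r0 th0 sepA u2 u0 uA C0 kernel_sep c uH.
rewrite -/v -/phi in form.
set J := \sum_(j < k) _ * _ in form.
have [phii JE] : itg mu phi /\ \int[mu]_x phi x = J by exact: Rintegral_sumZ.
have J0 : 0 <= J.
  apply: sumr_ge0 => j _; rewrite mulr_ge0 ?sqr_ge0//; apply: Rintegral_ge0 => x _.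
  exact: excess_ge0.
have Mb (q : R) : 0 <= q -> forall x, `|u x `^ q| <= M `^ q.
  move=> q0 x; rewrite ger0_norm ?powR_ge0//; apply: ge0_ler_powR; rewrite ?nnegrE//.
  exact: le_trans (u0 x) (uM x).
have mpow q : measurable_fun setT (fun x => u x `^ q).
  exact: (measurableT_comp (measurable_powR q) (sqint_meas u2)).
have uphi := itgM u2 phi2.
have iA : itg mu (fun x => u x `^ p * phi x).
  by apply: (itg_bdd (mpow p) (Mb p _)) => //; exact: ltW (lt_trans _ p1).
have iB : itg mu (fun x => V x * u x * phi x).
  by under eq_fun do rewrite -mulrA; exact: (itg_bdd mV VVM).
have iC : itg mu (fun x => V x * v x ^+ 2) by exact: (itg_bdd mV VVM).
have iD : itg mu (fun x => u x `^ (p - 1) * v x ^+ 2).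
  by apply: (itg_bdd (mpow (p - 1)) (Mb (p - 1) _)) => //; rewrite subr_ge0 ltW.
have W := weak phiH.
have Imass := excess_mass.
set Itot := \sum_(j < k) _ in form; rewrite -/Itot in Imass.
have wi0 : 0 <= \int[leb]_t subord_majorant s t by apply: Rintegral_ge0 => t _;
  exact: subord_majorant_ge0.
have cs0 : 0 <= (subord_const s)^-1 by rewrite invr_ge0 ltW// subord_const_gt0.
have e0 : 0 <= eps `^ (2 * s) by exact: powR_ge0.
have vv0 : 0 < \int[mu]_x (v x ^+ 2).
  rewrite Rintegral_sqr lt_neqAle inner_ge0 andbT; apply/eqP => /esym/(inner_eq0 v2) vae.
  exact: v0.
rewrite /rayleigh ler_pdivrMr//.
have st1 : eps `^ (2 * s) * \int[mu]_x (fraclap (s / 2) v x ^+ 2) <=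
    \int[mu]_x (u x `^ p * phi x) - \int[mu]_x (V x * u x * phi x) + dl * \int[mu]_x phi x.
  have := ler_wpM2l e0 form; rewrite mulrDr => /le_trans; apply.
  rewrite -W addrK lerD2l JE.
  apply: (@le_trans _ _ (eps `^ (2 * s) * ((subord_const s)^-1 * (2 * C * \int[leb]_t
    subord_majorant s t)
     * (th^-1 * \int[mu]_x (u x ^+ 2))) * J)); last by rewrite ler_wpM2r.
  have -> : (subord_const s)^-1 * (2 * (C * (Itot * J)) * \int[leb]_t subord_majorant s t) =
     (subord_const s)^-1 * (2 * C * \int[leb]_t subord_majorant s t) * Itot * J by ring.
  rewrite [leLHS]mulrA; apply: ler_wpM2r => //; apply: ler_wpM2l => //; apply: ler_wpM2l => //.
  by rewrite mulr_ge0// mulr_ge0// mulr_ge0.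
apply: (@le_trans _ _ (\int[mu]_x (u x `^ p * phi x - V x * u x * phi x + dl * phi x
   + V x * v x ^+ 2 - p * (u x `^ (p - 1) * v x ^+ 2)))).
  have iAB := itgB iA iB; have idl := itgZ dl phii; have iABd := itgD iAB idl.
  have iABC := itgD iABd iC; have ip := itgZ p iD.
  rewrite RintegralB// RintegralD// RintegralD// RintegralB// !RintegralZl//.
  by rewrite lerD2r lerD2r.
rewrite -RintegralZl//; apply: le_Rintegral => //.
- by apply: itgB; [apply: itgD => //; apply: itgD; [exact: itgB|exact: itgZ]|exact: itgZ].
- exact: itgZ.
move=> x _; have [d [z [d0 zP -> ->]]] := vphi x.
case: zP => [->|[-> hx]]; first by rewrite expr0n !mulr0 !(subr0, addr0).
have key := peak_ineq p1 th0 hx (VVm x) hdl hth c00 hc1 hc2.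
have z0 : 0 <= u x - th by rewrite subr_ge0 ltW.
rewrite -subr_le0; apply: le_trans (mulr_ge0_le0 (mulr_ge0 d0 z0) key).
rewrite le_eqVlt; apply/orP; left; apply/eqP; ring.
Qed.

End one_solution.

(** * Eigenvalues *)
Section spectrum.
Context {R : realType} {N : nat}.
Notation E := 'rV[R]_N.
Notation mu := (@lebesgueN R N).

(** The span of the first [l] vectors of a basis competes for the smaller
    index, with a smaller maximum. *)
Lemma eigenvalue_mono (s p eps : R) (V u : E -> R) (l k : nat) : (l <= k)%N ->
  (eigenvalue_lin s p eps V u l <= eigenvalue_lin s p eps V u k)%E.
Proof.
move=> lk; apply: le_ereal_inf_tmp => _ [W [e [eH efree WE]] <-].
pose e' (i : 'I_l) := e (widen_ord lk i).
pose ext (c : 'I_l -> R) (i : 'I_k) : R := if insub (i : nat) is Some j then c j else 0.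
have extE c x : \sum_(i < k) ext c i * e i x = \sum_(i < l) c i * e' i x.
  rewrite (bigID (fun i : 'I_k => (i < l)%N))/= [X in _ + X]big1 ?addr0 => [|i il].
    rewrite (big_ord_narrow lk); apply: eq_bigr => i _; rewrite /ext insubT//= => h.
    by congr (c _ * _); exact: val_inj.
  by rewrite /ext insubF ?mul0r//; exact/negbTE.
pose W' : set (E -> R) := [set v | exists c : 'I_l -> R, v = (fun x => \sum_(i < l) c i * e' i x)].
have W'W : W' `<=` W.
  move=> _ [c ->]; rewrite WE; exists (ext c).
  by apply/funext => x; rewrite extE.
have HW' : Hs_subspace s l W'.
  exists e'; split => // [i|c c0 i]; first exact: eH.
  have /efree/(_ (widen_ord lk i)) : ae0 (fun x => \sum_(i < k) ext c i * e i x).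
    by apply: filterS c0 => x; rewrite extE.
  rewrite /ext insubT//= => h <-; congr c; exact: val_inj.
apply: (@le_trans _ _ (ereal_sup [set (rayleigh s p eps V u v)%:E | v in W' `&` [set v | ~ ae0
  v]])).
  by apply: ereal_inf_lbound; exists W'.
apply: ereal_sup_le => _ [v [vW v0] <-]; exists v => //; split => //; exact: W'W.
Qed.

Lemma liminf_gt0 (f : R -> \bar R) (F : set_system R) {FF : Filter F} :
  (0 < limf_einf f F)%E -> exists d : R, 0 < d /\ \forall x \near F, (d%:E <= f x)%E.
Proof.
rewrite /limf_einf /limf_esup oppe_gt0.
move=> /ereal_inf_lt[_ [U FU <-]] sup0.
have [d [d0 hd]] : exists d : R, 0 < d /\
    (ereal_sup [set (\- f)%E x | x in U] <= (- d)%:E)%E.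
  case: (ereal_sup _) sup0 => [r||]// h.
    by exists (- r); rewrite opprK; split => //; rewrite oppr_gt0 -lte_fin.
  by exists 1; split => //; rewrite leNye.
exists d; split => //; apply: filterS FU => x Ux.
rewrite -leeN2 -EFinN; apply: le_trans hd; apply: ereal_sup_ubound; by exists x.
Qed.

Lemma eball_sep (x0 y0 : E) r x y : 0 < r ->
  eball x0 (2 * r) `&` eball y0 (2 * r) = set0 -> eball x0 r x -> eball y0 r y ->
  r ^+ 2 <= dotp (x - y) (x - y).
Proof.
move=> r0 disj; rewrite /eball/= => hx hy;
  rewrite -enorm_sqr ler_sqr ?nnegrE ?enorm_ge0 ?(ltW r0)//.
rewrite leNgt; apply/negP => h.
have : (eball x0 (2 * r) `&` eball y0 (2 * r)) y.
  split; rewrite /eball/=; last by lra.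
  rewrite (_ : y - x0 = (y - x) + (x - x0)); last by rewrite addrA subrK.
  apply: (le_lt_trans (enormD _ _)); rewrite -(opprB x y) enormN; lra.
by rewrite disj.
Qed.

Lemma closed_eball_compact (x : E) r : compact [set y | enorm (y - x) <= r].
Proof.
apply: bounded_closed_compact.
  exists (`|x| + `|r|); split; first exact: num_real.
  move=> B hB y /= hy; apply: le_trans (ltW hB).
  rewrite -[y](subrK x) addrC; apply: (le_trans (ler_normD _ _)); rewrite lerD2l.
  rewrite [leLHS]/Num.norm/= mx_normrE.
  apply: bigmax_le => [|[i j] _]; first by [].
  rewrite /= ord1; apply: (le_trans (coord_le_enorm _ j)).
  exact: le_trans hy (ler_norm _).
have -> : [set y | enorm (y - x) <= r] = (fun y : E => enorm (y - x)) @^-1` [set z | z <= r] by [].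
apply: preimage_closed; first by move=> y _; exact: continuous_enormB.
exact: closed_le.
Qed.

Lemma bounded_above_off_balls (u : E -> R) k (x0 : 'I_k -> E) r d : continuous u ->
  (forall x, (forall j, ~ eball (x0 j) r x) -> u x <= d) -> exists M, forall x, u x <= M.
Proof.
move=> cu uA.
have B j : exists M, forall x, eball (x0 j) r x -> u x <= M.
  have /compact_bounded : compact (u @` [set y | enorm (y - x0 j) <= r]).
    apply: (@continuous_compact _ _ u); last exact: closed_eball_compact.
    exact: continuous_subspaceT.
  move=> [M [_ hM]]; exists (M + 1) => x hx; apply: (le_trans (ler_norm _)).
  have M1 : M < M + 1 by rewrite ltrDl.
  by apply: (hM _ M1); exists x => //; exact: ltW.
have [f hf] := choice B.
exists (Num.max d (\big[Num.max/0]_(j < k) f j)) => x.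
have [[j hj]|h] := pselect (exists j, eball (x0 j) r x).
  rewrite le_max; apply/orP; right; apply: (le_trans (hf j x hj)).
  exact: le_bigmax.
by rewrite le_max uA// => j hj; apply: h; exists j.
Qed.

(** Each peak is positive on an open set on which the others vanish. *)
Lemma excess_free k (A : 'I_k -> set E) (u : E -> R) th r (xi : 'I_k -> E) : 0 < r ->
  (forall i j x y, i != j -> A i x -> A j y -> r ^+ 2 <= dotp (x - y) (x - y)) ->
  (forall j, open (A j)) -> continuous u -> (forall j, A j (xi j) /\ th < u (xi j)) ->
  forall c : 'I_k -> R, ae0 (fun x => \sum_(i < k) c i * excess A u th i x) -> forall i, c i = 0.
Proof.
move=> r0 sepA oA cu peak c [Z [mZ Z0 sZ]] j.
apply/eqP/negPn/negP => cj.
have [Aj uj] := peak j.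
pose U := A j `&` u @^-1` [set y | th < y].
have oU : open U.
  apply: openI => //; apply: open_comp; first by move=> x _; exact: cu.
  exact: open_gt.
have UZ : U `<=` Z.
  move=> x [Ax ux]; apply: sZ => /=; apply/eqP.
  rewrite (bigD1 j)//= big1 => [|i ij].
    rewrite addr0 mulf_neq0// /excess indicE mem_set// mulr1 gt_eqF//.
    by rewrite lt_max subr_gt0 ux.
  have /eqP := excess_disj u th r0 sepA x ij.
  rewrite mulf_eq0 => /orP[/eqP->|]; first by rewrite mulr0.
  rewrite /excess indicE mem_set// mulr1 gt_eqF//.
  by rewrite lt_max subr_gt0 ux.
have : (0 < mu Z)%E.
  apply: (lt_le_trans (lebesgueN_open_gt0 oU (conj Aj uj : U (xi j)))).
  by apply: le_measure; rewrite ?inE//; exact: open_measurable_rV.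
by rewrite Z0 ltxx.
Qed.

Lemma eigenvalue_le_basis (s p eps : R) (V u : E -> R) k (e : 'I_k -> E -> R) b :
  (forall i, Hs s (e i)) ->
  (forall c : 'I_k -> R, ae0 (fun x => \sum_(i < k) c i * e i x) -> forall i, c i = 0) ->
  (forall c : 'I_k -> R, ~ ae0 (fun x => \sum_(i < k) c i * e i x) ->
     rayleigh s p eps V u (fun x => \sum_(i < k) c i * e i x) <= b) ->
  (eigenvalue_lin s p eps V u k <= b%:E)%E.
Proof.
move=> eH ef eb.
pose W : set (E -> R) := [set v | exists c : 'I_k -> R, v = (fun x => \sum_(i < k) c i * e i x)].
apply: (@le_trans _ _ (ereal_sup [set (rayleigh s p eps V u v)%:E | v in W `&` [set v | ~ ae0 v]])).
  by apply: ereal_inf_lbound; exists W => //; exists e.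
by apply: ge_ereal_sup => _ [_ [[c ->] v0] <-]; rewrite lee_fin; exact: eb.
Qed.

End spectrum.

Theorem proposition3p3 (R : realType) (N k : nat) (s p : R)
    (V w : 'rV[R]_N -> R) (xi0 : 'I_k -> 'rV[R]_N) (u : R -> 'rV[R]_N -> R) :
  (1 <= N)%N -> 0 < s -> s < 1 -> 2 * s < N%:R ->
  1 < p -> p < 2 * N%:R / (N%:R - 2 * s) - 1 ->
  Cb 2 V -> 0 < inf (range V) ->
  ground_state s p w ->
  (1 <= k)%N -> injective xi0 -> (forall j, critical_point V (xi0 j)) ->
  peak_family s p V w xi0 u ->
  exists c0 : R, 0 < c0 /\
    \forall eps \near 0^'+, forall l : nat, (1 <= l <= k)%N ->
      (eigenvalue_lin s p eps V (u eps) l <=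
         eigenvalue_lin s p eps V (u eps) k)%E /\
      (eigenvalue_lin s p eps V (u eps) k <= (- c0)%:E < 0%:E)%E.
Proof.
move=> _ s0 s1 _ p1 _ [cV bV _] Vm0 _ k1 _ _ [sols [r [xi [r0 [disj [xiP _] off peak En]]]]].
set Vm := inf (range V) in Vm0.
have [VM VVM] : exists VM, forall x, `|V x| <= VM.
  move: bV => [M [_ hM]]; exists (M + 1) => x.
  by apply: (hM (M + 1)) => //; rewrite ltrDl.
have VVm x : Vm <= V x.
  apply: ge_inf; last by exists x.
  by exists (- VM) => _ [y _ <-]; have := VVM y; rewrite ler_norml => /andP[].
have p10 : 0 < p - 1 by rewrite subr_gt0.
(* a height that all peaks exceed *)
have [d [d0 hd]] : exists d : R, 0 < d /\ \forall eps \near 0^'+, forall j, d <= u eps (xi eps j).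
  have [f hf] := choice (fun j => liminf_gt0 (peak j)).
  exists (\big[Num.min/1]_(j < k) f j); split.
    by apply: lt_bigmin => // j _; have [] := hf j.
  apply: filter_forall => j; have [_] := hf j; apply: filterS => eps.
  by rewrite lee_fin; apply: le_trans; exact: bigmin_le_cond.
pose K := 2 * p / (p - 1).
have K0 : 0 < K by rewrite divr_gt0// mulr_gt0//; exact: lt_trans p1.
(* below the peaks, and small enough for [peak_ineq] *)
pose th := Num.min (d / 2) ((Vm / 4) `^ (p - 1)^-1 / K).
have Vm4 : 0 < Vm / 4 by rewrite divr_gt0.
have th0 : 0 < th by rewrite lt_min (divr_gt0 d0)//= divr_gt0// powR_gt0.
have thd : th < d.
  have : th <= d / 2 by rewrite ge_min lexx.
  lra.
have hth : (K * th) `^ (p - 1) <= Vm / 4.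
  have h : K * th <= (Vm / 4) `^ (p - 1)^-1.
    by rewrite mulrC -ler_pdivlMr// ge_min lexx orbT.
  apply: (@le_trans _ _ (((Vm / 4) `^ (p - 1)^-1) `^ (p - 1))).
    by apply: ge0_ler_powR; rewrite ?nnegrE ?powR_ge0 ?(ltW (mulr_gt0 K0 th0)) ?(ltW p10).
  by rewrite -powRrM mulVf ?gt_eqF// powRr1// divr_ge0// ltW.
pose c0 := Num.min (th `^ (p - 1) * (p - 1) / 2) (Vm / 2 / K).
have c00 : 0 < c0.
  rewrite lt_min; apply/andP; split; last by rewrite divr_gt0// divr_gt0.
  by rewrite divr_gt0// mulr_gt0// powR_gt0.
have hc1 : c0 <= th `^ (p - 1) * (p - 1) / 2 by rewrite ge_min lexx.
have hc2 : c0 * K <= Vm / 2 by rewrite -ler_pdivlMr// ge_min lexx orbT.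
have sepA i j x y : i != j -> eball (xi0 i) r x -> eball (xi0 j) r y ->
  r ^+ 2 <= dotp (x - y) (x - y).
  by move=> ij; apply: eball_sep => //; exact: disj.
have mA j : measurable (eball (xi0 j) r) by exact: measurable_eball.
have [C [C0 kernel_sep]] := @heat_kernel_sep R N r r0.
set L := \sum_(j < k) _ in En.
(* a bound for the mass of the solutions, whose energy is at most
   [`|L| + 1] for parameters below one *)
pose S := (`|L| + 1) / ((p - 1) / (2 * (p + 1)) * Vm).
pose B := (subord_const s)^-1 * (2 * C * \int[@lebesgue_measure R]_t subord_majorant s t) *
  (th^-1 * S).
have a0 : 0 < (p - 1) / (2 * (p + 1)) * Vm.
  by rewrite mulr_gt0// divr_gt0// mulr_gt0// addr_gt0//; exact: lt_trans p1.
have S0 : 0 <= S by rewrite divr_ge0// ?addr_ge0// ltW.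
have Cs0 : 0 <= (subord_const s)^-1 * (2 * C * \int[@lebesgue_measure R]_t subord_majorant s t).
  rewrite mulr_ge0 ?invr_ge0 ?(ltW (subord_const_gt0 s0 s1))// mulr_ge0 ?mulr_ge0 ?(ltW C0)//.
  by apply: Rintegral_ge0 => t _; exact: subord_majorant_ge0.
have B0 : 0 <= B by rewrite /B mulr_ge0// mulr_ge0// invr_ge0 ltW.
(* below this parameter the interaction of the peaks is absorbed by the
   potential *)
pose e1 := (Vm * th / 4 / (B + 1)) `^ (2 * s)^-1.
have e10 : 0 < e1 by rewrite powR_gt0// !divr_gt0 ?mulr_gt0// ltr_wpDl.
have EL : L < `|L| + 1 by rewrite (le_lt_trans (ler_norm _))// ltrDl.
exists c0; split => //.
near=> eps => l /andP[l1 lk].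
have eps0 : 0 < eps by near: eps; exact: nbhs_right_gt.
have eps1 : eps < 1 by near: eps; exact: nbhs_right_lt.
have epse : eps < e1 by near: eps; exact: nbhs_right_lt.
have sol : positive_solution s p eps V (u eps) by near: eps.
have offe x : (forall j, ~ eball (xi0 j) r x) -> `|u eps x| < th.
  by move: x; near: eps; exact: off.
have he : eps ^- N * energy s p eps V (u eps) <= `|L| + 1.
  by near: eps; apply: (cvgr_le L En).
have hde j : d <= u eps (xi eps j) by move: j; near: eps.
have xie j : eball (xi0 j) r (xi eps j).
  have h : [set x | eball (xi0 j) r x /\ local_max (u eps) x] = [set xi eps j].
    by move: j; near: eps; exact: xiP.
  by have : [set xi eps j] (xi eps j) by []; rewrite -h => -[].
split; first exact: eigenvalue_mono.
apply/andP; split; last by rewrite lte_fin oppr_lt0.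
have [cu upos [uHs _]] := sol.
have uA x : (forall j, ~ eball (xi0 j) r x) -> u eps x <= th.
  by move=> /offe/ltW; exact: le_trans (ler_norm _).
have [M uM] := bounded_above_off_balls cu uA.
have u0 x : 0 <= u eps x by exact: ltW.
have u2 : sqint (@lebesgueN R N) (u eps) by have [] := (HsP s0 s1 _).1 uHs.
have mV : measurable_fun setT V by exact: continuous_measurable_rV.
have massS : \int[@lebesgueN R N]_x (u eps x ^+ 2) <= S.
  rewrite ler_pdivlMr// mulrC -[leLHS]mulrA.
  apply: (le_trans (mass_le_energy s0 s1 p1 mV VVm VVM sol)).
  have eN : 0 < eps ^+ N by exact: exprn_gt0.
  rewrite mulrC ler_pdivrMr// in he; apply: (le_trans he).
  by rewrite ler_piMr ?addr_ge0// exprn_ile1// ltW.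
have hdl : eps `^ (2 * s) * ((subord_const s)^-1 * (2 * C * \int[@lebesgue_measure R]_t
  subord_majorant s t)
  * (th^-1 * \int[@lebesgueN R N]_x (u eps x ^+ 2))) <= Vm * th / 4.
  apply: (@le_trans _ _ (eps `^ (2 * s) * B)).
    rewrite ler_wpM2l ?powR_ge0// /B ler_wpM2l// ler_wpM2l// invr_ge0 ltW//.
  have ss0 : 0 < 2 * s by rewrite mulr_gt0.
  have h : eps `^ (2 * s) <= Vm * th / 4 / (B + 1).
    apply: (@le_trans _ _ (e1 `^ (2 * s))).
      by apply: ge0_ler_powR; rewrite ?nnegrE ?(ltW ss0) ?(ltW eps0) ?(ltW e10) ?(ltW epse).
    rewrite /e1 -powRrM mulVf ?gt_eqF// powRr1// !divr_ge0 ?mulr_ge0 ?addr_ge0 ?(ltW Vm0) ?(ltW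
      th0)//.
  rewrite ler_pdivlMr in h; last by rewrite ltr_wpDl.
  apply: le_trans h; rewrite ler_wpM2l ?powR_ge0// lerDl ler01//.
apply: (@eigenvalue_le_basis _ _ s p eps V (u eps) k (excess (fun j => eball (xi0 j) r) (u eps)
  th)).
- move=> j; exact: (Hs_excess s0 s1 mA r0 th0 sepA u2 u0 uA (ltW C0) (fun t x y => kernel_sep t
  x y) j uHs).
- apply: (@excess_free _ _ k _ (u eps) th r (xi eps)) => //.
    by move=> j; exact: open_eball.
  by move=> j; split; [exact: xie|exact: lt_le_trans thd (hde j)].
- move=> c vne.
  apply: (rayleigh_excess s0 s1 p1 mV VVm VVM sol uM mA r0 th0 sepA uA (ltW C0) (fun t x y =>
    kernel_sep t x y) _ _ _ _ _ hdl vne) => //.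
  exact: ltW.
Unshelve. all: by end_near. Qed.
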